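(* Let $M$ be a connected complex manifold and let $V$ be a norming volume form on $M$. Let $B_V$ be the closed unit ball in $L^1(M,V)$. Then the set $PSH^-_1(M,V)=PSH^-(M)\cap B_V$ is compact in $L^1(M,V)$.
   Context: For a positive continuous volume form $V$ on a complex manifold $M$ (with associated measure $dV$), $L^1(M,V)$ is the Banach space of measurable functions $u$ on $M$ (modulo equality a.e.) with $\|u\|_V=\int_M|u|\,dV<\infty$; for a measurable set $E\subset M$, put $\|u\|_{L^1(E,V)}=\int_E|u|\,dV$. ''Negative'' means $\le 0$, and negative plurisubharmonic functions are assumed not to be identically $-\infty$. $PSH^-(M)$ denotes the cone of all negative plurisubharmonic functions on $M$. The notation $A\Subset M$ means that $A$ is relatively compact in $M$. A positive continuous volume form $V$ on $M$ is called norming if for each compact set $F\subset M$ there is a constant $C(F)>0$, and for every increasing sequence of open sets $M_j\Subset M$ with $\bigcup_j M_j=M$ there is a sequence of numbers $\varepsilon_j>0$ converging to $0$, such that for every negative plurisubharmonic function $u$ on $M$: (1) $\|u\|_V<\infty$; (2) $u(z)\le -C(F)\|u\|_V$ for every $z\in F$; (3) $\|u\|_{L^1(M\setminus M_j,V)}\le\varepsilon_j\|u\|_V$ for every $j$. (The constants $C(F)$ and $\varepsilon_j$ do not depend on $u$.) *)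

(* Defs.v *)
From HB Require Import structures.
From mathcomp Require Import all_boot all_order all_algebra complex.
From mathcomp Require Import all_classical all_reals all_analysis.
From mathcomp Require Import measurable_realfun.

Set Implicit Arguments.
Unset Strict Implicit.
Unset Printing Implicit Defensive.

Import Order.TTheory GRing.Theory Num.Theory.
Import numFieldNormedType.Exports.

Local Open Scope classical_set_scope.
Local Open Scope ring_scope.
Local Open Scope complex_scope.

(* The usual topology of R[i], so that 'rV[R[i]]_n is the normed space C^n. *)
HB.instance Definition _ (R : realType) := NormedModule.copy R[i] R[i]^o.

(** Complex manifolds *)

(* Pure dimension n, Hausdorff and second countable. [chart_map i] is a
   homeomorphism from the open set [chart_dom i] onto an open set of C^n, with
   inverse [chart_inv i]; the values of [chart_map i] and [chart_inv i] outside
   these sets are irrelevant. Differentiability is over the field R[i], i.e. it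
   is complex differentiability. *)
Record complex_manifold (R : realType) (n : nat) (M : ptopologicalType) :=
  ComplexManifold {
    chart : Type;
    chart_dom : chart -> set M;
    chart_map : chart -> M -> 'rV[R[i]]_n;
    chart_inv : chart -> 'rV[R[i]]_n -> M;
    chart_dom_open : forall i, open (chart_dom i);
    chart_dom_cover : \bigcup_i chart_dom i = [set: M];
    chart_map_open : forall i, open (chart_map i @` chart_dom i);
    chart_mapK : forall i x, chart_dom i x -> chart_inv i (chart_map i x) = x;
    chart_map_continuous :
      forall i, {within chart_dom i, continuous (chart_map i)};
    chart_inv_continuous :
      forall i, {within chart_map i @` chart_dom i, continuous (chart_inv i)};
    transition_holomorphic : forall i j x, chart_dom i x -> chart_dom j x ->
      differentiable (chart_map j \o chart_inv i) (chart_map i x);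
    manifold_hausdorff : hausdorff_space M;
    manifold_second_countable : @second_countable M
  }.

(** Lebesgue measure on C^n *)

Record measure_space (R : realType) := MeasureSpace {
  ms_display : measure_display;
  ms_type : measurableType ms_display;
  ms_measure : {sigma_finite_measure set ms_type -> \bar R}
}.

Section product_sigma_finite.
Context d1 d2 (T1 : measurableType d1) (T2 : measurableType d2) (R : realType).
Variable m1 : {sigma_finite_measure set T1 -> \bar R}.
Variable m2 : {sigma_finite_measure set T2 -> \bar R}.

(* The library's sigma-finite instance on m1 \x m2 is not canonical: it is
   shadowed by the one for subprobabilities. *)
Definition sigma_product : set (T1 * T2)%type -> \bar R := (m1 \x m2)%E.

HB.instance Definition _ := Measure.on sigma_product.

Let sigma_product_sigma_finite :
  sigma_finite [set: (T1 * T2)%type] sigma_product.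
Proof.
have /sigma_finiteP[F [TF ndF Foo]] := sigma_finiteT m1.
have /sigma_finiteP[G [TG ndG Goo]] := sigma_finiteT m2.
exists (fun k => F k `*` G k).
  rewrite -setXTT TF TG predeqE => -[x y]; split.
    move=> [/= [k _ Fkx] [l _ Gly]]; exists (maxn k l) => //; split.
    - by move: x Fkx; exact/subsetPset/ndF/leq_maxl.
    - by move: y Gly; exact/subsetPset/ndG/leq_maxr.
  by move=> [k _ []/= ? ?]; split; exists k.
move=> k; have [? ?] := Foo k; have [? ?] := Goo k.
split; first exact: measurableX.
by rewrite /sigma_product product_measure1E// lte_mul_pinfty// ge0_fin_numE.
Qed.

HB.instance Definition _ :=
  Measure_isSigmaFinite.Build _ _ _ sigma_product sigma_product_sigma_finite.

End product_sigma_finite.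

(* (R * R)^n with the product of 2n copies of the Lebesgue measure of R,
   and its identification [to_Cn] with C^n. *)
Fixpoint real_Cn (R : realType) (n : nat) : measure_space R :=
  match n with
  | 0 => MeasureSpace (\d_tt : {sigma_finite_measure set unit -> \bar R})
  | n'.+1 => MeasureSpace
      (sigma_product (sigma_product (@lebesgue_measure R) (@lebesgue_measure R))
         (ms_measure (real_Cn R n')) : {sigma_finite_measure set _ -> \bar R})
  end.

Fixpoint to_Cn (R : realType) (n : nat) :
    ms_type (real_Cn R n) -> 'rV[R[i]]_n :=
  match n with
  | 0 => fun=> 0
  | n'.+1 => fun p =>
      row_mx (const_mx (p.1.1 +i* p.1.2) : 'rV_1) (to_Cn p.2) : 'rV_(1 + n')
  end.

Definition Cn_integral (R : realType) (n : nat) (D : set 'rV[R[i]]_n)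
    (f : 'rV[R[i]]_n -> \bar R) : \bar R :=
  (\int[ms_measure (real_Cn R n)]_(t in @to_Cn R n @^-1` D) f (to_Cn t))%E.

(** Volume forms *)

Definition borel (T : ptopologicalType) := g_sigma_algebraType (@open T).

(* A positive continuous (n, n)-form is given in the chart i, with
   z = chart_map i, by
     density i * (i/2)^n dz_1 /\ d(conj z_1) /\ ... /\ dz_n /\ d(conj z_n),
   whence the transformation law; [vol] is the associated measure dV, which is
   determined by the densities. *)
Record volume_form (R : realType) (n : nat) (M : ptopologicalType)
    (X : complex_manifold R n M) := VolumeForm {
  density : chart X -> 'rV[R[i]]_n -> R;
  density_continuous :
    forall i, {within chart_map i @` chart_dom i, continuous (density i)};
  density_gt0 : forall i x, chart_dom i x -> 0 < density i (chart_map i x);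
  density_transition : forall i j x, chart_dom i x -> chart_dom j x ->
    density i (chart_map i x) =
    density j (chart_map j x) *
      ComplexField.Normc.normc
        (\det (jacobian (chart_map j \o chart_inv i) (chart_map i x))) ^+ 2;
  vol : {measure set (borel M) -> \bar R};
  volE : forall i (A : set (borel M)), measurable A -> A `<=` chart_dom i ->
    vol A = Cn_integral (chart_map i @` A) (fun z => (density i z)%:E)
}.

(** Plurisubharmonic functions *)

Definition circle_mean (R : realType) (n : nat) (v : 'rV[R[i]]_n -> \bar R)
    (z w : 'rV[R[i]]_n) : \bar R :=
  (((2 * pi)^-1)%:E * \int[@lebesgue_measure R]_(t in `[0%R, (2 * pi)%R])
     v (z + (cos t +i* sin t) *: w)%R)%E.

Definition psh_on (R : realType) (n : nat) (D : set 'rV[R[i]]_n)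
    (v : 'rV[R[i]]_n -> \bar R) :=
  [/\ forall z, D z -> (v z < +oo)%E,
      forall a : R, open (D `&` [set z | (v z < a%:E)%E]) &
      forall z w, (forall c : R[i], `|c| <= 1 -> D (z + c *: w)) ->
        (v z <= circle_mean v z w)%E].

Section norming.
Context (R : realType) (n : nat) (M : ptopologicalType).
Variable X : complex_manifold R n M.

Definition psh (u : M -> \bar R) :=
  forall i, psh_on (@chart_map _ _ _ X i @` chart_dom i) (u \o chart_inv i).

(* PSH^-(M) *)
Definition negative_psh : set (M -> \bar R) :=
  [set u | [/\ psh u, forall x, (u x <= 0)%E & exists x, u x != -oo%E]].

Variable V : volume_form X.

Definition L1norm_on (E : set M) (u : M -> \bar R) : \bar R :=
  (\int[vol V]_(x in (E : set (borel M))) `|u x|)%E.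

Definition L1norm (u : M -> \bar R) : \bar R := L1norm_on [set: M] u.

Definition exhaustion (U : (set M)^nat) :=
  [/\ forall j, open (U j), forall j, precompact (U j),
      forall j, U j `<=` U j.+1 & \bigcup_j U j = [set: M]].

Definition norming :=
  [/\ forall u, negative_psh u -> (L1norm u < +oo)%E,
      forall F : set M, compact F -> exists2 C : R, 0 < C &
        forall u, negative_psh u ->
          forall z, F z -> (u z <= - (C%:E * L1norm u))%E &
      forall U, exhaustion U -> exists eps : R^nat,
        [/\ forall j, 0 < eps j, eps @ \oo --> (0 : R) &
            forall u, negative_psh u ->
              forall j, (L1norm_on (~` U j) u <= (eps j)%:E * L1norm u)%E]].

End norming.

(** The space L^1 *)

(* Elements are a.e.-equality classes of Borel functions; [L1_fun f] is a
   representative of f. *)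
Definition L1 d (T : measurableType d) (R : realType)
    (mu : {measure set T -> \bar R}) := LspaceType mu (@lexx _ _ 1%E).

Section L1_metric.
Context d (T : measurableType d) (R : realType).
Variable mu : {measure set T -> \bar R}.

HB.instance Definition _ := gen_eqMixin (L1 mu).
HB.instance Definition _ := gen_choiceMixin (L1 mu).

Definition L1_fun (f : L1 mu) : T -> R := f.

Definition L1_dist (f g : L1 mu) : R :=
  fine ('N[mu]_1[EFin \o (L1_fun f \- L1_fun g)%R])%E.

Let mL1 (f : L1 mu) : measurable_fun [set: T] (L1_fun f).
Proof. exact: (@measurable_funPT _ _ _ _ (repr (f : {mfun_ mu, T >-> _}))). Qed.

Let L1_fun_fin (f : L1 mu) : ('N[mu]_1[EFin \o L1_fun f] < +oo)%E.
Proof. exact: (@Lebesgue_finite _ _ _ _ _ _ f). Qed.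

Let LnormN (h : T -> R) :
  ('N[mu]_1[EFin \o (\- h)%R] = 'N[mu]_1[EFin \o h])%E.
Proof. exact: (oppe_Lnorm mu (EFin \o h)). Qed.

Let L1_distE (f g : L1 mu) :
  (L1_dist f g)%:E = ('N[mu]_1[EFin \o (L1_fun f \- L1_fun g)%R])%E.
Proof.
rewrite /L1_dist fineK// ge0_fin_numE ?Lnorm_ge0//.
apply: (@le_lt_trans _ _ ('N[mu]_1[EFin \o L1_fun f] +
                          'N[mu]_1[EFin \o (\- L1_fun g)%R])%E).
  by apply: eminkowski => //; exact: measurableT_comp.
by rewrite LnormN lte_add_pinfty.
Qed.

Let L1_distxx f : L1_dist f f = 0.
Proof.
apply: EFin_inj; rewrite L1_distE Lnorm1.
by under eq_integral do rewrite /= subrr normr0; rewrite integral0.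
Qed.

Let L1_dist_sym f g : L1_dist f g = L1_dist g f.
Proof.
apply: EFin_inj; rewrite !L1_distE -LnormN.
by apply: eq_Lnorm => x /=; rewrite opprB.
Qed.

Let L1_dist_triangle g f h : L1_dist f h <= L1_dist f g + L1_dist g h.
Proof.
rewrite -lee_fin EFinD !L1_distE.
rewrite (_ : (L1_fun f \- L1_fun h)%R =
  ((L1_fun f \- L1_fun g) \+ (L1_fun g \- L1_fun h))%R).
  by apply: eminkowski => //; exact: measurable_funB.
by apply/funext => x /=; rewrite subrKA.
Qed.

Let L1_dist_positivity f g : L1_dist f g = 0 -> f = g.
Proof.
move=> dfg; have := L1_distE f g; rewrite dfg => /esym N0.
have fg0 : (EFin \o (L1_fun f \- L1_fun g)%R = \0 %[ae mu])%E.
  apply: Lnorm_eq0_eq0 N0 => //.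
  by apply/measurable_EFinP; exact: measurable_funB.
have fg : f = g :> {mfun_ mu, T >-> measurableTypeR R}.
  rewrite -[LHS]reprK -[RHS]reprK; apply/eqmodP/asboolP.
  by apply: filterS fg0 => x /(_ I) [] /subr0_eq.
case: f g fg {dfg N0 fg0} => f [[Hf]] [g [[Hg]]] /= fg.
by case: _ / fg Hg => Hg; rewrite (Prop_irrelevance Hf Hg).
Qed.

HB.instance Definition _ := isMetric.Build R (L1 mu)
  L1_distxx L1_dist_positivity L1_dist_sym L1_dist_triangle.

End L1_metric.

(* The classes in L^1(M, V) of the elements of PSH^-(M), intersected with the
   closed unit ball. *)
Definition negative_psh1 (R : realType) (n : nat) (M : ptopologicalType)
    (X : complex_manifold R n M) (V : volume_form X) : set (L1 (vol V)) :=
  [set f | exists2 u, negative_psh X u &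
             {ae vol V, forall x : borel M, (L1_fun f x)%:E = u x}] `&`
  [set f | ('N[vol V]_1[EFin \o L1_fun f] <= 1)%E].

Arguments negative_psh1 {R n M X} V.

(* Main.v *)
Require Import Defs.
From HB Require Import structures.
From mathcomp Require Import all_boot all_order all_algebra complex.
From mathcomp Require Import all_classical all_reals all_analysis.
From mathcomp Require Import measurable_realfun.
From mathcomp Require Import ring lra.

(* Write s = - u. The classes in question have Borel representatives s >= 0
   that lie above their circle means in every holomorphic disc, and integral at
   most 1.

   Precompactness: since rotations of C^n preserve Lebesgue measure, s lies,
   in a coordinate ball, above its convolution with the normalized Lipschitz
   kernel max(0, r - |w|), and the mass of the difference against a fixed
   cutoff is O(r). The convolutions are equi-Lipschitz, so along an ultrafilter
   they become uniformly close at each scale r, hence the functions s become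
   close in L^1 of a smaller ball. Finitely many balls cover a set of the
   exhaustion by finite unions of balls of a countable cover, and by the third
   norming property the mass outside it is uniformly small.

   Closedness: the pointwise lower limit S of a rapidly convergent sequence
   satisfies the same mean inequalities by Fatou. Its lower semicontinuous
   regularization still dominates the convolutions, so by the O(r) estimate it
   equals S almost everywhere; it is the opposite of a plurisubharmonic
   function. *)

Set Implicit Arguments.
Unset Strict Implicit.
Unset Printing Implicit Defensive.

Import Order.TTheory GRing.Theory Num.Theory.
Import numFieldNormedType.Exports.

Local Open Scope classical_set_scope.
Local Open Scope ring_scope.
Local Open Scope complex_scope.

Local Notation normc := ComplexField.Normc.normc.

(** * The real norm of C^n *)

(** The mean inequality is one-sided, yet it controls distances in L^1: [s] minus its normalized
    convolution is nonnegative, so its L^1 norm is its integral, and Fubini estimates that integral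
    by moving the averaging from [s] onto the cutoff.

    The norm of C^n is the maximum norm, so coordinate balls are polydiscs. The kernel depends on
    this norm alone and is therefore unchanged when all coordinates are multiplied by a common
    phase. This is the symmetry that turns a convolution into a mean of circle means; that Lebesgue
    measure shares it is proved by shears in each real plane.

    In the closedness part the disc inequality and semicontinuity behave differently: the former
    survives pointwise lower limits, the latter does not. Regularizing restores it, at the risk of
    altering the function on a set of positive measure; the defect estimate excludes this. That the
    limit is not identically -oo follows from its finite integral and the positive volume of [M]. *)

Lemma normc_le_ReIm (R : realType) (c : R[i]) :
  normc c <= `|complex.Re c| + `|complex.Im c|.
Proof.
rewrite -lecR rmorphD /= -[leLHS]/`|c| {1}(complexE c); apply: (le_trans (ler_normD _ _)).
rewrite lerD//; first by rewrite normc_def /= expr0n addr0 sqrtr_sqr.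
rewrite normrM (_ : `|'i| = 1) ?mul1r; last first.
  by rewrite normc_def /= expr0n expr1n add0r sqrtr1.
by rewrite normc_def /= expr0n addr0 sqrtr_sqr.
Qed.

Section complex_row_vectors.
Context (R : realType) (n : nat).
Notation E := 'rV[R[i]]_n.
Implicit Types (z w : E) (r : R).

(** The norm of ['rV[R[i]]_n] takes its values in [R[i]]; this is the same number as an element of
    [R]. It is the maximum of the moduli of the coordinates. *)
Definition rnorm z : R := complex.Re `|z|.

Lemma rnormE z : `|z| = (rnorm z)%:C.
Proof. by rewrite /rnorm RRe_real// normr_real. Qed.

Lemma rnorm_ge0 z : 0 <= rnorm z.
Proof. by rewrite -lecR -rnormE normr_ge0. Qed.

Lemma rnorm0 : rnorm 0 = 0.
Proof. by rewrite /rnorm normr0. Qed.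

Lemma rnormD z w : rnorm (z + w) <= rnorm z + rnorm w.
Proof. by rewrite -lecR rmorphD/= -!rnormE ler_normD. Qed.

Lemma rnormN z : rnorm (- z) = rnorm z.
Proof. by rewrite /rnorm normrN. Qed.

Lemma rnormB z w : rnorm (z - w) = rnorm (w - z).
Proof. by rewrite -rnormN opprB. Qed.

Lemma rnormZ (c : R[i]) z : rnorm (c *: z) = normc c * rnorm z.
Proof. by apply: complexI; rewrite -rnormE normrZ rnormE rmorphM. Qed.

Lemma rnorm_dist_le z w : `|rnorm z - rnorm w| <= rnorm (z - w).
Proof.
rewrite ler_norml lerBrDr lerBlDr; apply/andP; split.
  rewrite addrC lerBlDr -[leLHS]/(rnorm w) addrC.
  by rewrite -{1}(subrK z w) (rnormB z); exact: rnormD.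
by rewrite -{1}(subrK w z); exact: rnormD.
Qed.

Definition rball z r := [set y | rnorm (y - z) < r].

Lemma rball_ball z r : rball z r = ball z (r%:C).
Proof.
apply/seteqP; split => y; rewrite -ball_normE /= -normrN opprB rnormE ltcR; exact.
Qed.

Lemma nbhs_rballP z (A : set E) :
  nbhs z A <-> exists2 r, 0 < r & rball z r `<=` A.
Proof.
split=> [/nbhs_ballP[/= e e0 zeA]|[r r0 rA]].
  have er : e = (complex.Re e)%:C by rewrite RRe_real// gtr0_real.
  exists (complex.Re e); first by rewrite -ltcR -er.
  by rewrite rball_ball -er.
by apply/nbhs_ballP; exists r%:C => /=; [rewrite ltcR|rewrite -rball_ball].
Qed.

Lemma rball_open z r : open (rball z r).
Proof.
rewrite openE => y; rewrite /rball /= => yr; apply/nbhs_rballP.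
exists (r - rnorm (y - z)); first by rewrite subr_gt0.
move=> x /=; rewrite /rball /= ltrBrDr; apply: le_lt_trans.
by rewrite (_ : x - z = (x - y) + (y - z)) ?rnormD// addrA subrK.
Qed.

Lemma nbhs_rball z r : 0 < r -> nbhs z (rball z r).
Proof. by move=> r0; apply/nbhs_rballP; exists r. Qed.

Lemma rnorm_ltP z r : 0 < r ->
  rnorm z < r <-> forall j, normc (z ord0 j) < r.
Proof.
move=> r0; have := rball_ball z r; rewrite predeqE => /(_ 0).
rewrite /rball /= sub0r rnormN => ->; split=> [[_ zr] j|zr].
  by rewrite -ltcR; have := zr ord0 j; rewrite -ball_normE /= mxE subr0.
split; first by rewrite ltcR.
by move=> i j; rewrite ord1 -ball_normE /= mxE subr0; have := zr j; rewrite -ltcR.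
Qed.

(** Balls with rational centers and radii [1 / (k + 1)] form a base. Second countability is what
    makes functions of two Borel variables measurable below. *)
Lemma second_countable_Cn : @second_countable E.
Proof.
pose pt (q : 'rV[rat * rat]_n) : E :=
  map_mx (fun q => ratr q.1 +i* ratr q.2) q.
exists (range (fun qk : 'rV[rat * rat]_n * nat =>
    rball (pt qk.1) qk.2.+1%:R^-1)).
  by apply: card_le_trans (card_image_le _ _) _; exact: countableP.
split=> [_ [qk _ <-]|z A /nbhs_rballP[r r0 rA]]; first exact: rball_open.
have [k kr] := ltr_add_invr (divr_gt0 r0 (ltr0n R 2)).
rewrite add0r in kr.
have {}kr : 2 * k.+1%:R^-1 < r by rewrite -ltr_pdivlMl// mulrC.
have aprx (x : R) : exists q : rat, `|x - ratr q| < k.+1%:R^-1 / 2.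
  have /rat_in_itvoo[q] : x - k.+1%:R^-1 / 2 < x + k.+1%:R^-1 / 2.
    by rewrite ltrBlDr -addrA ltrDl addr_gt0.
  rewrite in_itv /= => /andP[? ?]; exists q.
  by rewrite ltr_distlC; apply/andP.
pose q : 'rV[rat * rat]_n := \row_j
  (sval (cid (aprx (complex.Re (z ord0 j)))), sval (cid (aprx (complex.Im (z ord0 j))))).
have zq : rnorm (z - pt q) < k.+1%:R^-1.
  apply/rnorm_ltP => [|j]; first by rewrite invr_gt0.
  rewrite !mxE /=; case: cid => a /= za; case: cid => b /= zb.
  apply: le_lt_trans (normc_le_ReIm _) _; move: za zb.
  case: (z ord0 j) => x y /= xa yb.
  by rewrite (splitr k.+1%:R^-1) ltrD.
exists (rball (pt q) k.+1%:R^-1); first by split; [exists (q, k)|exact: zq].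
move=> y; rewrite /rball /= => yq; apply: rA; rewrite /rball /=.
rewrite (_ : y - z = (y - pt q) - (z - pt q)); last by rewrite opprB addrA subrK.
rewrite (le_lt_trans (rnormD _ _))// rnormN; apply: lt_trans kr.
by rewrite mulr_natl mulr2n; exact: ltrD yq zq.
Qed.

End complex_row_vectors.

(** * Borel maps into second countable spaces *)

Section borel_measurability.

Lemma bigcup_countable_measurable d (T : measurableType d) (I : Type)
    (D : set I) (F : I -> set T) :
  countable D -> (forall i, D i -> measurable (F i)) ->
  measurable (\bigcup_(i in D) F i).
Proof.
move=> /pfcard_geP[->|[f]] mF; first by rewrite bigcup_set0.
rewrite (_ : \bigcup_(i in D) F i = \bigcup_k F (f k)).
  by apply: bigcupT_measurable => k; apply: mF; exact: funS.
apply/seteqP; split=> [t [i Di Fit]|t [k _ Ft]]; last by exists (f k) => //; exact: funS.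
by have [k _ fk] := 'surj_f Di; exists k => //; rewrite fk.
Qed.

Lemma measurable_fun_borel d (T : measurableType d) (X : ptopologicalType)
    (f : T -> borel X) :
  (forall U : set X, open U -> measurable (f @^-1` U)) ->
  measurable_fun [set: T] f.
Proof.
move=> mf; apply: (measurability (@open X : set (set (borel X)))) => //.
by move=> _ [U oU <-]; rewrite setTI; exact: mf.
Qed.

Lemma open_borel (X : ptopologicalType) (U : set X) :
  open U -> measurable (U : set (borel X)).
Proof. by move=> oU; exact: sub_sigma_algebra. Qed.

Lemma measurable_borel_open d (T : measurableType d) (X : ptopologicalType)
    (f : T -> borel X) (U : set X) :
  measurable_fun [set: T] f -> open U -> measurable (f @^-1` U).
Proof.
by move=> mf oU; rewrite -[X in measurable X]setTI; apply: mf => //; exact: open_borel.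
Qed.

(** An open subset of a product of second countable spaces is a countable union of open rectangles,
    and the preimage of a rectangle is an intersection of two measurable sets. *)
Lemma measurable_open_pair d (T : measurableType d) (X Y : ptopologicalType)
    (f : T -> borel X) (g : T -> borel Y) (O : set (X * Y)) :
  @second_countable X -> @second_countable Y ->
  measurable_fun [set: T] f -> measurable_fun [set: T] g -> open O ->
  measurable [set t | O (f t, g t)].
Proof.
move=> [B cB [oB bB]] [C cC [oC bC]] mf mg oO.
pose I := [set bc : set X * set Y | [/\ B bc.1, C bc.2 & bc.1 `*` bc.2 `<=` O]].
have cI : countable I.
  apply: (@sub_countable _ _ _ (B `*` C)); last exact: countableX.
  by apply: subset_card_le => -[U V] [].
rewrite (_ : mkset _ = \bigcup_(bc in I) (f @^-1` bc.1 `&` g @^-1` bc.2)).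
  apply: bigcup_countable_measurable => // -[U V] [/= BU CV _].
  by apply: measurableI; apply: measurable_borel_open => //; [exact: oB|exact: oC].
apply/seteqP; split=> [t /= Ot|t [[U V]] [/= BU CV UVO] [/= Uf Vg]]; last exact: UVO.
move: oO; rewrite openE => /(_ _ Ot) [[P Q] /= [/bB[U [BU Uf] UP] /bC[V [CV Vg] VQ]] PQO].
exists (U, V) => //=; split=> // -[x y] [/= Ux Vy].
by apply: PQO; split; [exact: UP|exact: VQ].
Qed.

Lemma measurable_fun_continuous2 d (T : measurableType d)
    (X Y Z : ptopologicalType) (f : T -> borel X) (g : T -> borel Y)
    (h : X * Y -> Z) :
  @second_countable X -> @second_countable Y -> continuous h ->
  measurable_fun [set: T] f -> measurable_fun [set: T] g ->
  measurable_fun [set: T] (fun t => h (f t, g t) : borel Z).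
Proof.
move=> cX cY ch mf mg; apply: measurable_fun_borel => U oU.
by apply: (@measurable_open_pair _ _ _ _ _ _ (h @^-1` U)) => //; move/continuousP : ch; exact.
Qed.

Lemma continuous_measurable_borel (X Y : ptopologicalType) (f : X -> Y) :
  continuous f -> measurable_fun [set: borel X] (f : borel X -> borel Y).
Proof.
move=> /continuousP cf; apply: measurable_fun_borel => U oU.
apply: open_borel; exact: cf.
Qed.

(** Reconciles the sigma-algebra generated by the open sets with the standard one on the line, which
    the open rays generate. *)
Lemma measurable_fun_borelR d (T : measurableType d) (R : realType)
    (f : T -> R) :
  measurable_fun [set: T] (f : T -> borel R) <-> measurable_fun [set: T] f.
Proof.
split=> mf; last first.
  apply: measurable_fun_borel => U /open_measurable mU.
  by rewrite -[X in measurable X]setTI; exact: mf.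
apply: (measurability _ (RGenOInfty.measurableE R)) => // _ [_ [x ->] <-].
by rewrite setTI; apply: measurable_borel_open => //; exact: interval_open.
Qed.

Lemma second_countable_realType (R : realType) : @second_countable R.
Proof.
exists (range (fun q : rat * rat => `]ratr q.1 : R, ratr q.2[%classic)).
  by apply: card_le_trans (card_image_le _ _) _; exact: countableP.
split=> [_ [q _ <-]|x A /nbhs_ballP[e /= e0 eA]]; first exact: interval_open.
have [|p] := @rat_in_itvoo R (x - e) x; first by rewrite ltrBlDr ltrDl.
have [|q] := @rat_in_itvoo R x (x + e); first by rewrite ltrDl.
rewrite !in_itv /= => /andP[xq qe] /andP[ep px].
exists `]ratr p : R, ratr q[%classic.
  by split; [exists (p, q)|rewrite /= in_itv /= px].
move=> y /=; rewrite in_itv /= => /andP[py yq]; apply: eA.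
rewrite /ball /= ltr_distlC; apply/andP; split.
  exact: lt_trans ep py.
exact: lt_trans yq qe.
Qed.

End borel_measurability.

(** * Lebesgue measure on C^n *)

Section measure_preserving.
Context (R : realType).

Definition measure_preserving d (T : measurableType d)
    (m : {measure set T -> \bar R}) (f : T -> T) :=
  measurable_fun [set: T] f /\
  forall A, measurable A -> m (f @^-1` A) = m A.

Lemma ex_pushforward d (T : measurableType d) d' (T' : measurableType d')
    (m : {measure set T -> \bar R}) (f : T -> T') :
  measurable_fun [set: T] f ->
  exists m' : {measure set T' -> \bar R}, forall A, m' A = m (f @^-1` A).
Proof. by move=> mf; unshelve eexists (pushforward m f : {measure set T' -> \bar R}). Qed.

Lemma measure_preserving_comp d (T : measurableType d)
    (m : {measure set T -> \bar R}) (f g : T -> T) :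
  measure_preserving m f -> measure_preserving m g ->
  measure_preserving m (f \o g).
Proof.
move=> [mf fm] [mg gm]; split=> [|A mA]; first exact: measurableT_comp.
by rewrite comp_preimage gm ?fm// -[X in measurable X]setTI; exact: mf.
Qed.

Lemma measure_preserving_id d (T : measurableType d)
    (m : {measure set T -> \bar R}) : measure_preserving m id.
Proof. by split. Qed.

Context d1 d2 (T1 : measurableType d1) (T2 : measurableType d2).
Variable m1 : {sigma_finite_measure set T1 -> \bar R}.
Variable m2 : {sigma_finite_measure set T2 -> \bar R}.

(** The product measure integrates the measures of slices in one fixed order. Uniqueness of a
    measure with given values on rectangles permits the other order, which is needed for maps that
    move the first coordinate. *)
Lemma sigma_product2E A : measurable A ->
  sigma_product m1 m2 A = (m1 \x^ m2)%E A.
Proof.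
move=> mA; apply: (product_measure_unique (m' := (m1 \x^ m2)%E)) => //.
by move=> B C mB mC; exact: product_measure2E.
Qed.

Lemma measure_preserving_prod f g :
  measure_preserving m1 f -> measure_preserving m2 g ->
  measure_preserving (sigma_product m1 m2) (fun p => (f p.1, g p.2)).
Proof.
move=> [mf fm] [mg gm].
have mfg : measurable_fun [set: T1 * T2] (fun p => (f p.1, g p.2)).
  apply/measurable_fun_pairP; split.
    exact: (measurableT_comp mf measurable_fst).
  exact: (measurableT_comp mg measurable_snd).
split=> // A mA; have [m' m'E] := ex_pushforward (sigma_product m1 m2) mfg.
rewrite -m'E; apply/esym; apply: product_measure_unique => // B C mB mC.
rewrite m'E -fm// -gm//; apply: product_measure1E.
  by rewrite -[X in measurable X]setTI; exact: mf.
by rewrite -[X in measurable X]setTI; exact: mg.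
Qed.

(** Cavalieri's principle: the measure of a set is the integral of the measures of its slices, and
    [f] preserves each of these. *)
Lemma measure_preserving_fiber1 (f : T1 * T2 -> T1 * T2) :
  measurable_fun [set: T1 * T2] f ->
  (forall p, (f p).1 = p.1) ->
  (forall x, measure_preserving m2 (fun y => (f (x, y)).2)) ->
  measure_preserving (sigma_product m1 m2) f.
Proof.
move=> mf f1 fp; split=> // A mA; rewrite /sigma_product /product_measure1.
apply: eq_integral => x _ /=; rewrite -[RHS](fp x).2; last exact: measurable_xsection.
congr (m2 _); apply/seteqP; split=> y; rewrite /xsection /= !inE /=.
  by have := f1 (x, y); case: (f _) => a b /= ->.
by have := f1 (x, y); case: (f _) => a b /= ->.
Qed.

Lemma measure_preserving_fiber2 (f : T1 * T2 -> T1 * T2) :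
  measurable_fun [set: T1 * T2] f ->
  (forall p, (f p).2 = p.2) ->
  (forall y, measure_preserving m1 (fun x => (f (x, y)).1)) ->
  measure_preserving (sigma_product m1 m2) f.
Proof.
move=> mf f2 fp; split=> // A mA.
have mfA : measurable (f @^-1` A) by rewrite -[X in measurable X]setTI; exact: mf.
transitivity ((m1 \x^ m2)%E (f @^-1` A)); first exact: sigma_product2E.
transitivity ((m1 \x^ m2)%E A); last by apply/esym; exact: sigma_product2E.
apply: eq_integral => y _ /=; rewrite -[RHS](fp y).2; last exact: measurable_ysection.
congr (m1 _); apply/seteqP; split=> x; rewrite /ysection /= !inE /=.
  by have := f2 (x, y); case: (f _) => a b /= ->.
by have := f2 (x, y); case: (f _) => a b /= ->.
Qed.

End measure_preserving.

Section lebesgue_plane.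
Context (R : realType).
Notation leb := (@lebesgue_measure R).
Notation leb2 := (sigma_product leb leb).

(** Lebesgue measure is determined by its values on half-open intervals, whose lengths are unchanged
    by a shift. *)
Lemma measure_preserving_shift (a : R) :
  measure_preserving leb (fun x : measurableTypeR R => x + a : measurableTypeR R).
Proof.
have ma : measurable_fun [set: measurableTypeR R]
    (fun x : measurableTypeR R => x + a : measurableTypeR R).
  exact: measurable_funD.
split=> // A mA; apply/esym.
have [m' m'E] := ex_pushforward leb ma.
rewrite -m'E; apply: lebesgue_measure_unique => // _ [[b c]] _ <-.
rewrite m'E [X in _ = lebesgue_measure X](_ : _ = `](b - a), (c - a)]%classic).
  rewrite !lebesgue_measure_itv /= !lte_fin ltrD2r.
  by rewrite -!EFinB opprB addrA subrK.
by apply/seteqP; split=> x /=; rewrite !in_itv /= ltrBlDr lerBrDr.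
Qed.

Lemma measure_preserving_shear1 (a : R) :
  measure_preserving leb2 (fun p => (p.1 + a * p.2, p.2)).
Proof.
apply: measure_preserving_fiber2 => //=; last first.
  by move=> y; exact: (measure_preserving_shift (a * y)).
apply/measurable_fun_pairP; split; last exact: measurable_snd.
by apply: measurable_funD => //; exact: measurable_funM.
Qed.

Lemma measure_preserving_shear2 (a : R) :
  measure_preserving leb2 (fun p => (p.1, p.2 + a * p.1)).
Proof.
apply: measure_preserving_fiber1 => //=; last first.
  by move=> y; exact: (measure_preserving_shift (a * y)).
apply/measurable_fun_pairP; split; first exact: measurable_fst.
by apply: measurable_funD => //; exact: measurable_funM.
Qed.

(* For [a != -1] a rotation is the product of three shears, whose parameters
   are minus the tangent of the half angle, the sine, and minus the tangent
   again. *)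
Lemma measure_preserving_rotation (a b : R) : a ^+ 2 + b ^+ 2 = 1 ->
  measure_preserving leb2 (fun p => (a * p.1 - b * p.2, a * p.2 + b * p.1)).
Proof.
wlog aN1 : a b / a != -1 => [wlog_rot ab|ab].
  (* The half-turn has no tangent of the half angle; it is the square of the quarter-turn. *)
  have [aN1|] := eqVneq a (-1); last by move=> aN1; exact: wlog_rot.
  have b0 : b = 0.
    by apply/eqP; rewrite -sqrf_eq0; apply/eqP; move: ab; rewrite aN1; lra.
  have /wlog_rot rot : (0 : R) != -1 by rewrite eq_sym oppr_eq0 oner_eq0.
  have /rot {}rot : (0 : R) ^+ 2 + 1 ^+ 2 = 1 by lra.
  rewrite (_ : (fun _ => _) = (fun p => (0 * p.1 - 1 * p.2, 0 * p.2 + 1 * p.1))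
     \o (fun p => (0 * p.1 - 1 * p.2, 0 * p.2 + 1 * p.1))).
    exact: measure_preserving_comp.
  by apply/funext => -[x y] /=; rewrite aN1 b0; congr (_, _); ring.
have a1 : 1 + a != 0 by rewrite addrC addr_eq0.
pose t := b / (1 + a).
have bt : b * t = 1 - a.
  by rewrite /t mulrA -expr2 (_ : b ^+ 2 = (1 - a) * (1 + a)) ?mulfK//; lra.
have ta : t * a = b - t by rewrite /t; field.
rewrite (_ : (fun _ => _) = (fun p => (p.1 + (- t) * p.2, p.2)) \o
    ((fun p => (p.1, p.2 + b * p.1)) \o (fun p => (p.1 + (- t) * p.2, p.2)))).
  apply: measure_preserving_comp; first exact: measure_preserving_shear1.
  apply: measure_preserving_comp; first exact: measure_preserving_shear2.
  exact: measure_preserving_shear1.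
apply/funext => -[x y] /=; congr (_, _); last first.
  rewrite mulrDr mulrA mulrN bt; ring.
transitivity ((1 - b * t) * x - (t + (t - t * (b * t))) * y); last ring.
by rewrite bt mulrBr mulr1 ta; ring.
Qed.

End lebesgue_plane.

Section lebesgue_Cn.
Context (R : realType).

Lemma rnorm_row_mx_lt n (c : R[i]) (v : 'rV[R[i]]_n) r : 0 < r ->
  rnorm (row_mx (const_mx c : 'rV_1) v) < r <-> normc c < r /\ rnorm v < r.
Proof.
move=> r0; split=> [/(rnorm_ltP _ r0) cv|[cr /(rnorm_ltP _ r0) vr]].
  split; first by have := cv (lshift n ord0); rewrite row_mxEl mxE.
  by apply/rnorm_ltP => // j; have := cv (rshift 1 j); rewrite row_mxEr.
apply/rnorm_ltP => // j; case: (split_ordP j) => k ->.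
  by rewrite row_mxEl mxE.
by rewrite row_mxEr.
Qed.

Let to_C (p : R * R) : 'rV[R[i]]_1 := const_mx (p.1 +i* p.2).

Let continuous_to_C : continuous to_C.
Proof.
move=> [x y] A /nbhs_rballP[r r0 rA].
have r20 : 0 < r / 2 by exact: divr_gt0.
exists (ball x (r / 2), ball y (r / 2)).
  by split; [exact: nbhsx_ballx x _ r20|exact: nbhsx_ballx y _ r20].
move=> [x' y'] /= [xx' yy']; apply: rA; rewrite /rball /=.
apply/rnorm_ltP => // j; rewrite !mxE.
apply: le_lt_trans (normc_le_ReIm _) _ => /=.
by rewrite (splitr r) ltrD// distrC.
Qed.

Let continuous_row_mx m n :
  continuous (fun p : 'rV[R[i]]_m * 'rV[R[i]]_n => row_mx p.1 p.2).
Proof.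
move=> [x y] A /nbhs_rballP[r r0 rA].
exists (rball x r, rball y r); first by split; exact: nbhs_rball.
move=> [x' y'] /= [xx' yy']; apply: rA; rewrite /rball /=.
apply/rnorm_ltP => // j.
case: (split_ordP j) => k ->; rewrite opp_row_mx add_row_mx ?row_mxEl ?row_mxEr.
  by move: k {j}; apply/rnorm_ltP.
by move: k {j}; apply/rnorm_ltP.
Qed.

Lemma measurable_to_Cn n :
  measurable_fun [set: ms_type (real_Cn R n)]
    (@to_Cn R n : _ -> borel 'rV[R[i]]_n).
Proof.
elim: n => [|n IHn] /=; first exact: measurable_cst.
pose T := ((measurableTypeR R * measurableTypeR R) * ms_type (real_Cn R n))%type.
have m1 : measurable_fun [set: T] (fun p => to_C p.1 : borel _).
  apply: (measurable_fun_continuous2 (f := fun p : T => p.1.1) (g := fun p : T => p.1.2)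
    (h := to_C)) => //; try exact: second_countable_realType.
    apply/measurable_fun_borelR.
    exact: (measurableT_comp measurable_fst measurable_fst).
  apply/measurable_fun_borelR.
  exact: (measurableT_comp measurable_snd measurable_fst).
have m2 := measurableT_comp IHn (@measurable_snd _ _ (measurableTypeR R * measurableTypeR R)%type _).
apply: (measurable_fun_continuous2
  (h := fun p : 'rV[R[i]]_1 * 'rV[R[i]]_n => row_mx p.1 p.2) _ _ _ m1 m2).
- exact: second_countable_Cn.
- exact: second_countable_Cn.
- exact: continuous_row_mx.
Qed.

Let mu n := ms_measure (real_Cn R n).

(** Only positivity and finiteness are wanted, so in the induction the disc of radius [r] in the new
    coordinate is squeezed between the squares of half-sides [r / 2] and [r]. *)
Lemma to_Cn_rball_gt0_lty n r : 0 < r ->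
  (0 < mu n (@to_Cn R n @^-1` rball 0 r) < +oo)%E.
Proof.
move=> r0; elim: n => [|n IHn].
  have -> : @to_Cn R 0 @^-1` rball 0 r = [set: unit].
    by apply/seteqP; split=> // t _; rewrite /rball /= subr0 rnorm0.
  by rewrite /mu /= diracT ltry lte01.
have mB k : measurable (@to_Cn R k @^-1` rball 0 r).
  by apply: (measurable_borel_open (@measurable_to_Cn k)); exact: rball_open.
pose sq (a : R) : set (measurableTypeR R * measurableTypeR R) := `]-a, a[ `*` `]-a, a[.
have msq a : measurable (sq a) by apply: measurableX.
have sqE a : 0 < a ->
    sigma_product (@lebesgue_measure R) (@lebesgue_measure R) (sq a) = ((2 * a) ^+ 2)%:E.
  move=> a0; apply: (etrans (product_measure1E _ _ _ _)) => //.
  have aE : @lebesgue_measure R `]-a, a[ = (2 * a)%:E.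
    by rewrite lebesgue_measure_itv /= lte_fin gtrN// -EFinB opprK mulr_natl mulr2n.
  by rewrite expr2 EFinM; congr (_ * _)%E; exact: aE.
have prodE a : 0 < a -> mu n.+1 (sq a `*` (@to_Cn R n @^-1` rball 0 r)) =
    (((2 * a) ^+ 2)%:E * mu n (@to_Cn R n @^-1` rball 0 r))%E.
  by move=> a0; rewrite -sqE//; apply: product_measure1E.
move: IHn => /andP[IHn0 IHn1]; apply/andP; split.
  have r20 : 0 < r / 2 by exact: divr_gt0.
  apply: (@lt_le_trans _ _ (mu n.+1 (sq (r / 2) `*` (@to_Cn R n @^-1` rball 0 r)))).
    by rewrite prodE// mule_gt0// lte_fin exprn_gt0// mulr_gt0.
  apply: le_measure; rewrite ?inE//; first exact: measurableX.
  move=> [[x y] v] /= [[/= xr yr] vr]; move: vr; rewrite /rball /= !subr0 => vr.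
  apply/rnorm_row_mx_lt => //; split=> //; apply: le_lt_trans (normc_le_ReIm _) _.
  by rewrite (splitr r) ltrD//= ltr_norml; move: xr yr; rewrite !in_itv.
apply: (@le_lt_trans _ _ (mu n.+1 (sq r `*` (@to_Cn R n @^-1` rball 0 r)))).
  apply: le_measure; rewrite ?inE//; first exact: measurableX.
  move=> [[x y] v] /=; rewrite /rball /= !subr0 => /(rnorm_row_mx_lt _ _ r0)[cr vr].
  split=> //; rewrite /sq /= !in_itv /= -!ltr_norml.
  move: cr; rewrite /= => cr; split; apply: le_lt_trans cr.
    by rewrite -sqrtr_sqr ler_wsqrtr// lerDl sqr_ge0.
  by rewrite -sqrtr_sqr ler_wsqrtr// lerDr sqr_ge0.
by rewrite prodE// lte_mul_pinfty// lee_fin exprn_ge0// mulr_ge0// ltW.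
Qed.

(** The measure of C^n is an image of the one on the iterated product of real planes, so invariance
    under [F] is proved by exhibiting a measure-preserving map upstairs that covers [F]. *)
Definition lifts_measure_preserving n (F : 'rV[R[i]]_n -> 'rV[R[i]]_n) :=
  exists2 tau, measure_preserving (mu n) tau &
    forall t, to_Cn (tau t) = F (to_Cn t).

Lemma lifts_translation n (w : 'rV[R[i]]_n) :
  lifts_measure_preserving (fun z => z + w).
Proof.
elim: n w => [|n IHn] w.
  exists id => [|t]; first exact: measure_preserving_id.
  by apply/rowP => -[].
have [tau tauP tauE] := IHn (@rsubmx _ _ 1 _ w).
pose c := w ord0 ord0.
exists (fun p => ((p.1.1 + complex.Re c, p.1.2 + complex.Im c), tau p.2)).
  apply: (measure_preserving_prod
    (f := fun p : measurableTypeR R * measurableTypeR R =>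
      (p.1 + complex.Re c, p.2 + complex.Im c) : measurableTypeR R * measurableTypeR R)
    (m1 := sigma_product (@lebesgue_measure R) (@lebesgue_measure R))) => //.
  exact: (measure_preserving_prod (measure_preserving_shift (complex.Re c))
    (measure_preserving_shift (complex.Im c))).
move=> [[x y] v] /=; rewrite tauE.
transitivity (row_mx (const_mx (x +i* y)) (to_Cn v) +
    row_mx (lsubmx (w : 'rV_(1 + n))) (rsubmx (w : 'rV_(1 + n))) : 'rV_(1 + n));
  last by rewrite hsubmxK.
rewrite add_row_mx; f_equal; apply/rowP => j; rewrite !mxE ord1.
rewrite (_ : lshift n ord0 = ord0); last exact/val_inj.
by rewrite -/c; case: c.
Qed.

Lemma lifts_rotation n (c : R[i]) : normc c = 1 ->
  lifts_measure_preserving (fun z : 'rV[R[i]]_n => c *: z).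
Proof.
move=> c1; elim: n => [|n [tau tauP tauE]].
  exists id => [|t]; first exact: measure_preserving_id.
  by apply/rowP => -[].
case: c c1 tauE => a b ab1 tauE.
exists (fun p => ((a * p.1.1 - b * p.1.2, a * p.1.2 + b * p.1.1), tau p.2)).
  apply: (measure_preserving_prod
    (f := fun p : measurableTypeR R * measurableTypeR R =>
      (a * p.1 - b * p.2, a * p.2 + b * p.1) : measurableTypeR R * measurableTypeR R)
    (m1 := sigma_product (@lebesgue_measure R) (@lebesgue_measure R))) => //.
  apply: measure_preserving_rotation.
  by rewrite -[LHS]sqr_sqrtr ?addr_ge0 ?sqr_ge0//; rewrite [Num.sqrt _]ab1 expr1n.
move=> [[x y] v] /=; rewrite tauE; apply: esym.
apply: (etrans (@scale_row_mx _ 1 1 n _ _ _)); f_equal.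
by apply/rowP => j; rewrite !mxE.
Qed.

End lebesgue_Cn.

Section Cn_measure.
Context (R : realType).

(** Lebesgue measure carried to the Borel sets of C^n, so that the integration theory applies there
    directly; [Cn_integralE] links it with [Cn_integral]. *)
Definition Cn_measure (n : nat) : set (borel 'rV[R[i]]_n) -> \bar R :=
  pushforward (ms_measure (real_Cn R n)) (@to_Cn R n : _ -> borel _).

Section instances.
Variable n : nat.

Let Cn_measure_measure :
  exists m' : {measure set (borel 'rV[R[i]]_n) -> \bar R},
    Cn_measure (n := n) = m'.
Proof.
have [m' m'E] := ex_pushforward (ms_measure (real_Cn R n)) (@measurable_to_Cn R n).
by exists m'; apply/funext => A; rewrite m'E.
Qed.

Let Cn_measure0 : Cn_measure (n := n) set0 = 0%E.
Proof. by have [m' ->] := Cn_measure_measure. Qed.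

Let Cn_measure_ge0 A : (0 <= Cn_measure (n := n) A)%E.
Proof. by have [m' ->] := Cn_measure_measure; exact: measure_ge0. Qed.

Let Cn_measure_sigma_additive : semi_sigma_additive (Cn_measure (n := n)).
Proof.
by have [m' ->] := Cn_measure_measure; exact: measure_semi_sigma_additive.
Qed.

HB.instance Definition _ := isMeasure.Build _ _ _ (Cn_measure (n := n))
  Cn_measure0 Cn_measure_ge0 Cn_measure_sigma_additive.

Let Cn_measure_sigma_finite : sigma_finite [set: borel 'rV[R[i]]_n] (Cn_measure (n := n)).
Proof.
exists (fun k => rball 0 k.+1%:R) => [|k].
  apply/seteqP; split=> // z _; exists (Num.truncn (rnorm z)) => //.
  by rewrite /rball /= subr0; exact: truncnS_gt.
split; first by apply: open_borel; exact: rball_open.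
by have /andP[] := @to_Cn_rball_gt0_lty R n k.+1%:R (ltr0Sn _ _).
Qed.

HB.instance Definition _ := Measure_isSigmaFinite.Build _ _ _
  (Cn_measure (n := n)) Cn_measure_sigma_finite.

End instances.

Section properties.
Variable n : nat.
Notation E := 'rV[R[i]]_n.
Notation lam := (Cn_measure (n := n)).

Lemma Cn_integralE (D : set (borel E)) (f : borel E -> \bar R) :
  measurable D -> measurable_fun D f -> (forall z, D z -> 0 <= f z)%E ->
  Cn_integral D f = (\int[lam]_(z in D) f z)%E.
Proof.
move=> mD mf f0; rewrite [RHS]ge0_integral_pushforward//.
  exact: measurable_to_Cn.
by move=> z; rewrite inE; exact: f0.
Qed.

Lemma lifts_measure_preservingP (F : E -> E) :
  measurable_fun [set: borel E] (F : borel E -> borel E) ->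
  lifts_measure_preserving F ->
  measure_preserving lam (F : borel E -> borel E).
Proof.
move=> mF [tau [mtau tauP] tauE]; split=> // A mA; rewrite /Cn_measure /pushforward.
have mA' : measurable (@to_Cn R n @^-1` A).
  by rewrite -[X in measurable X]setTI; apply: measurable_to_Cn.
apply: etrans (tauP _ mA'); congr (ms_measure _ _).
by apply/seteqP; split=> t /=; rewrite tauE.
Qed.

Lemma continuous_addr (w : E) : continuous (fun z : E => z + w).
Proof.
move=> z A /nbhs_rballP[r r0 rA]; apply/nbhs_rballP; exists r => // y yz.
by apply: rA; rewrite /rball /= opprD addrACA subrr addr0.
Qed.

Lemma measure_preserving_translation (w : E) :
  measure_preserving lam (fun z : borel E => (z : E) + w : borel E).
Proof.
apply: lifts_measure_preservingP; last exact: lifts_translation.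
by apply: (@continuous_measurable_borel E E); exact: continuous_addr.
Qed.

Lemma continuous_scale_unit (c : R[i]) : normc c = 1 ->
  continuous (fun z : E => c *: z).
Proof.
move=> c1 z A /nbhs_rballP[r r0 rA]; apply/nbhs_rballP; exists r => // y yz.
by apply: rA; rewrite /rball /= -scalerBr rnormZ c1 mul1r.
Qed.

Lemma measure_preserving_unit_scale (c : R[i]) : normc c = 1 ->
  measure_preserving lam (fun z : borel E => c *: (z : E) : borel E).
Proof.
move=> c1; apply: lifts_measure_preservingP; last exact: lifts_rotation.
by apply: (@continuous_measurable_borel E E); exact: continuous_scale_unit.
Qed.

Lemma ge0_integral_preserving d (T : measurableType d)
    (m : {measure set T -> \bar R}) (F : T -> T) (f : T -> \bar R) :
  measure_preserving m F -> measurable_fun [set: T] f ->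
  (forall z, 0 <= f z)%E -> (\int[m]_z f (F z) = \int[m]_z f z)%E.
Proof.
move=> [mF mP] mf f0.
rewrite -[LHS]/(\int[m]_(x in F @^-1` [set: T]) (f \o F) x)%E.
rewrite -ge0_integral_pushforward//.
by apply: eq_measure_integral => A mA _; exact: mP.
Qed.

Lemma Cn_measure_rball (z : E) r : 0 < r -> (0 < lam (rball z r) < +oo)%E.
Proof.
move=> r0; have [_ /(_ _ (open_borel (@rball_open _ _ z r)))] :=
  measure_preserving_translation z.
rewrite (_ : _ @^-1` _ = rball 0 r) => [<-|]; first exact: to_Cn_rball_gt0_lty.
by apply/seteqP; split=> y; rewrite /rball /= subr0 addrK.
Qed.

End properties.
End Cn_measure.

(** * Convolution with a Lipschitz kernel *)

(* Lipschitz rather than an indicator, so that convolving with it makes bounded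
   sets of L^1 equicontinuous. *)
HB.lock Definition hat (R : realType) (n : nat) (r : R) (w : 'rV[R[i]]_n) : R :=
  Num.max 0 (r - rnorm w).

(** The convolution is left unnormalized: the mass [hatmass n r] of the kernel appears as a factor
    in the inequalities instead, which avoids division of extended reals. *)
HB.lock Definition hatconv (R : realType) (n : nat) (r : R)
    (s : 'rV[R[i]]_n -> \bar R) (z : 'rV[R[i]]_n) : \bar R :=
  (\int[Cn_measure (R := R) (n := n)]_w (s w * (hat r ((w : 'rV[R[i]]_n) - z))%:E))%E.

Section hat_kernel.
Context (R : realType) (n : nat).
Notation E := 'rV[R[i]]_n.
Notation lam := (Cn_measure (R := R) (n := n)).
Implicit Types (z w : E) (r : R).

Lemma hatE r w : hat r w = Num.max 0 (r - rnorm w).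
Proof. by rewrite hat.unlock. Qed.

Lemma hat_ge0 r w : 0 <= hat r w.
Proof. by rewrite !hatE le_max lexx. Qed.

Lemma hat_le r w : 0 <= r -> hat r w <= r.
Proof. by move=> r0; rewrite !hatE ge_max r0 gerBl rnorm_ge0. Qed.

Lemma hat_ge r w : r - rnorm w <= hat r w.
Proof. by rewrite !hatE le_max lexx orbT. Qed.

Lemma hat_out r w : r <= rnorm w -> hat r w = 0.
Proof. by move=> rw; rewrite hatE; apply/max_idPl; rewrite subr_le0. Qed.

Lemma hatN r w : hat r (- w) = hat r w.
Proof. by rewrite !hatE rnormN. Qed.

Lemma hatB r z w : hat r (z - w) = hat r (w - z).
Proof. by rewrite -hatN opprB. Qed.

Lemma hatZ r (c : R[i]) w : normc c = 1 -> hat r (c *: w) = hat r w.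
Proof. by move=> c1; rewrite !hatE rnormZ c1 mul1r. Qed.

Lemma hat_lip r z w : hat r z <= hat r w + rnorm (z - w).
Proof.
rewrite [leLHS]hatE ge_max addr_ge0 ?hat_ge0 ?rnorm_ge0//=.
have := rnorm_dist_le w z; rewrite ler_norml rnormB => /andP[_].
by have := hat_ge r w; lra.
Qed.

Lemma measurable_rnormB d (T : measurableType d) (f g : T -> borel E) :
  measurable_fun [set: T] f -> measurable_fun [set: T] g ->
  measurable_fun [set: T] (fun t => rnorm ((f t : E) - (g t : E))).
Proof.
move=> mf mg; apply/measurable_fun_borelR.
apply: (measurable_fun_continuous2 (h := fun p : E * E => rnorm (p.1 - p.2))) => //.
- exact: second_countable_Cn.
- exact: second_countable_Cn.
move=> [x y] A /nbhs_ballP[e /= e0 eA].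
have e20 : 0 < e / 2 by exact: divr_gt0.
exists (rball x (e / 2), rball y (e / 2)); first by split; exact: nbhs_rball.
move=> [x' y'] /= [xx' yy']; apply: eA; rewrite -ball_normE /=.
apply: le_lt_trans (rnorm_dist_le _ _) _.
rewrite opprD opprK addrACA (splitr e) (le_lt_trans (rnormD _ _))//.
by rewrite ltrD// 1?rnormB// addrC.
Qed.

Lemma measurable_hatB d (T : measurableType d) (f g : T -> borel E) r :
  measurable_fun [set: T] f -> measurable_fun [set: T] g ->
  measurable_fun [set: T] (fun t => hat r ((f t : E) - (g t : E))).
Proof.
move=> mf mg; under eq_fun do rewrite hatE.
apply: measurable_maxr => //.
by apply: measurable_funB => //; exact: measurable_rnormB.
Qed.

Lemma measurable_EFin_hatB d (T : measurableType d) (f g : T -> borel E) r :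
  measurable_fun [set: T] f -> measurable_fun [set: T] g ->
  measurable_fun [set: T] (fun t => (hat r ((f t : E) - (g t : E)))%:E).
Proof. by move=> mf mg; apply/measurable_EFinP; exact: measurable_hatB. Qed.

Lemma measurable_hat z r :
  measurable_fun [set: borel E] (fun w : borel E => (hat r ((w : E) - z))%:E).
Proof. by apply: (measurable_EFin_hatB (g := cst (z : borel E))). Qed.

Definition hatmass r : \bar R := (\int[lam]_w (hat r w)%:E)%E.

Lemma measurable_hat0 r :
  measurable_fun [set: borel E] (fun w : borel E => (hat r w)%:E).
Proof. by have := measurable_hat 0 r; under eq_fun do rewrite subr0. Qed.

Lemma integral_hatB z r : (\int[lam]_w (hat r ((w : E) - z))%:E = hatmass r)%E.
Proof.
have h := @ge0_integral_preserving R _ _ _ _ (fun w : borel E => (hat r w)%:E)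
  (measure_preserving_translation (- z)) (measurable_hat0 r).
by apply: h => w; rewrite lee_fin hat_ge0.
Qed.

Lemma integral_hatBl z r : (\int[lam]_w (hat r (z - (w : E)))%:E = hatmass r)%E.
Proof. by under eq_integral do rewrite hatB; exact: integral_hatB. Qed.

(** The kernel is at least [r / 2] on the ball of radius [r / 2], at most [r] everywhere, and zero
    outside the ball of radius [r]. *)
Lemma hat_mass_bounds r : 0 < r -> (0 < hatmass r < +oo)%E.
Proof.
move=> r0; have r20 : 0 < r / 2 by exact: divr_gt0.
have mB a : measurable (rball 0 a : set (borel E)).
  by apply: open_borel; exact: rball_open.
apply/andP; split.
  apply: (@lt_le_trans _ _ (\int[lam]_(w in rball 0 (r / 2)) (cst (r / 2)%:E w))%E).
    rewrite integral_cst// mule_gt0 ?lte_fin//.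
    by have /andP[] := Cn_measure_rball (0 : E) r20.
  apply: (@le_trans _ _ (\int[lam]_(w in rball 0 (r / 2)) (hat r w)%:E)%E).
    apply: ge0_le_integral => //.
    - by move=> w _; rewrite lee_fin ltW.
    - by apply: measurable_funTS; exact: measurable_hat0.
    - move=> w; rewrite /rball /= subr0 => wr; rewrite lee_fin.
      by apply: le_trans (hat_ge _ _); lra.
  apply: ge0_subset_integral => //; first exact: measurable_hat0.
  by move=> w _; rewrite lee_fin hat_ge0.
rewrite /hatmass (_ : (fun w => _) = (fun w => (hat r w)%:E) \_ (rball 0 r)); last first.
  apply/funext => w; rewrite patchE; case: ifPn => // /negP wr.
  rewrite hat_out// leNgt; apply/negP => wr'; apply: wr.
  by rewrite inE /rball /= subr0.
rewrite -integral_mkcond.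
apply: (@le_lt_trans _ _ (\int[lam]_(w in rball 0 r) (cst r%:E w))%E).
  apply: ge0_le_integral => //.
  - by move=> w _; rewrite lee_fin hat_ge0.
  - by apply: measurable_funTS; exact: measurable_hat0.
  - by move=> w _; rewrite lee_fin hat_le// ltW.
rewrite integral_cst//; apply: lte_mul_pinfty => //; first by rewrite lee_fin ltW.
by have /andP[] := Cn_measure_rball (0 : E) r0.
Qed.

Lemma hatconvE r (s : E -> \bar R) z :
  (hatconv r s z = \int[lam]_w (s w * (hat r ((w : E) - z))%:E))%E.
Proof. by rewrite hatconv.unlock. Qed.

Section hatconv.
Variable s : borel E -> \bar R.
Hypothesis ms : measurable_fun [set: borel E] s.
Hypothesis s0 : forall w, (0 <= s w)%E.

Lemma hatconv_integrand_ge0 r z w : (0 <= s w * (hat r ((w : E) - z))%:E)%E.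
Proof. by rewrite mule_ge0// lee_fin hat_ge0. Qed.

Lemma hatconv_ge0 r z : (0 <= hatconv r s z)%E.
Proof. by rewrite hatconvE; apply: integral_ge0 => w _; exact: hatconv_integrand_ge0. Qed.

Lemma measurable_hatconv_integrand r z :
  measurable_fun [set: borel E] (fun w : borel E => s w * (hat r ((w : E) - z))%:E)%E.
Proof. by apply: emeasurable_funM => //; exact: measurable_hat. Qed.

(** The kernel is 1-Lipschitz, so the total mass of [s] serves as a Lipschitz constant, uniformly
    over functions of bounded mass. The additive form makes sense for infinite values too. *)
Lemma hatconv_lip r z z' :
  (hatconv r s z <= hatconv r s z' + (rnorm (z - z'))%:E * \int[lam]_w s w)%E.
Proof.
have d0 : 0 <= rnorm (z - z') := rnorm_ge0 _.
rewrite !hatconvE.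
rewrite -ge0_integralZl_EFin//.
rewrite -ge0_integralD//; first last.
- exact: measurable_funeM.
- by move=> w _; rewrite mule_ge0.
- exact: measurable_hatconv_integrand.
- by move=> w _; exact: hatconv_integrand_ge0.
apply: ge0_le_integral => //.
- by move=> w _; exact: hatconv_integrand_ge0.
- exact: measurable_hatconv_integrand.
- by apply: emeasurable_funD; [exact: measurable_hatconv_integrand|exact: measurable_funeM].
move=> w _; rewrite (muleC _%:E) -ge0_muleDr ?lee_fin ?hat_ge0//.
rewrite -EFinD lee_wpmul2l// lee_fin.
have := hat_lip r ((w : E) - z) (w - z').
by rewrite (_ : _ - _ - _ = z' - z) 1?rnormB// opprB addrC addrA subrK.
Qed.

End hatconv.

End hat_kernel.

(** * From circle means to the convolution *)

Section supermean.
Context (R : realType) (n : nat).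
Notation E := 'rV[R[i]]_n.
Notation lam := (Cn_measure (R := R) (n := n)).
Notation leb := (@lebesgue_measure R).
Implicit Types (z w : E) (r : R).

Lemma normc_cis (t : R) : normc (cos t +i* sin t) = 1.
Proof. by rewrite /= cos2Dsin2 sqrtr1. Qed.

Lemma continuous_rotation z :
  continuous (fun p : E * R => z + (cos p.2 +i* sin p.2) *: p.1).
Proof.
move=> [w t] A /nbhs_rballP[r r0 rA].
have r20 : 0 < r / 2 by exact: divr_gt0.
have M0 : 0 < 1 + rnorm w by rewrite ltr_wpDr// rnorm_ge0.
pose d := r / 2 / (1 + rnorm w) / 2.
have d0 : 0 < d by rewrite !divr_gt0.
have nc : \forall t' \near t, `|cos t' - cos t| < d.
  by have /cvgrPdistC_lt := @continuous_cos R t; exact.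
have ns : \forall t' \near t, `|sin t' - sin t| < d.
  by have /cvgrPdistC_lt := @continuous_sin R t; exact.
exists (rball w (r / 2), [set t' | `|cos t' - cos t| < d /\ `|sin t' - sin t| < d]).
  split; first exact: nbhs_rball.
  by move: nc ns; exact: filterS2.
move=> [w' t'] /= [ww' [ct st]]; apply: rA; rewrite /rball /=.
rewrite opprD addrACA subrr add0r.
rewrite (_ : _ - _ = (cos t' +i* sin t') *: (w' - w) +
   ((cos t' +i* sin t') - (cos t +i* sin t)) *: w); last first.
  by rewrite scalerBr scalerBl addrA subrK.
apply: le_lt_trans (rnormD _ _) _.
rewrite !rnormZ normc_cis mul1r (splitr r) ltr_leD//.
apply: (@le_trans _ _ (2 * d * rnorm w)).
  rewrite ler_wpM2r ?rnorm_ge0//.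
  by apply: le_trans (normc_le_ReIm _) _; rewrite /= mulr_natl mulr2n lerD// ltW.
rewrite (_ : 2 * d = r / 2 / (1 + rnorm w)); last first.
  by rewrite /d mulrC divfK.
rewrite -mulrA; apply: ler_piMr; first exact: ltW.
by rewrite ler_pdivrMl// mulr1 lerDr.
Qed.

Lemma measurable_rotation d (T : measurableType d) (f : T -> borel E) (g : T -> R) z :
  measurable_fun [set: T] f -> measurable_fun [set: T] g ->
  measurable_fun [set: T]
    (fun t => z + (cos (g t) +i* sin (g t)) *: (f t : E) : borel E).
Proof.
move=> mf /measurable_fun_borelR mg.
apply: (measurable_fun_continuous2 (h := fun p : E * R =>
  z + (cos p.2 +i* sin p.2) *: p.1)) => //.
- exact: second_countable_Cn.
- exact: second_countable_realType.
- exact: continuous_rotation.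
Qed.

(* The kernel is invariant under the rotations [w |-> e^(it) w], so by Fubini
   its convolution is a mean of circle means. *)
Lemma hatconv_le_supermean (s : borel E -> \bar R) r z :
  measurable_fun [set: borel E] s -> (forall w, (0 <= s w)%E) -> 0 < r ->
  (forall w, rnorm w < r ->
    (\int[leb]_(t in `[0%R, (2 * pi)%R]) s (z + (cos t +i* sin t) *: w)%R <=
     (2 * pi)%:E * s z)%E) ->
  (hatconv r s z <= hatmass n r * s z)%E.
Proof.
move=> ms s0 r0 sz.
have pi20 : 0 < 2 * pi :> R by rewrite mulr_gt0// pi_gt0.
pose I : set (measurableTypeR R) := `[0, 2 * pi]%classic.
have mI0 : measurable I by exact: measurable_itv.
pose F (p : borel E * measurableTypeR R) : \bar R :=
  (s (z + (cos p.2 +i* sin p.2) *: (p.1 : E))%R * (hat r p.1)%:E * (\1_I p.2)%:E)%E.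
have lI : leb I = (2 * pi)%:E.
  by rewrite lebesgue_measure_itv /= lte_fin pi20 -EFinB subr0.
have mI : measurable_fun [set: borel E * measurableTypeR R]
    (fun p => (\1_I p.2 : R)%:E).
  have mI1 : measurable_fun [set: measurableTypeR R] (\1_I : measurableTypeR R -> R).
    by apply: measurable_indic; exact: measurable_itv.
  apply/measurable_EFinP; exact: (measurableT_comp mI1 measurable_snd).
have mrot : measurable_fun [set: borel E * measurableTypeR R]
    (fun p => s (z + (cos p.2 +i* sin p.2) *: (p.1 : E))).
  by apply: (measurableT_comp ms); apply: measurable_rotation.
have mF : measurable_fun [set: borel E * measurableTypeR R] F.
  apply: emeasurable_funM => //; apply: emeasurable_funM => //.
  exact: (measurableT_comp (measurable_hat0 r) measurable_fst).
have F0 p : (0 <= F p)%E by rewrite /F !mule_ge0// lee_fin// hat_ge0.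
have cutI (g : R -> \bar R) :
    (\int[leb]_t (g t * (\1_I t)%:E) = \int[leb]_(t in I) g t)%E.
  rewrite [RHS]integral_mkcond; apply: eq_integral => t _.
  by rewrite patchE indicE; case: ifPn => _; rewrite ?mule1 ?mule0.
have mrotw w : measurable_fun [set: measurableTypeR R]
    (fun t => s (z + (cos t +i* sin t) *: w)).
  by apply: (measurableT_comp ms); apply: (measurable_rotation (f := cst (w : borel E))).
(* Integrating over the angle first, the hypothesis applies to every [w] in the support of the
   kernel. *)
have lhs : (\int[lam]_w \int[leb]_t F (w, t) <= (2 * pi)%:E * (hatmass n r * s z))%E.
  rewrite muleA muleAC [X in (X <= _)%E](_ : _ = \int[lam]_w ((hat r w)%:E *
      \int[leb]_(t in I) s (z + (cos t +i* sin t) *: (w : E))%R))%E; last first.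
    apply: eq_integral => w _; rewrite cutI /=.
    rewrite -ge0_integralZl//; last by rewrite lee_fin hat_ge0.
      by apply: eq_integral => t _; rewrite muleC.
    exact: measurable_funTS.
  apply: (@le_trans _ _ (\int[lam]_w ((2 * pi)%:E * s z * (hat r w)%:E))%E).
    apply: ge0_le_integral => //.
    - by move=> w _; rewrite mule_ge0 ?lee_fin ?hat_ge0// integral_ge0.
    - apply: emeasurable_funM; first exact: measurable_hat0.
      have mG : measurable_fun [set: borel E * measurableTypeR R] (fun p =>
        (s (z + (cos p.2 +i* sin p.2) *: (p.1 : E))%R * (\1_I p.2)%:E)%E).
        exact: emeasurable_funM.
      have := measurable_fun_fubini_tonelli_F (m2 := leb) _ mG.
      rewrite /fubini_F; under eq_fun do rewrite cutI.
      by apply => p; rewrite mule_ge0// lee_fin.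
    - by apply: measurable_funeM; exact: measurable_hat0.
    move=> w _; have [rw|wr] := leP r (rnorm w); first by rewrite hat_out// mul0e mule0.
    by rewrite muleC lee_wpmul2r ?lee_fin ?hat_ge0// sz.
  rewrite ge0_integralZl//; first exact: measurable_hat0.
  - by move=> w _; rewrite lee_fin hat_ge0.
  - by rewrite mule_ge0// lee_fin ltW.
(* Integrating over [w] first, the rotation is absorbed by the measure and by the kernel, so the
   inner integral is the same for all angles in [I]. *)
have rhs : (\int[leb]_t \int[lam]_w F (w, t) = (2 * pi)%:E * hatconv r s z)%E.
  have mg : measurable_fun [set: borel E]
      (fun w : borel E => s (z + (w : E))%R * (hat r w)%:E)%E.
    apply: emeasurable_funM; last exact: measurable_hat0.
    apply: (measurableT_comp ms); apply: (@continuous_measurable_borel E E).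
    rewrite (_ : +%R z = (fun w => w + z)); first exact: continuous_addr.
    by apply/funext => w; rewrite addrC.
  have g0 w : (0 <= s (z + w)%R * (hat r w)%:E)%E by rewrite mule_ge0// lee_fin hat_ge0.
  have rotE t : (\int[lam]_w (s (z + (cos t +i* sin t) *: (w : E))%R * (hat r w)%:E) =
      hatconv r s z)%E.
    have h1 := ge0_integral_preserving (measure_preserving_unit_scale n (normc_cis t)) mg g0.
    have h2 := ge0_integral_preserving (measure_preserving_translation (- z)) mg g0.
    transitivity (\int[lam]_w (s (z + (w : E))%R * (hat r w)%:E))%E.
      rewrite -h1; apply: eq_integral => w _; congr (_ * _%:E)%E.
      exact/esym/hatZ/normc_cis.
    by rewrite hatconvE -h2; apply: eq_integral => w _; rewrite addrC subrK.
  have inner t : (\int[lam]_w F (w, t) = hatconv r s z * (\1_I t)%:E)%E.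
    rewrite -(rotE t) /F /=; apply: ge0_integralZr.
    - exact: measurableT.
    - apply: emeasurable_funM; last exact: measurable_hat0.
      by apply: (measurableT_comp ms); apply: (measurable_rotation (g := cst t)).
    - by move=> w _; rewrite mule_ge0// lee_fin hat_ge0.
    - by rewrite lee_fin.
  under eq_integral do rewrite inner.
  rewrite cutI integral_cst// muleC; congr (_ * _)%E.
  exact: lI.
have := lhs; rewrite fubini_tonelli// rhs lee_pmul2l//.
Qed.

End supermean.

(** * Mass lost by convolving *)

Section defect_estimate.
Context (R : realType) (n : nat).
Notation E := 'rV[R[i]]_n.
Notation lam := (Cn_measure (R := R) (n := n)).
Implicit Types (z w : E) (r : R).

Lemma measurable_rball z r : measurable (rball z r : set (borel E)).
Proof. by apply: open_borel; exact: rball_open. Qed.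

Section defect.
Variable s : borel E -> \bar R.
Hypothesis ms : measurable_fun [set: borel E] s.
Hypothesis s0 : forall w, (0 <= s w)%E.

Let measurable_pair r : measurable_fun [set: borel E * borel E]
  (fun p : borel E * borel E => s p.2 * (hat r ((p.2 : E) - (p.1 : E)))%:E)%E.
Proof.
apply: emeasurable_funM; first exact: (measurableT_comp ms measurable_snd).
by apply: measurable_EFin_hatB.
Qed.

Lemma measurable_hatconv r : measurable_fun [set: borel E] (hatconv r s : borel E -> \bar R).
Proof.
have := measurable_fun_fubini_tonelli_F (m2 := lam) _ (measurable_pair r).
rewrite (_ : fubini_F _ _ = (hatconv r s : borel E -> \bar R)); last first.
  by apply/funext => z; rewrite hatconvE.
by apply => p; rewrite mule_ge0// lee_fin hat_ge0.
Qed.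

(* The test function [hat a (_ - z0)] is 1-Lipschitz, so averaging it over
   balls of radius [r] loses at most [r]; by Fubini the averaging moves to
   [s]. *)
Lemma hatconv_defect (z0 : E) a r : 0 < a -> 0 < r ->
  (hatmass n r * \int[lam]_w (s w * (hat a ((w : E) - z0))%:E) <=
   \int[lam]_w ((hat a ((w : E) - z0))%:E * hatconv r s w) +
   r%:E * hatmass n r * \int[lam]_(w in rball z0 a) s w)%E.
Proof.
move=> a0 r0.
have /andP[m0 moo] : (0 < hatmass n r < +oo)%E := hat_mass_bounds n r0.
pose phi w := hat a (w - z0).
have mphi : measurable_fun [set: borel E] (fun w : borel E => (phi w)%:E).
  exact: measurable_hat.
have phi0 w : (0 <= (phi w)%:E)%E by rewrite lee_fin hat_ge0.
have mker w : measurable_fun [set: borel E] (fun z : borel E => (hat r (w - (z : E)))%:E).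
  by apply: (measurable_EFin_hatB (f := cst (w : borel E))).
have ker0 w z : (0 <= (hat r (w - z))%:E)%E by rewrite lee_fin hat_ge0.
have mphiker w : measurable_fun [set: borel E]
    (fun z : borel E => (phi z)%:E * (hat r (w - (z : E)))%:E)%E.
  exact: emeasurable_funM.
have -> : (\int[lam]_w ((phi w)%:E * hatconv r s w) =
    \int[lam]_w (s w * \int[lam]_z ((phi z)%:E * (hat r ((w : E) - (z : E)))%:E)))%E.
  transitivity (\int[lam]_z \int[lam]_w ((phi z)%:E * (s w * (hat r ((w : E) - (z : E)))%:E)))%E.
    apply: eq_integral => z _; rewrite hatconvE; apply/esym; apply: ge0_integralZl.
    - exact: measurableT.
    - by apply: emeasurable_funM => //; exact: measurable_hat.
    - by move=> w _; rewrite mule_ge0.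
    - exact: phi0.
  rewrite (fubini_tonelli (fun p : borel E * borel E =>
      (phi p.1)%:E * (s p.2 * (hat r ((p.2 : E) - (p.1 : E)))%:E)))%E.
  - apply: eq_integral => w _.
    transitivity (\int[lam]_z (s w * ((phi z)%:E * (hat r ((w : E) - (z : E)))%:E)))%E.
      by apply: eq_integral => z _; rewrite muleCA.
    apply: ge0_integralZl.
    + exact: measurableT.
    + exact: mphiker.
    + by move=> z _; rewrite mule_ge0.
    + exact: s0.
  - apply: emeasurable_funM; last exact: measurable_pair.
    exact: (measurableT_comp mphi measurable_fst).
  - by move=> p; rewrite !mule_ge0.
have mB := measurable_rball z0 a.
have -> : (\int[lam]_(w in rball z0 a) s w = \int[lam]_w (s w * (\1_(rball z0 a) w)%:E))%E.
  rewrite integral_mkcond; apply: eq_integral => w _.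
  by rewrite patchE indicE; case: ifPn => _; rewrite ?mule1 ?mule0.
have mind : measurable_fun [set: borel E] (fun w : borel E => (\1_(rball z0 a) w : R)%:E).
  by apply/measurable_EFinP; exact: measurable_indic.
have mav : measurable_fun [set: borel E] (fun w : borel E =>
    \int[lam]_z ((phi z)%:E * (hat r ((w : E) - (z : E)))%:E))%E.
  have mpair : measurable_fun [set: borel E * borel E]
      (fun p : borel E * borel E => (phi p.2)%:E * (hat r ((p.1 : E) - (p.2 : E)))%:E)%E.
    apply: emeasurable_funM; first exact: (measurableT_comp mphi measurable_snd).
    by apply: measurable_EFin_hatB.
  have := measurable_fun_fubini_tonelli_F (m2 := lam) _ mpair.
  by apply => p; rewrite mule_ge0.
have av0 w : (0 <= \int[lam]_z ((phi z)%:E * (hat r (w - (z : E)))%:E))%E.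
  by apply: integral_ge0 => z _; rewrite mule_ge0.
have k0 : (0 <= r%:E * hatmass n r)%E by apply: mule_ge0; [rewrite lee_fin|]; exact: ltW.
have sind0 w : (0 <= s w * (\1_(rball z0 a) w)%:E)%E.
  by apply: mule_ge0; rewrite ?s0// lee_fin.
have sphi0 w : (0 <= s w * (hat a (w - z0))%:E)%E by apply: mule_ge0; [exact: s0|exact: phi0].
rewrite -ge0_integralZl//; first last.
- exact: ltW.
- exact: emeasurable_funM.
rewrite -[X in (_ <= _ + X)%E]ge0_integralZl//; first last.
- exact: emeasurable_funM.
rewrite -ge0_integralD//; first last.
- by apply: measurable_funeM; exact: emeasurable_funM.
- by move=> w _; apply: mule_ge0.
- exact: emeasurable_funM.
- by move=> w _; rewrite mule_ge0.
apply: ge0_le_integral => //.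
- by move=> w _; apply: mule_ge0 => //; exact: ltW.
- by apply: measurable_funeM; exact: emeasurable_funM.
- apply: emeasurable_funD; first exact: emeasurable_funM.
  by apply: measurable_funeM; exact: emeasurable_funM.
move=> w _; rewrite (muleCA _ (s w)) [X in (_ <= _ + X)%E]muleCA.
rewrite -ge0_muleDr//; last by rewrite mule_ge0// lee_fin.
apply: lee_wpmul2l => //; rewrite indicE.
have [wB|wB] := boolP (w \in rball z0 a); last first.
  have -> : hat a ((w : E) - z0) = 0.
    by apply: hat_out; rewrite leNgt; apply/negP; move: wB; rewrite notin_setE.
  by rewrite mule0 mule0 adde0.
(* With [hatmass n r] written as the integral of the kernel centered at [w], the inequality holds
   pointwise in [z]: the cutoff varies by at most [r] where the kernel does not vanish. *)
rewrite mule1 -(integral_hatBl w r).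
rewrite -[X in (_ <= _ + X)%E]ge0_integralZl//; last by rewrite lee_fin ltW.
rewrite [X in (X <= _)%E]muleC -[X in (X <= _)%E]ge0_integralZl//; last exact: phi0.
rewrite -ge0_integralD//; first last.
- exact: measurable_funeM.
- by move=> z _; rewrite mule_ge0// lee_fin ltW.
- by move=> z _; rewrite mule_ge0.
apply: ge0_le_integral => //.
- by move=> z _; apply: mule_ge0; [exact: phi0|exact: ker0].
- exact: measurable_funeM.
- by apply: emeasurable_funD => //; exact: measurable_funeM.
move=> z _; rewrite -ge0_muleDl; [|exact: phi0|by rewrite lee_fin ltW].
have [rwz|wzr] := leP r (rnorm (w - (z : E))); first by rewrite (hat_out rwz) !mule0.
apply: lee_wpmul2r; first by rewrite lee_fin hat_ge0.
rewrite -EFinD lee_fin; have := hat_lip a (w - z0) ((z : E) - z0).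
by rewrite opprB addrA subrK => /le_trans; apply; rewrite lerD2l ltW.
Qed.

End defect.
End defect_estimate.

(** * L^1 distance controlled by the distance of the convolutions *)

Section real_integrals.
Context d (T : measurableType d) (R : realType).
Variable mu : {measure set T -> \bar R}.

Lemma ge0_integral_EFinD (f g : T -> R) :
  measurable_fun [set: T] f -> (forall x, 0 <= f x) ->
  measurable_fun [set: T] g -> (forall x, 0 <= g x) ->
  (\int[mu]_x (f x + g x)%:E = \int[mu]_x (f x)%:E + \int[mu]_x (g x)%:E)%E.
Proof.
move=> mf f0 mg g0; under eq_integral do rewrite EFinD.
rewrite ge0_integralD// => [x _||x _|]; rewrite ?lee_fin//.
  exact/measurable_EFinP.
exact/measurable_EFinP.
Qed.

Lemma ge0_integral_EFinZ (k : R) (f : T -> R) : 0 <= k ->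
  measurable_fun [set: T] f -> (forall x, 0 <= f x) ->
  (\int[mu]_x (k * f x)%:E = k%:E * \int[mu]_x (f x)%:E)%E.
Proof.
move=> k0 mf f0; under eq_integral do rewrite EFinM.
rewrite ge0_integralZl//; first exact/measurable_EFinP.
by move=> x _; rewrite lee_fin.
Qed.

(** Where [phi] does not vanish, [m * f1 - A1] and [m * f2 - A2] are nonnegative almost everywhere,
    so [m * |f1 - f2|] is at most their sum plus [|A1 - A2|]; the weighted integral of each is at
    most [K]. The proof adds instead of subtracting and cancels only the integrals of [phi * A1] and
    [phi * A2], which are finite. *)
Lemma weighted_close (phi A1 A2 f1 f2 : T -> R) (m delta K : R) :
  measurable_fun [set: T] phi -> measurable_fun [set: T] A1 ->
  measurable_fun [set: T] A2 -> measurable_fun [set: T] f1 ->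
  measurable_fun [set: T] f2 ->
  (forall x, 0 <= phi x) -> (forall x, 0 <= A1 x) -> (forall x, 0 <= A2 x) ->
  (forall x, 0 <= f1 x) -> (forall x, 0 <= f2 x) -> 0 <= m -> 0 <= delta ->
  (\int[mu]_x (phi x * A1 x)%:E < +oo)%E ->
  (\int[mu]_x (phi x * A2 x)%:E < +oo)%E ->
  (m%:E * \int[mu]_x (f1 x * phi x)%:E <= \int[mu]_x (phi x * A1 x)%:E + K%:E)%E ->
  (m%:E * \int[mu]_x (f2 x * phi x)%:E <= \int[mu]_x (phi x * A2 x)%:E + K%:E)%E ->
  {ae mu, forall x, phi x != 0 -> A1 x <= m * f1 x} ->
  {ae mu, forall x, phi x != 0 -> A2 x <= m * f2 x} ->
  (forall x, phi x != 0 -> `|A1 x - A2 x| <= delta) ->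
  (m%:E * \int[mu]_x (phi x * `|f1 x - f2 x|)%:E <=
   (2 * K)%:E + delta%:E * \int[mu]_x (phi x)%:E)%E.
Proof.
move=> mphi mA1 mA2 mf1 mf2 phi0 A10 A20 f10 f20 m0 delta0 X1 X2 Y1 Y2 ae1 ae2 Ad.
have X1fin : (\int[mu]_x (phi x * A1 x)%:E)%E \is a fin_num.
  by rewrite ge0_fin_numE// integral_ge0// => x _; rewrite lee_fin mulr_ge0.
have X2fin : (\int[mu]_x (phi x * A2 x)%:E)%E \is a fin_num.
  by rewrite ge0_fin_numE// integral_ge0// => x _; rewrite lee_fin mulr_ge0.
have mabs : measurable_fun [set: T] (fun x => `|f1 x - f2 x|).
  by apply: measurableT_comp => //; exact: measurable_funB.
have mM (f g : T -> R) : measurable_fun [set: T] f -> measurable_fun [set: T] g ->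
  measurable_fun [set: T] (fun x => f x * g x : R) by exact: measurable_funM.
have mD (f g : T -> R) : measurable_fun [set: T] f -> measurable_fun [set: T] g ->
  measurable_fun [set: T] (fun x => f x + g x : R) by exact: measurable_funD.
have main : (m%:E * \int[mu]_x (phi x * `|f1 x - f2 x|)%:E +
    (\int[mu]_x (phi x * A1 x)%:E + \int[mu]_x (phi x * A2 x)%:E) <=
   m%:E * \int[mu]_x (f1 x * phi x)%:E +
    (m%:E * \int[mu]_x (f2 x * phi x)%:E + delta%:E * \int[mu]_x (phi x)%:E))%E.
  rewrite -!ge0_integral_EFinZ//; try by [auto | move=> x; do ?[apply: addr_ge0 | apply: mulr_ge0]].
  rewrite -!ge0_integral_EFinD//; try by [auto 10 | move=> x; do ?[apply: addr_ge0 | apply: mulr_ge0]].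
  apply: ae_ge0_le_integral => //.
  - by move=> x _; rewrite lee_fin; do ?[apply: addr_ge0 | apply: mulr_ge0].
  - by apply/measurable_EFinP; auto 10.
  - by move=> x _; rewrite lee_fin; do ?[apply: addr_ge0 | apply: mulr_ge0].
  - by apply/measurable_EFinP; auto 10.
  apply: filterS2 ae1 ae2 => x A1f A2f _; rewrite lee_fin.
  have [->|phix] := eqVneq (phi x) 0; first by rewrite !mul0r !mulr0 !addr0.
  have := A1f phix; have := A2f phix; have := Ad _ phix => Adx A2x A1x.
  suff : m * `|f1 x - f2 x| + A1 x + A2 x <= m * f1 x + m * f2 x + delta.
    by move=> /(ler_wpM2l (phi0 x)); rewrite !mulrDr; lra.
  rewrite -{1}(ger0_norm m0) -normrM mulrBr; move: Adx; rewrite ler_norml => /andP[? ?].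
  by case: (ler0P (m * f1 x - m * f2 x)) => ?; lra.
rewrite -(leeD2rE _ _ (x := (\int[mu]_x (phi x * A1 x)%:E + \int[mu]_x (phi x * A2 x)%:E)%E)).
  apply: (le_trans main); rewrite addeA.
  apply: (@le_trans _ _ ((\int[mu]_x (phi x * A1 x)%:E + K%:E) +
     (\int[mu]_x (phi x * A2 x)%:E + K%:E) + delta%:E * \int[mu]_x (phi x)%:E))%E.
    by rewrite leeD2r// leeD.
  rewrite mulr_natl mulr2n EFinD [X in (X + _ <= _)%E]addeACA [leRHS]addeC.
  by rewrite -[leLHS]addeA.
by rewrite fin_numD X1fin.
Qed.

End real_integrals.

Section supermean_close.
Context (R : realType) (n : nat).
Notation E := 'rV[R[i]]_n.
Notation lam := (Cn_measure (R := R) (n := n)).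
Implicit Types (z w : E) (r a C : R).

Lemma hatconv_le (s : borel E -> \bar R) r z :
  measurable_fun [set: borel E] s -> (forall w, (0 <= s w)%E) -> 0 <= r ->
  (hatconv r s z <= r%:E * \int[lam]_w s w)%E.
Proof.
move=> ms s0 r0; rewrite hatconvE -ge0_integralZl//.
apply: ge0_le_integral => //.
- by move=> w _; exact: hatconv_integrand_ge0.
- exact: measurable_hatconv_integrand.
- exact: measurable_funeM.
by move=> w _; rewrite muleC lee_wpmul2r// lee_fin hat_le.
Qed.

(* The mean inequality at the single scale [r] is all that the compactness
   argument uses of superharmonicity. *)
Definition almost_supermean z0 a r C (f : borel E -> R) :=
  [/\ measurable_fun [set: borel E] f, forall w, 0 <= f w,
      (\int[lam]_w (f w)%:E <= C%:E)%E &
      {ae lam, forall w : borel E, rball z0 a w ->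
         (hatconv r (EFin \o f) w <= hatmass n r * (f w)%:E)%E}].

Section bounds.
Variables (z0 : E) (a r C : R) (a0 : 0 < a) (r0 : 0 < r).

Section one.
Variable f : borel E -> R.
Hypothesis fP : almost_supermean z0 a r C f.

Lemma almost_supermean_fin w : hatconv r (EFin \o f) w \is a fin_num.
Proof.
have [mf f0 fC _] := fP.
rewrite ge0_fin_numE; last by apply: hatconv_ge0 => v; rewrite lee_fin.
apply: (@le_lt_trans _ _ (r%:E * C%:E)%E); last by rewrite -EFinM ltry.
apply: le_trans (hatconv_le _ _ _ _) _.
- exact/measurable_EFinP.
- by move=> v; rewrite lee_fin.
- exact: ltW.
by rewrite lee_wpmul2l// lee_fin ltW.
Qed.

Lemma almost_supermean_hatconvE w :
  (fine (hatconv r (EFin \o f) w))%:E = hatconv r (EFin \o f) w.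
Proof. by rewrite fineK// almost_supermean_fin. Qed.

Lemma almost_supermean_lip z z' :
  fine (hatconv r (EFin \o f) z) <=
  fine (hatconv r (EFin \o f) z') + rnorm (z - z') * C.
Proof.
have [mf f0 fC _] := fP.
have mef : measurable_fun [set: borel E] (EFin \o f) by exact/measurable_EFinP.
have ef0 w : (0 <= (EFin \o f) w)%E by rewrite lee_fin.
have := hatconv_lip mef ef0 r z z'.
rewrite -(almost_supermean_hatconvE z) -(almost_supermean_hatconvE z').
move: (fine (hatconv r (EFin \o f) z)) (fine (hatconv r (EFin \o f) z')) => x y.
rewrite -lee_fin EFinD EFinM => /le_trans; apply.
by rewrite leeD2l// lee_wpmul2l// lee_fin rnorm_ge0.
Qed.

End one.

(** An instance of [weighted_close] with the cutoff as weight and the convolutions as [A1] and [A2];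
    [hatconv_defect] supplies [K = r * m * C], whence the term [2 * r * C]. *)
Lemma almost_supermean_close f1 f2 delta :
  almost_supermean z0 a r C f1 -> almost_supermean z0 a r C f2 -> 0 <= delta ->
  (forall z, rball z0 a z ->
    `|fine (hatconv r (EFin \o f1) z) - fine (hatconv r (EFin \o f2) z)| <= delta) ->
  (hatmass n r * \int[lam]_w (hat a ((w : E) - z0) * `|f1 w - f2 w|)%:E <=
   (2 * r * C)%:E * hatmass n r + delta%:E * hatmass n a)%E.
Proof.
move=> fP1 fP2 delta0 fdelta.
have [mf1 f10 fC1 sup1] := fP1; have [mf2 f20 fC2 sup2] := fP2.
have /andP[mr0 mroo] := hat_mass_bounds n r0.
have /andP[ma0 maoo] := hat_mass_bounds n a0.
have mrE : (fine (hatmass n r))%:E = hatmass n r by rewrite fineK// ge0_fin_numE// ltW.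
pose m := fine (hatmass n r).
have m0 : 0 <= m by rewrite fine_ge0// ltW.
pose phi w := hat a (w - z0).
have mphi : measurable_fun [set: borel E] (phi : borel E -> R).
  by apply: (measurable_hatB (g := cst (z0 : borel E))).
have phi0 w : 0 <= phi w by exact: hat_ge0.
have hatconvP f : almost_supermean z0 a r C f ->
    measurable_fun [set: borel E] (fun w : borel E => fine (hatconv r (EFin \o f) w)) /\
    forall w, 0 <= fine (hatconv r (EFin \o f) w).
  move=> [mf f0 _ _]; split=> [|w]; last first.
    by apply/fine_ge0/hatconv_ge0 => v; rewrite lee_fin.
  apply: measurableT_comp => //; apply: measurable_hatconv.
    exact/measurable_EFinP.
  by move=> v; rewrite lee_fin.
have [mA1 A10] := hatconvP _ fP1; have [mA2 A20] := hatconvP _ fP2.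
pose X (A : borel E -> R) := (\int[lam]_w (phi w * A w)%:E)%E.
pose Y (f : borel E -> R) := (\int[lam]_w (f w * phi w)%:E)%E.
have intphi : (\int[lam]_w (phi w)%:E = hatmass n a)%E by exact: integral_hatB.
have XP f : almost_supermean z0 a r C f ->
    X (fun w => fine (hatconv r (EFin \o f) w)) \is a fin_num /\
    (m%:E * Y f <= X (fun w => fine (hatconv r (EFin \o f) w)) + (r * m * C)%:E)%E.
  move=> fP; have [mA A0] := hatconvP _ fP; have [mf f0 fC _] := fP; split.
    rewrite ge0_fin_numE; last by apply: integral_ge0 => w _; rewrite lee_fin mulr_ge0.
    apply: (@le_lt_trans _ _ (\int[lam]_w (r * C * phi w)%:E)%E).
      apply: ge0_le_integral => //.
      - by move=> w _; rewrite lee_fin mulr_ge0.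
      - by apply/measurable_EFinP; exact: measurable_funM.
      - by apply/measurable_EFinP; exact: measurable_funM.
      move=> w _; rewrite lee_fin mulrC ler_wpM2r// -lee_fin almost_supermean_hatconvE//.
      apply: le_trans (hatconv_le _ _ _ _) _ => //.
      + exact/measurable_EFinP.
      + exact: ltW.
      + by rewrite EFinM lee_wpmul2l// lee_fin ltW.
    have C0 : 0 <= C.
      by rewrite -lee_fin (le_trans _ fC)// integral_ge0// => w _; rewrite lee_fin.
    rewrite ge0_integral_EFinZ// ?mulr_ge0// ?(ltW r0)// intphi.
    by rewrite lte_mul_pinfty// lee_fin mulr_ge0// ltW.
  have mef : measurable_fun [set: borel E] (EFin \o f) by exact/measurable_EFinP.
  have ef0 w : (0 <= (EFin \o f) w)%E by rewrite lee_fin.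
  have := hatconv_defect mef ef0 z0 a0 r0.
  rewrite -mrE => /le_trans; apply; apply: leeD.
    rewrite /X le_eqVlt; apply/orP; left; apply/eqP; apply: eq_integral => w _.
    by rewrite EFinM almost_supermean_hatconvE.
  rewrite -EFinM [X in (_ <= X)%E]EFinM; apply: lee_wpmul2l; first by rewrite lee_fin mulr_ge0// ltW.
  apply: le_trans fC; apply: ge0_subset_integral => //.
  exact: measurable_rball.
have [X1fin Y1] := XP _ fP1; have [X2fin Y2] := XP _ fP2.
have phiB w : phi w != 0 -> rball z0 a w.
  move=> phiw; rewrite /rball /= ltNge; apply: contraNN phiw => wa.
  by rewrite /phi (hat_out wa).
rewrite -mrE -intphi (_ : ((2 * r * C)%:E * m%:E = (2 * (r * m * C))%:E)%E); last first.
  by rewrite -EFinM; congr _%:E; ring.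
apply: (weighted_close mphi mA1 mA2 mf1 mf2) => //.
- by rewrite -ge0_fin_numE// integral_ge0// => w _; rewrite lee_fin mulr_ge0.
- by rewrite -ge0_fin_numE// integral_ge0// => w _; rewrite lee_fin mulr_ge0.
- apply: filterS sup1 => w f1w /phiB /f1w.
  by rewrite -mrE -almost_supermean_hatconvE.
- apply: filterS sup2 => w f2w /phiB /f2w.
  by rewrite -mrE -almost_supermean_hatconvE.
- by move=> w /phiB /fdelta.
Qed.

End bounds.
End supermean_close.

(** * Compactness and regularization in C^n *)

Section compactness.
Context (R : realType) (n : nat).
Notation E := 'rV[R[i]]_n.
Implicit Types (z w : E) (r a C : R).

Definition closed_rball z r := [set y | rnorm (y - z) <= r].

Lemma closed_closed_rball z r : closed (closed_rball z r).
Proof.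
rewrite -openC openE => y /= /negP; rewrite -ltNge => ry; apply/nbhs_rballP.
exists (rnorm (y - z) - r); first by rewrite subr_gt0.
move=> x; rewrite /rball /= => xy; apply/negP; rewrite -ltNge.
have := rnormD (y - x) (x - z); rewrite addrA subrK rnormB; lra.
Qed.

Let continuous_Complex : continuous (fun p : R * R => (p.1 +i* p.2 : R[i])).
Proof.
move=> [x y] A /nbhs_ballP[e /= e0 eA].
have [r r0 re] : exists2 r, 0 < r & r%:C = e.
  by exists (complex.Re e); [rewrite -ltcR|]; rewrite RRe_real// gtr0_real.
have r20 : 0 < r / 2 by exact: divr_gt0.
exists (ball x (r / 2), ball y (r / 2)).
  by split; [exact: nbhsx_ballx x _ r20|exact: nbhsx_ballx y _ r20].
move=> [x' y'] /= [xx' yy']; apply: eA; rewrite -ball_normE /= -re ltcR.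
apply: le_lt_trans (normc_le_ReIm _) _ => /=.
by rewrite (splitr r) ltrD.
Qed.

Lemma compact_closed_rball z r : compact (closed_rball z r).
Proof.
pose sq (c : R[i]) : set (R * R) :=
  `[complex.Re c - r, complex.Re c + r] `*` `[complex.Im c - r, complex.Im c + r].
pose A (j : 'I_n) : set R[i] := (fun p => p.1 +i* p.2) @` sq (z ord0 j).
have cA j : compact (A j).
  apply: continuous_compact.
    by apply: continuous_subspaceT => p; exact: continuous_Complex.
  by apply: compact_setX; exact: segment_compact.
apply: (subclosed_compact (@closed_closed_rball z r) (rV_compact cA)).
move=> y /= yz j.
have : normc ((y - z) ord0 j) <= r.
  apply/ler_addgt0Pr => e e0; apply/ltW; move: j; apply/rnorm_ltP.
    by rewrite ltr_wpDl// (le_trans (rnorm_ge0 _) yz).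
  by rewrite (le_lt_trans yz)// ltrDl.
rewrite !mxE /A /sq /=; case: (y ord0 j) => c d; case: (z ord0 j) => c' d' /= cdr.
exists (c, d) => //=; rewrite !in_itv /= -!ler_distl; split; apply: le_trans cdr.
  by rewrite -sqrtr_sqr ler_wsqrtr// lerDl sqr_ge0.
by rewrite -sqrtr_sqr ler_wsqrtr// lerDr sqr_ge0.
Qed.

Lemma finite_net z a eta : 0 < eta ->
  exists N : seq E, forall y, rball z a y -> exists2 w, w \in N & rnorm (y - w) < eta.
Proof.
move=> eta0; have := @compact_closed_rball z a; rewrite compact_cover.
move=> /(_ E setT (fun w => rball w eta)).
case=> [w _|y _|N _ NB].
- exact: rball_open.
- by exists y => //; rewrite /rball /= subrr rnorm0.
exists (finmap.enum_fset N) => y yB; have [|w /= wN yw] := NB y; first exact: ltW.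
by exists w.
Qed.

End compactness.

Section ultrafilter.
Context (R : realType) (T : Type) (F : set_system T).
Context {FU : UltraFilter F}.

(** The image of the ultrafilter contains the compact segment from 0 to [B], hence clusters at some
    [p]; by maximality it contains every ball around [p]. *)
Lemma ultra_oscillation (K : set T) (f : T -> R) (B : R) eta :
  F K -> (forall t, K t -> 0 <= f t <= B) -> 0 < eta ->
  exists2 S, F S & forall t t', S t -> S t' -> `|f t - f t'| <= eta.
Proof.
move=> FK fB eta0.
have eta20 : 0 < eta / 2 by exact: divr_gt0.
have Fseg : (f @ F) `[0, B]%classic.
  by apply: (@filterS _ F _ K (f @^-1` _) _ FK) => t /fB; rewrite /= in_itv.
have [p [_ pF]] := @segment_compact R 0 B (f @ F) _ Fseg.
exists (f @^-1` ball p (eta / 2)).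
  have [//|FC] := in_ultra_setVsetC (f @^-1` ball p (eta / 2)) FU.
  have [x [/= Cx Bx]] := pF (~` ball p (eta / 2)) _ FC (nbhsx_ballx p _ eta20).
  by [].
move=> t t'; rewrite -!ball_normE /= => pt pt'.
rewrite (_ : f t - f t' = (p - f t') - (p - f t)); last by ring.
by rewrite (le_trans (ler_normB _ _))// (splitr eta) ltW// ltrD.
Qed.

Lemma ultra_oscillation_seq (I : eqType) (N : seq I) (K : set T)
    (f : I -> T -> R) (B : R) eta :
  F K -> (forall i t, K t -> 0 <= f i t <= B) -> 0 < eta ->
  exists2 S, F S & forall i t t', i \in N -> S t -> S t' ->
    `|f i t - f i t'| <= eta.
Proof.
move=> FK fB eta0; elim: N => [|i N [S FS SP]]; first by exists setT; [exact: filterT|].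
have [S' FS' S'P] := ultra_oscillation FK (fB i) eta0.
exists (S' `&` S); first exact: filterI.
move=> j t t'; rewrite in_cons => /orP[/eqP ->|jN] [S't St] [S't' St'].
  exact: S'P.
exact: SP.
Qed.

End ultrafilter.

Section supermean_compact.
Context (R : realType) (n : nat).
Notation E := 'rV[R[i]]_n.
Notation lam := (Cn_measure (R := R) (n := n)).
Context (T : Type) (F : set_system T) {FU : UltraFilter F}.

(** An Arzela-Ascoli argument at one fixed scale [r]: the convolutions share the Lipschitz constant
    [C] and the bound [r * C], so small oscillation on a finite net makes them uniformly close along
    the ultrafilter. *)
Lemma almost_supermean_ultra (K : set T) (f : T -> borel E -> R) (z0 : E) (a r0 C : R) eps :
  0 < a -> 0 < r0 -> 0 < C -> F K ->
  (forall t r, K t -> 0 < r -> r <= r0 -> almost_supermean z0 a r C (f t)) ->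
  0 < eps ->
  exists2 S, F S & forall t t', S t -> S t' ->
    (\int[lam]_(w in rball z0 (a / 2)) `|f t w - f t' w|%:E <= eps%:E)%E.
Proof.
move=> a0 r00 C0 FK fP eps0.
(* The cutoff is at least [a / 2] on the half ball, so the bound to reach is [eps * (a / 2) * m].
   This [r] makes the defect term [2 * r * C * m] at most half of it, and [delta] below makes
   [delta * M] the other half. *)
pose r := Num.min r0 (eps * a / (8 * C)).
have r_gt0 : 0 < r by rewrite lt_min r00 divr_gt0 ?mulr_gt0.
have rr0 : r <= r0 by rewrite ge_min lexx.
have rC : 2 * r * C <= eps * a / 4.
  have : r <= eps * a / (8 * C) by rewrite ge_min lexx orbT.
  by rewrite ler_pdivlMr ?mulr_gt0//; lra.
have /andP[m0 moo] := hat_mass_bounds n r_gt0.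
have /andP[M0 Moo] := hat_mass_bounds n a0.
have mE : hatmass n r = (fine (hatmass n r))%:E by rewrite fineK// ge0_fin_numE// ltW.
have ME : hatmass n a = (fine (hatmass n a))%:E by rewrite fineK// ge0_fin_numE// ltW.
move: m0 M0; rewrite mE ME !lte_fin.
set m := fine _; set M := fine _ => m0 M0.
pose delta := eps * a * m / (4 * M).
have delta0 : 0 < delta by rewrite divr_gt0// !mulr_gt0.
have deltaM : delta * M = eps * a * m / 4.
  by rewrite /delta; field; rewrite gt_eqF.
(* Moving to a point of the net costs [delta / 4] for each of the two convolutions; the oscillation
   at the net takes the remaining [delta / 2]. *)
have [N NB] := @finite_net R n z0 a (delta / (4 * C)) ltac:(by rewrite divr_gt0// mulr_gt0).
have delta20 : 0 < delta / 2 by exact: divr_gt0.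
have [w t Kt|S FS SP] := @ultra_oscillation_seq R T F _ _ N K
    (fun w t => fine (hatconv r (EFin \o f t) w)) (r * C) _ FK _ delta20.
  have fPt := fP t r Kt r_gt0 rr0; have [mf f0 fC _] := fPt.
  have mef : measurable_fun [set: borel E] (EFin \o f t) by exact/measurable_EFinP.
  have ef0 v : (0 <= (EFin \o f t) v)%E by rewrite lee_fin.
  rewrite fine_ge0 ?hatconv_ge0//= -lee_fin (almost_supermean_hatconvE r_gt0 fPt).
  apply: le_trans (hatconv_le w mef ef0 (ltW r_gt0)) _.
  by rewrite EFinM lee_wpmul2l// lee_fin ltW.
exists (S `&` K); first exact: filterI.
move=> t t' [St Kt] [St' Kt'].
have fPt := fP t r Kt r_gt0 rr0; have fPt' := fP t' r Kt' r_gt0 rr0.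
have close z : rball z0 a z -> `|fine (hatconv r (EFin \o f t) z) -
    fine (hatconv r (EFin \o f t') z)| <= delta.
  move=> /NB[w wN zw].
  have := SP w t t' wN St St'.
  have := almost_supermean_lip r_gt0 fPt z w.
  have := almost_supermean_lip r_gt0 fPt w z.
  have := almost_supermean_lip r_gt0 fPt' z w.
  have := almost_supermean_lip r_gt0 fPt' w z.
  rewrite (rnormB w z).
  have zwC : rnorm (z - w) * C <= delta / 4.
    have -> : delta / 4 = delta / (4 * C) * C by field; rewrite gt_eqF.
    by rewrite ler_wpM2r// ltW.
  move: (rnorm (z - w) * C) zwC => e.
  move: (fine _) (fine _) (fine _) (fine _) => x1 x2 x3 x4.
  by rewrite !ler_norml => ? ? ? ? ? /andP[? ?]; apply/andP; split; lra.
have := almost_supermean_close a0 r_gt0 fPt fPt' (ltW delta0) close.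
rewrite mE ME -/m -/M => cl.
have [mf f0 _ _] := fPt; have [mf' f0' _ _] := fPt'.
have mabs : measurable_fun [set: borel E] (fun w : borel E => `|f t w - f t' w|).
  by apply: measurableT_comp => //; exact: measurable_funB.
have mB := measurable_rball z0 (a / 2).
have low : ((a / 2)%:E * \int[lam]_(w in rball z0 (a / 2)) `|f t w - f t' w|%:E <=
    \int[lam]_w (hat a ((w : E) - z0) * `|f t w - f t' w|)%:E)%E.
  have mabsE : measurable_fun (rball z0 (a / 2) : set (borel E))
      (fun w : borel E => `|f t w - f t' w|%:E).
    by apply: measurable_funTS; exact/measurable_EFinP.
  have mhat : measurable_fun [set: borel E]
      (fun w : borel E => (hat a ((w : E) - z0) * `|f t w - f t' w|)%:E).
    apply/measurable_EFinP; apply: measurable_funM => //.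
    by apply: (measurable_hatB (g := cst (z0 : borel E))).
  rewrite -ge0_integralZl//; last by rewrite lee_fin divr_ge0 ?ltW.
  apply: (@le_trans _ _ (\int[lam]_(w in rball z0 (a / 2))
      (hat a ((w : E) - z0) * `|f t w - f t' w|)%:E)%E).
    apply: ge0_le_integral => //.
    - by move=> w _; rewrite -EFinM lee_fin mulr_ge0// divr_ge0 ?ltW.
    - exact: measurable_funeM.
    - exact: measurable_funTS.
    move=> w; rewrite /rball /= => wz; rewrite -EFinM lee_fin ler_wpM2r//.
    by have := hat_ge a (w - z0); lra.
  apply: ge0_subset_integral => //.
  by move=> w _; rewrite lee_fin mulr_ge0// hat_ge0.
have ma0 : 0 < m * (a / 2) by rewrite mulr_gt0// divr_gt0.
rewrite -(@lee_pmul2l _ (m * (a / 2))%:E)//.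
rewrite EFinM -muleA.
apply: (@le_trans _ _ (m%:E * \int[lam]_w (hat a ((w : E) - z0) * `|f t w - f t' w|)%:E)%E).
  by rewrite lee_wpmul2l// lee_fin ltW.
apply: (le_trans cl); rewrite -!EFinM -EFinD lee_fin deltaM.
have := ler_wpM2r (ltW m0) rC; lra.
Qed.

(* By the defect estimate the integrals of [S] and of its lower regularization
   [S'] against the cutoff agree. *)
Lemma supermean_regularization (S S' : borel E -> \bar R) (z0 : E) (a r0 : R) :
  0 < a -> 0 < r0 ->
  measurable_fun [set: borel E] S -> measurable_fun [set: borel E] S' ->
  (forall w, 0 <= S' w)%E -> (forall w, S' w <= S w)%E ->
  (\int[lam]_w S w < +oo)%E ->
  (forall r w, 0 < r -> r <= r0 -> rball z0 a w ->
    (hatconv r S w <= hatmass n r * S' w)%E) ->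
  {ae lam, forall w : borel E, rball z0 a w -> S w = S' w}.
Proof.
move=> a0 r00 mS mS' S'0 S'S Soo conv_le.
have S0 w : (0 <= S w)%E by exact: le_trans (S'0 w) (S'S w).
have [phi [phiE mphi phi0]] : exists phi : borel E -> R,
    [/\ (fun w => hat a ((w : E) - z0)) = phi, measurable_fun [set: borel E] phi &
        forall w, 0 <= phi w].
  exists (fun w => hat a ((w : E) - z0)); split=> // [|w]; last exact: hat_ge0.
  by apply: (measurable_hatB (g := cst (z0 : borel E))).
have phiEw w : hat a ((w : E) - z0) = phi w by rewrite -phiE.
have mphiE : measurable_fun [set: borel E] (EFin \o phi) by exact/measurable_EFinP.
have ephi0 w : (0 <= (phi w)%:E)%E by rewrite lee_fin.
have mB := measurable_rball z0 a.
have SBfin : (\int[lam]_(w in rball z0 a) S w \is a fin_num)%E.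
  rewrite ge0_fin_numE ?integral_ge0//; apply: le_lt_trans Soo.
  exact: ge0_subset_integral.
have phiSfin : (\int[lam]_w (S w * (phi w)%:E) < +oo)%E.
  apply: (@le_lt_trans _ _ (a%:E * \int[lam]_w S w)%E); last first.
    by apply: lte_mul_pinfty; rewrite ?lee_fin ?(ltW a0).
  rewrite -ge0_integralZl//; last by rewrite lee_fin ltW.
  apply: ge0_le_integral => //.
  - by move=> w _; rewrite mule_ge0.
  - exact: emeasurable_funM.
  - exact: measurable_funeM.
  by move=> w _; rewrite muleC lee_wpmul2r// lee_fin -phiEw hat_le// ltW.
have defect r : 0 < r -> r <= r0 ->
    (\int[lam]_w (S w * (phi w)%:E) <=
     \int[lam]_w (S' w * (phi w)%:E) + r%:E * \int[lam]_(w in rball z0 a) S w)%E.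
  move=> r_gt0 rr0; have /andP[m0 moo] := hat_mass_bounds n r_gt0.
  have mE : hatmass n r = (fine (hatmass n r))%:E by rewrite fineK// ge0_fin_numE// ltW.
  move: (hatconv_defect mS S0 z0 a0 r_gt0) (conv_le r) m0; rewrite mE lte_fin.
  move: (fine _) => m dS convS m0.
  rewrite -(@lee_pmul2l _ m%:E)//; apply: le_trans.
    by move: dS; under eq_integral do rewrite phiEw; apply.
  have int1 : (0 <= \int[lam]_w (S' w * (phi w)%:E))%E.
    by apply: integral_ge0 => w _; rewrite mule_ge0.
  have int2 : (0 <= r%:E * \int[lam]_(w in rball z0 a) S w)%E.
    by apply: mule_ge0; [rewrite lee_fin ltW|exact: integral_ge0].
  rewrite [X in (_ <= X)%E]ge0_muleDr//.
  apply: leeD; last by rewrite muleA (muleC r%:E).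
  rewrite -ge0_integralZl//; first last.
  - by rewrite lee_fin ltW.
  - by move=> w _; rewrite mule_ge0.
  - exact: emeasurable_funM.
  apply: ge0_le_integral => //.
  - by move=> w _; rewrite mule_ge0 ?lee_fin ?hat_ge0 ?hatconv_ge0.
  - apply: emeasurable_funM; first exact: measurable_hat.
    exact: measurable_hatconv.
  - by apply: measurable_funeM; exact: emeasurable_funM.
  move=> w _; rewrite phiEw.
  have [wB|wB] := ltP (rnorm (w - z0)) a.
    by rewrite muleA muleC lee_wpmul2r// convS.
  by rewrite -phiEw (hat_out wB) mul0e mule0 mule0.
(* Letting the scale tend to 0 removes the error term; dividing by [1 + K] covers the case
   [K = 0]. *)
have key : (\int[lam]_w (S w * (phi w)%:E) <= \int[lam]_w (S' w * (phi w)%:E))%E.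
  apply/lee_addgt0Pr => e e0.
  pose K := fine (\int[lam]_(w in rball z0 a) S w)%E.
  have KE : (\int[lam]_(w in rball z0 a) S w)%E = K%:E by rewrite fineK.
  have K0 : 0 <= K by rewrite fine_ge0// integral_ge0.
  pose r := Num.min r0 (e / (1 + K)).
  have K1 : 0 < 1 + K by rewrite ltr_wpDr.
  have r_gt0 : 0 < r by rewrite lt_min r00 divr_gt0.
  apply: le_trans (defect r r_gt0 _) _; first by rewrite ge_min lexx.
  rewrite leeD2l// KE -EFinM lee_fin.
  apply: (@le_trans _ _ (e / (1 + K) * K)).
    by rewrite ler_wpM2r// ge_min lexx orbT.
  by rewrite mulrAC ler_pdivrMr// ler_wpM2l ?(ltW e0)// lerDr.
(* The difference is taken only where [S] is finite and is 0 elsewhere, so that it is nonnegative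
   and [S' + D <= S] holds everywhere; since [S] is integrable, the excluded set is negligible. *)
pose Sfin : set (borel E) := [set w | (S w < +oo)%E].
have mSfin : measurable Sfin.
  by rewrite -[X in measurable X]setTI; exact: emeasurable_fun_infty_o.
pose D := (fun w => S w - S' w)%E \_ Sfin.
have mD : measurable_fun [set: borel E] D.
  apply/(measurable_restrictT _ mSfin).
  by apply: emeasurable_funB; exact: measurable_funTS.
have D0 w : (0 <= D w)%E.
  rewrite /D patchE; case: ifPn => // /set_mem Sw; rewrite sube_ge0//.
  by rewrite ge0_fin_numE// (le_lt_trans (S'S w)).
have DS w : (S' w + D w <= S w)%E.
  rewrite /D patchE; case: ifPn => [/set_mem Sw|_]; last by rewrite adde0.
  by rewrite addeC subeK// ge0_fin_numE// (le_lt_trans (S'S w)).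
have S'fin : (\int[lam]_w (S' w * (phi w)%:E) \is a fin_num)%E.
  rewrite ge0_fin_numE; last by apply: integral_ge0 => w _; rewrite mule_ge0.
  apply: le_lt_trans phiSfin; apply: ge0_le_integral => //.
  - by move=> w _; rewrite mule_ge0.
  - exact: emeasurable_funM.
  - exact: emeasurable_funM.
  by move=> w _; rewrite lee_wpmul2r.
have : (\int[lam]_w (D w * (phi w)%:E) <= 0)%E.
  rewrite -(leeD2lE _ _ S'fin) adde0; apply: le_trans key.
  rewrite -ge0_integralD//; first last.
  - exact: emeasurable_funM.
  - by move=> w _; rewrite mule_ge0.
  - exact: emeasurable_funM.
  - by move=> w _; rewrite mule_ge0.
  apply: ge0_le_integral => //.
  - by move=> w _; rewrite adde_ge0// mule_ge0.
  - by apply: emeasurable_funD; exact: emeasurable_funM.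
  - exact: emeasurable_funM.
  by move=> w _; rewrite -ge0_muleDl// lee_wpmul2r.
move=> intD.
have aeD : ae_eq lam setT (fun w => D w * (phi w)%:E)%E (cst 0%E).
  apply/ae_eq_integral_abs => //; first exact: emeasurable_funM.
  apply/eqP; rewrite eq_le integral_ge0// andbT; apply: le_trans intD.
  rewrite le_eqVlt; apply/orP; left; apply/eqP; apply: eq_integral => w _.
  by rewrite gee0_abs// mule_ge0.
have aeS : {ae lam, forall w : borel E, (S w \is a fin_num)}.
  have : lam.-integrable setT S.
    apply/integrableP; split=> //; rewrite (eq_integral S)// => w _.
    by rewrite gee0_abs.
  by move=> /integrable_ae => /(_ measurableT); apply: filterS => w; exact.
apply: filterS2 aeD aeS => w /(_ I) /= Dw Sw wB.
have : D w = 0%E.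
  move: Dw => /eqP; rewrite mule_eq0 => /orP[/eqP//|]; rewrite eqe -phiEw => /eqP phiw.
  have := hat_ge a (w - z0); rewrite phiw subr_le0 leNgt.
  by move: wB; rewrite /rball /= => ->.
have Swoo : (S w < +oo)%E by rewrite ltey_eq Sw.
rewrite /D patchE mem_set//= => /eqP; rewrite sube_eq ?add0e; first by move=> /eqP.
  by [].
by [].
Qed.

End supermean_compact.

(** * Charts *)

Section restricted_integral.
Context d (T : measurableType d) (R : realType).
Variable mu : {measure set T -> \bar R}.

Lemma ge0_integral_mrestr (B : set T) (mB : measurable B) (f : T -> \bar R) :
  measurable_fun [set: T] f -> (forall x, 0 <= f x)%E ->
  (\int[mrestr mu mB]_x f x = \int[mu]_(x in B) f x)%E.
Proof.
move=> mf f0; have mCB := measurableC mB.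
rewrite -(setUv B) ge0_integral_setU//; first last.
- exact/disj_setPCl.
- by rewrite setUv.
rewrite [X in (_ + X)%E](_ : _ = 0%E) ?adde0.
  apply: eq_measure_integral => A mA AB.
  by transitivity (mu (A `&` B)) => //; rewrite setIidl.
rewrite (eq_measure_integral mzero) ?integral_measure_zero// => A mA AB.
transitivity (mu (A `&` B)) => //.
by rewrite (_ : A `&` B = set0) ?measure0//; exact/disjoints_subset.
Qed.

End restricted_integral.

Section chart.
Context (R : realType) (n : nat) (M : ptopologicalType).
Variables (X : complex_manifold R n M) (i : chart X).
Notation E := 'rV[R[i]]_n.
Notation lam := (Cn_measure (R := R) (n := n)).
Notation dom := (chart_dom i).
Notation phi := (chart_map i).
Notation inv := (chart_inv i).
Notation D := (chart_map i @` chart_dom i).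

Lemma chart_invP z : D z -> dom (inv z) /\ phi (inv z) = z.
Proof. by move=> [x dx <-]; rewrite chart_mapK. Qed.

Lemma open_chart_image (N : set E) : open N -> N `<=` D -> open (inv @` N).
Proof.
move=> oN ND; rewrite (_ : _ @` _ = dom `&` phi @^-1` N).
  apply: (iffLR (continuous_inP phi (chart_dom_open i))) => //.
  rewrite -continuous_open_subspace; last exact: chart_dom_open.
  exact: chart_map_continuous.
apply/seteqP; split=> [_ [z Nz <-]|x [dx Nx]]; last by exists (phi x) => //; rewrite chart_mapK.
by have [dz ze] := chart_invP (ND _ Nz); split=> //; rewrite /= ze.
Qed.

Lemma open_chart_preimage (U : set M) : open U -> open (D `&` inv @^-1` U).
Proof.
move=> oU.
have : {in D, continuous inv}.
  rewrite -continuous_open_subspace; last exact: chart_map_open.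
  exact: chart_inv_continuous.
by move/(continuous_inP inv (@chart_map_open _ _ _ X i)); exact.
Qed.

(* The inverse chart, cut off outside [N] to be globally measurable. *)
Definition chart_inv_on (N : set E) (z : borel E) : borel M :=
  if z \in N then inv z else point.

Lemma chart_inv_onE N z : N z -> chart_inv_on N z = inv z.
Proof. by move=> zN; rewrite /chart_inv_on mem_set. Qed.

Lemma measurable_chart_inv_on (N : set E) : open N -> N `<=` D ->
  measurable_fun [set: borel E] (chart_inv_on N).
Proof.
move=> oN ND; apply: measurable_fun_borel => U oU.
have mN : measurable (N : set (borel E)) by exact: open_borel.
rewrite (_ : _ @^-1` _ = (N `&` (D `&` inv @^-1` U)) `|`
    (~` N `&` [set _ | U point])).
  apply: measurableU.
    by apply: measurableI => //; apply: open_borel; exact: open_chart_preimage.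
  apply: measurableI; first exact: measurableC.
  by have [Up|Up] := pselect (U point);
    [rewrite (_ : mkset _ = setT)|rewrite (_ : mkset _ = set0)] => //;
    apply/seteqP; split.
apply/seteqP; split=> z; rewrite /chart_inv_on /=.
  case: ifPn => [/set_mem zN Uz|/negP zN Up]; [left|right].
    by split=> //; split=> //; exact: ND.
  by split=> //; move/mem_set.
by move=> [[zN [_ Uz]]|[zN Up]]; [rewrite mem_set|rewrite memNset].
Qed.

Section ball.
Variables (z0 : E) (a : R) (a0 : 0 < a).
Hypothesis BD : closed_rball z0 a `<=` D.

Let rball_closed : rball z0 a `<=` closed_rball z0 a.
Proof. by move=> z; exact: ltW. Qed.

Let rballD : rball z0 a `<=` D.
Proof. by move=> z /rball_closed/BD. Qed.

Let chart_inv_ball := chart_inv_on (rball z0 a).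

Let chart_inv_ballE z : rball z0 a z -> chart_inv_ball z = inv z.
Proof. exact: chart_inv_onE. Qed.

Let measurable_chart_inv_ball : measurable_fun [set: borel E] chart_inv_ball.
Proof. by apply: measurable_chart_inv_on => //; exact: rball_open. Qed.

Lemma measurable_chart_comp (f : borel M -> \bar R) :
  measurable_fun [set: borel M] f ->
  measurable_fun [set: borel E] ((fun z => f (inv z)) \_ (rball z0 a)).
Proof.
move=> mf; rewrite (_ : _ \_ _ = (f \o chart_inv_ball) \_ (rball z0 a)).
  apply/(measurable_restrictT _ (measurable_rball z0 a)).
  apply: measurable_funTS; exact: (measurableT_comp mf measurable_chart_inv_ball).
apply/funext => z; rewrite !patchE; case: ifPn => // /set_mem zB.
by rewrite /= chart_inv_ballE.
Qed.

Variable V : volume_form X.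

Let image_ball (A : set (borel M)) :
  phi @` (inv @` rball z0 a `&` A) = rball z0 a `&` chart_inv_ball @^-1` A.
Proof.
apply/seteqP; split=> [_ [_ [[z zB <-] Az] <-]|z [zB]].
  have [_ ->] := chart_invP (rballD zB); split=> //.
  by rewrite /= chart_inv_ballE.
rewrite /= chart_inv_ballE// => Az; exists (inv z); last by have [] := chart_invP (rballD zB).
by split=> //; exists z.
Qed.

Lemma measurable_chart_ball : measurable (inv @` rball z0 a : set (borel M)).
Proof.
by apply: open_borel; apply: open_chart_image => //; exact: rball_open.
Qed.

(** On the compact closed ball the continuous positive density lies between its minimum and its
    maximum, which serve as [c] and [C]. In particular null sets correspond. *)
Lemma chart_volume_bounds : exists c C : R, [/\ 0 < c, 0 < C &
  forall A : set (borel M), measurable A ->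
    (c%:E * lam (rball z0 a `&` chart_inv_ball @^-1` A) <=
       vol V (inv @` rball z0 a `&` A))%E /\
    (vol V (inv @` rball z0 a `&` A) <=
       C%:E * lam (rball z0 a `&` chart_inv_ball @^-1` A))%E].
Proof.
have cK := @compact_closed_rball R n z0 a.
have K0 : closed_rball z0 a !=set0.
  by exists z0; rewrite /closed_rball /= subrr rnorm0 ltW.
have fK : {within closed_rball z0 a, continuous (density V i)}.
  by apply: continuous_subspaceW BD _; exact: density_continuous.
have [zm /set_mem zmK min] := compact_EVT_min K0 cK fK.
have [zM /set_mem zMK max] := compact_EVT_max K0 cK fK.
have pos z : closed_rball z0 a z -> 0 < density V i z.
  by move=> /BD [x dx <-]; exact: density_gt0.
exists (density V i zm), (density V i zM); split; [exact: pos|exact: pos|].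
move=> A mA; have mB := measurable_rball z0 a.
have mBA : measurable (rball z0 a `&` chart_inv_ball @^-1` A : set (borel E)).
  apply: measurableI => //; rewrite -[X in measurable X]setTI.
  exact: measurable_chart_inv_ball.
have Qdom : inv @` rball z0 a `&` A `<=` dom.
  by move=> _ [[z /rballD/chart_invP[dz _] <-] _].
rewrite (volE V _ Qdom); last by apply: measurableI; [exact: measurable_chart_ball|].
rewrite image_ball; set BA := _ `&` _ in mBA *.
have BAK z : BA z -> closed_rball z0 a z by move=> [/rball_closed].
have mdens : measurable_fun (BA : set (borel E)) (density V i : borel E -> R).
  apply: (@measurable_funS _ _ _ _ (D : set (borel E))).
  - by apply: open_borel; exact: chart_map_open.
  - by move=> z /BAK/BD.
  apply: (measurability _ (RGenOInfty.measurableE R)) => _ [_ [x ->] <-].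
  have : {in D, continuous (density V i)}.
    rewrite -continuous_open_subspace; last exact: chart_map_open.
    exact: density_continuous.
  move/(continuous_inP _ (@chart_map_open _ _ _ X i)) => cD.
  by apply: open_borel; apply: cD; exact: interval_open.
rewrite Cn_integralE//; first last.
- by move=> z /BAK /pos z_gt0; rewrite lee_fin ltW.
- exact/measurable_EFinP.
rewrite -!integral_cst//; split; apply: ge0_le_integral => //.
- by move=> z _; rewrite lee_fin ltW// pos.
- exact/measurable_EFinP.
- by move=> z /BAK zK; rewrite lee_fin min// inE.
- by move=> z /BAK /pos z_gt0; rewrite lee_fin ltW.
- exact/measurable_EFinP.
- by move=> z /BAK zK; rewrite lee_fin max// inE.
Qed.

(** An inequality between measures passes to integrals of nonnegative functions. Both sides are
    therefore written as integrals over [M]: against the restricted volume, and against the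
    pushforward of restricted Lebesgue measure under the cut-off inverse chart. *)
Lemma chart_integral_bounds : exists c C : R, [/\ 0 < c, 0 < C &
  forall f : borel M -> \bar R, measurable_fun [set: borel M] f ->
    (forall x, 0 <= f x)%E ->
    (c%:E * \int[lam]_(z in rball z0 a) f (inv z) <=
       \int[vol V]_(x in (inv @` rball z0 a : set (borel M))) f x)%E /\
    (\int[vol V]_(x in (inv @` rball z0 a : set (borel M))) f x <=
       C%:E * \int[lam]_(z in rball z0 a) f (inv z))%E].
Proof.
have [c [C [c0 C0 cC]]] := chart_volume_bounds.
exists c, C; split=> // f mf f0.
have mB := measurable_rball z0 a.
pose m1 := mrestr (vol V) measurable_chart_ball.
have [m2 m2E] := ex_pushforward (mrestr lam mB) measurable_chart_inv_ball.
have intm1 : (\int[vol V]_(x in (inv @` rball z0 a : set (borel M))) f x = \int[m1]_x f x)%E.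
  by rewrite /m1 ge0_integral_mrestr.
have intm2 : (\int[lam]_(z in rball z0 a) f (inv z) = \int[m2]_x f x)%E.
  have -> : (m2 : set (borel M) -> \bar R) = pushforward (mrestr lam mB) chart_inv_ball.
    by apply/funext => A; rewrite m2E.
  transitivity (\int[mrestr lam mB]_x (f \o chart_inv_ball) x)%E; last first.
    by apply/esym; apply: ge0_integral_pushforward.
  have mfg := measurableT_comp mf measurable_chart_inv_ball.
  apply/esym; apply: etrans (ge0_integral_mrestr lam mB mfg _) _ => [x|]; first exact: f0.
  by apply: eq_integral => z /set_mem zB; rewrite /= chart_inv_ballE.
rewrite intm1 intm2.
pose c' : {nonneg R} := NngNum (ltW c0); pose C' : {nonneg R} := NngNum (ltW C0).
have -> : (c%:E * \int[m2]_x f x = \int[mscale c' m2]_x f x)%E by rewrite ge0_integral_mscale.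
have -> : (C%:E * \int[m2]_x f x = \int[mscale C' m2]_x f x)%E by rewrite ge0_integral_mscale.
have m2A A : m2 A = lam (rball z0 a `&` chart_inv_ball @^-1` A) by rewrite m2E setIC.
split; apply: ge0_le_measure_integral => // A mA.
  have : (c%:E * m2 A <= vol V (A `&` inv @` rball z0 a))%E.
    by rewrite m2A (setIC A); have [] := cC _ mA.
  exact.
have : (vol V (A `&` inv @` rball z0 a) <= C%:E * m2 A)%E.
  by rewrite m2A (setIC A); have [] := cC _ mA.
exact.
Qed.

End ball.
End chart.

(** * Superharmonicity along discs *)

Section limn_einf.
Context (R : realType).
Implicit Types (u v : (\bar R)^nat).
Local Open Scope ereal_scope.

Lemma limn_einf_sup_einfs u : limn_einf u = ereal_sup (range (einfs u)).
Proof. by rewrite limn_einf_lim; apply/cvg_lim => //; exact: cvg_einfs_sup. Qed.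

Lemma limn_einf_ge u c N : (forall k, (N <= k)%N -> c <= u k) -> c <= limn_einf u.
Proof.
move=> cu; rewrite limn_einf_sup_einfs; apply: le_trans (ereal_sup_ubound _).
  2: by exists N.
by apply: le_ereal_inf_tmp => _ [k /= Nk <-]; exact: cu.
Qed.

Lemma limn_einf_le u v : (forall k, u k <= v k) -> limn_einf u <= limn_einf v.
Proof.
move=> uv; rewrite !limn_einf_sup_einfs; apply: ge_ereal_sup => _ [N _ <-].
apply: le_trans (ereal_sup_ubound _); last by exists N.
apply: le_ereal_inf_tmp => _ [k /= Nk <-]; apply: le_trans (uv k).
by apply: ereal_inf_lbound; exists k.
Qed.

Lemma limn_einf_cst_le u c : (forall k, u k <= c) -> limn_einf u <= c.
Proof.
move=> uc; rewrite limn_einf_sup_einfs; apply: ge_ereal_sup => _ [N _ <-].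
by apply: le_trans (uc N); apply: ereal_inf_lbound; exists N => /=.
Qed.

Lemma lt_limn_einf u c : c < limn_einf u ->
  exists N, forall k, (N <= k)%N -> c < u k.
Proof.
rewrite limn_einf_sup_einfs => /ereal_sup_gt[_ [N _ <-] cN].
exists N => k Nk; apply: lt_le_trans cN _.
by apply: ereal_inf_lbound; exists k.
Qed.

(** Turns the failure of an inequality between extended reals into a real threshold, on which
    semicontinuity and lower limits can act. *)
Lemma ereal_between x y : 0 <= x -> x < y -> exists2 r : R, x < r%:E & r%:E < y.
Proof.
case: x y => [x| |] [y| |] //= x0 xy.
- exists ((x + y) / 2)%R; rewrite lte_fin; move: xy; rewrite lte_fin; lra.
- by exists (x + 1)%R; rewrite ?lte_fin ?ltrDl// ltry.
Qed.

Lemma limn_einfM k u : (0 < k)%R -> (forall j, 0 <= u j) ->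
  limn_einf (fun j => k%:E * u j) <= k%:E * limn_einf u.
Proof.
move=> k0 u0.
have l0 : 0 <= limn_einf u by apply: (@limn_einf_ge _ _ 0).
rewrite leNgt; apply/negP => /ereal_between[|r lr /lt_limn_einf[N rN]].
  by rewrite mule_ge0// lee_fin ltW.
have : (k^-1 * r)%:E <= limn_einf u.
  apply: (@limn_einf_ge _ _ N) => j Nj.
  rewrite -(@lee_pmul2l _ k%:E) ?lte_fin// -EFinM mulVKf ?gt_eqF//.
  by rewrite ltW// rN.
rewrite -(@lee_pmul2l _ k%:E) ?lte_fin// -EFinM mulVKf ?gt_eqF//.
by rewrite leNgt lr.
Qed.

End limn_einf.

Section disc_super.
Context (R : realType) (n : nat) (M : ptopologicalType).
Variable X : complex_manifold R n M.
Notation E := 'rV[R[i]]_n.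
Notation leb := (@lebesgue_measure R).
Implicit Types (s u : M -> \bar R) (i : chart X).
Notation D i := (@chart_map _ _ _ X i @` chart_dom i).

Definition disc_in (N : set E) (z w : E) := forall c : R[i], `|c| <= 1 -> N (z + c *: w).

(* Superharmonicity of [s] along holomorphic discs, without semicontinuity. *)
Definition disc_super s := forall i z w, disc_in (D i) z w ->
  (\int[leb]_(t in `[0%R, (2 * pi)%R]) s (chart_inv i (z + (cos t +i* sin t) *: w))%R <=
   (2 * pi)%:E * s (chart_inv i z))%E.

Let pi20 : 0 < 2 * pi :> R.
Proof. by rewrite mulr_gt0// pi_gt0. Qed.

Lemma normr_cis_le1 (t : R) : `|cos t +i* sin t| <= 1 :> R[i].
Proof. by rewrite -[leLHS]/((normc (cos t +i* sin t))%:C) normc_cis. Qed.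

Lemma psh_measurable u : psh X u -> measurable_fun [set: borel M] (u : borel M -> \bar R).
Proof.
move=> pu; apply: (measurability _ (ErealGenInftyO.measurableE R)) => _ [_ [a ->] <-].
rewrite setTI; apply: open_borel.
rewrite (_ : _ @^-1` _ = \bigcup_(i in [set: chart X])
    (chart_inv i @` (D i `&` [set z | ((u \o chart_inv i) z < a%:E)%E]))).
  apply: bigcup_open => i _; apply: open_chart_image; last by move=> z [].
  by have [_ + _] := pu i; exact.
apply/seteqP; split=> [x /= ua|_ [i _ [z [Dz /= ua] <-]]]; last first.
  by rewrite /= in_itv.
have : [set: M] x by [].
rewrite -(chart_dom_cover X) => -[i _ dx]; exists i => //.
exists (chart_map i x); last exact: chart_mapK.
split; first by exists x.
by rewrite /= chart_mapK//; move: ua; rewrite in_itv.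
Qed.

Lemma psh_disc_super u : psh X u -> (forall x, u x <= 0)%E ->
  disc_super (fun x => - u x)%E.
Proof.
move=> pu u0 i z w zw; have [_ _ /(_ z w zw)] := pu i.
rewrite /circle_mean /=.
set I := (\int[_]_(t in _) - u _)%E.
have -> : (\int[leb]_(t in `[0%R, (2 * pi)%R])
    u (chart_inv i (z + (cos t +i* sin t) *: w)%R) = - I)%E.
  rewrite /I -integral_ge0N => [|t _]; last by rewrite oppe_ge0.
  by apply: eq_integral => t _; rewrite oppeK.
rewrite muleN leeNr => h.
rewrite -(@lee_pmul2l _ (2 * pi)^-1%:E) ?lte_fin ?invr_gt0//.
by rewrite muleA -EFinM mulVf ?gt_eqF// mul1e.
Qed.

Lemma disc_super_psh s : (forall x, 0 <= s x)%E ->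
  (forall a : R, open [set x | (a%:E < s x)%E]) -> disc_super s ->
  psh X (fun x => - s x)%E.
Proof.
move=> s0 ls ds i; split=> [z _|a|z w zw].
- by apply: (@le_lt_trans _ _ 0%E); rewrite ?ltry// oppe_le0.
- have := @open_chart_preimage _ _ _ X i _ (ls (- a)).
  rewrite (_ : _ `&` _ = D i `&` [set z | (((fun x => - s x) \o chart_inv i) z < a%:E)%E])//.
  by apply/seteqP; split=> z [Dz] /=; rewrite EFinN lteNl.
rewrite /circle_mean /= integral_ge0N//.
rewrite muleN leeN2.
rewrite -(@lee_pmul2l _ (2 * pi)%:E) ?lte_fin// muleA -EFinM mulfV ?gt_eqF// mul1e.
exact: ds.
Qed.

Lemma measurable_circle s i z w : measurable_fun [set: borel M] (s : borel M -> \bar R) ->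
  disc_in (D i) z w ->
  measurable_fun [set: measurableTypeR R]
    (fun t => s (chart_inv i (z + (cos t +i* sin t) *: w))).
Proof.
move=> ms zw.
have mD := measurable_chart_inv_on (@chart_map_open _ _ _ X i) (@subset_refl _ _).
have mc : measurable_fun [set: measurableTypeR R]
    (fun t : measurableTypeR R => z + (cos t +i* sin t) *: w : borel E).
  by apply: (measurable_rotation (f := cst (w : borel E)) (g := id)).
have := measurableT_comp ms (measurableT_comp mD mc).
rewrite (_ : _ \o _ = (fun t => s (chart_inv i (z + (cos t +i* sin t) *: w))))//.
by apply/funext => t /=; rewrite chart_inv_onE//; apply: zw; exact: normr_cis_le1.
Qed.

Lemma disc_super_limn_einf (s : (M -> \bar R)^nat) :
  (forall k, measurable_fun [set: borel M] (s k : borel M -> \bar R)) ->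
  (forall k x, 0 <= s k x)%E -> (forall k, disc_super (s k)) ->
  disc_super (fun x => limn_einf (s ^~ x)).
Proof.
move=> ms s0 ds i z w zw.
apply: (@le_trans _ _ (limn_einf (fun k => \int[leb]_(t in `[0%R, (2 * pi)%R])
    s k (chart_inv i (z + (cos t +i* sin t) *: w))%R))%E).
  apply: fatou => // k.
  by apply: measurable_funTS; exact: measurable_circle.
apply: le_trans (limn_einfM pi20 _) => //.
by apply: limn_einf_le => k; exact: ds.
Qed.

(** The largest lower semicontinuous minorant of [s], formed with neighborhoods in [M] itself and
    hence independent of charts. *)
Definition lsc_reg s (x : M) : \bar R :=
  ereal_sup [set ereal_inf (s @` U) | U in [set U : set M | open U /\ U x]].

Lemma lsc_reg_le s x : (lsc_reg s x <= s x)%E.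
Proof.
apply: ge_ereal_sup => _ [U [oU Ux] <-]; apply: ereal_inf_lbound.
by exists x.
Qed.

Lemma lsc_reg_ge0 s x : (forall y, 0 <= s y)%E -> (0 <= lsc_reg s x)%E.
Proof.
move=> s0; apply: le_trans (ereal_sup_ubound _).
  2: by exists setT => //; split => //; exact: openT.
by apply: le_ereal_inf_tmp => _ [y _ <-].
Qed.

Lemma le_lsc_reg s x c U : open U -> U x -> (forall y, U y -> c <= s y)%E ->
  (c <= lsc_reg s x)%E.
Proof.
move=> oU Ux cs; apply: le_trans (ereal_sup_ubound _).
  2: by exists U.
by apply: le_ereal_inf_tmp => _ [y Uy <-]; exact: cs.
Qed.

Lemma lsc_reg_open s (a : R) : open [set x | (a%:E < lsc_reg s x)%E].
Proof.
rewrite openE => x /= /ereal_sup_gt[_ [U [oU Ux] <-] aU].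
rewrite /interior; apply: filterS (open_nbhs_nbhs (conj oU Ux)) => y Uy.
apply: lt_le_trans aU _; apply: (le_lsc_reg oU Uy) => v Uv.
by apply: ereal_inf_lbound; exists v.
Qed.

Lemma measurable_lsc_reg s : measurable_fun [set: borel M] (lsc_reg s : borel M -> \bar R).
Proof.
apply: (measurability _ (ErealGenOInfty.measurableE R)) => _ [_ [a ->] <-].
rewrite setTI; apply: open_borel.
rewrite (_ : _ @^-1` _ = [set x | (a%:E < lsc_reg s x)%E]); first exact: lsc_reg_open.
by apply/seteqP; split=> x /=; rewrite in_itv /= andbT.
Qed.

End disc_super.

(** * The regularization keeps the disc inequality *)

Section disc_regularization.
Context (R : realType) (n : nat) (M : ptopologicalType).
Variable X : complex_manifold R n M.
Notation E := 'rV[R[i]]_n.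
Notation leb := (@lebesgue_measure R).
Notation D i := (@chart_map _ _ _ X i @` chart_dom i).

Let pi20 : 0 < 2 * pi :> R.
Proof. by rewrite mulr_gt0// pi_gt0. Qed.

(** The closed disc is compact, so some uniform neighborhood of it lies in [N], and moving the
    center slightly keeps the disc in that neighborhood. *)
Lemma disc_in_near (N : set E) z w : open N -> disc_in N z w ->
  exists2 d, 0 < d & forall y, rball z d y -> disc_in N y w.
Proof.
move=> oN zw.
(* The disc parameter is taken as a row vector of length 1, since closed balls of row vectors are
   already known to be compact. *)
pose f (v : 'rV[R[i]]_1) : E := z + v ord0 ord0 *: w.
have cf : continuous f.
  move=> v A /nbhs_rballP[r r0 rA]; apply/nbhs_rballP.
  have w1 : 0 < 1 + rnorm w by rewrite ltr_wpDr// rnorm_ge0.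
  exists (r / (1 + rnorm w)); first exact: divr_gt0.
  move=> v' vv'; apply: rA; rewrite /rball /= /f opprD addrACA subrr add0r -scalerBl rnormZ.
  have : normc (v' ord0 ord0 - v ord0 ord0) < r / (1 + rnorm w).
    have := (iffLR (rnorm_ltP (v' - v) (divr_gt0 r0 w1))) vv' ord0.
    by rewrite !mxE.
  rewrite ltr_pdivlMr// mulrDr mulr1; apply: le_lt_trans.
  by rewrite lerDr -lecR; exact: (normr_ge0 (v' ord0 ord0 - v ord0 ord0)).
have cK : compact (f @` closed_rball 0 1).
  apply: continuous_compact; last exact: compact_closed_rball.
  exact: continuous_subspaceT.
have KN : f @` closed_rball 0 1 `<=` N.
  move=> _ [v v1 <-]; apply: zw.
  rewrite -[leLHS]/((normc (v ord0 ord0))%:C) lecR.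
  apply/ler_addgt0Pr => e e0; apply/ltW.
  have e1 : 0 < 1 + e by rewrite addr_gt0.
  apply: (iffLR (rnorm_ltP v e1) _ ord0).
  by move: v1; rewrite /closed_rball /= subr0 => /le_lt_trans; apply; rewrite ltrDl.
have := (iffLR (compact_near_coveringP _)) cK R 0^'+ (fun d x => rball x d `<=` N) _.
case.
  move=> x /KN; move: oN; rewrite openE => /[apply] /nbhs_rballP[e e0 eN].
  have e20 : 0 < e / 2 by exact: divr_gt0.
  exists (rball x (e / 2), [set d | d < e / 2]).
    split; first exact: nbhs_rball.
    by apply: nbhs_right_lt.
  move=> [x' d] /= [xx' de] y yx'; apply: eN; rewrite /rball /=.
  rewrite (_ : y - x = (y - x') + (x' - x)); last by rewrite addrA subrK.
  apply: le_lt_trans (rnormD _ _) _; rewrite (splitr e) ltrD//.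
  exact: lt_trans de.
move=> d /= d0 dN.
exists (d / 2); first exact: divr_gt0.
move=> y yz c c1; apply: (dN (d / 2)).
- by rewrite /ball /= sub0r normrN gtr0_norm ?divr_gt0// ltr_pdivrMr// ltr_pMr// ltr1n.
- exact: divr_gt0.
- exists (const_mx c); first last.
    by rewrite /f mxE.
  rewrite /closed_rball /= subr0; apply/ler_addgt0Pr => e e0; apply/ltW.
  apply/rnorm_ltP => [|j]; first by rewrite addr_gt0.
  rewrite mxE; move: c1; rewrite -[X in X <= _]/((normc c)%:C) lecR => /le_lt_trans; apply.
  by rewrite ltrDl.
by rewrite /rball /= opprD addrACA subrr addr0.
Qed.

(* By Fatou the circle means of [lsc_reg S] are lower semicontinuous in their
   center, so a strict lower bound for them at [z] persists on a neighbourhood,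
   where it bounds [S] and hence [lsc_reg S (z)]. *)
Lemma lsc_reg_disc_super (S : M -> \bar R) :
  measurable_fun [set: borel M] (S : borel M -> \bar R) ->
  (forall x, 0 <= S x)%E -> disc_super X S -> disc_super X (lsc_reg S).
Proof.
move=> mS S0 dS i z w zw.
pose T := lsc_reg S.
have T0 x : (0 <= T x)%E by exact: lsc_reg_ge0.
pose G y := (\int[leb]_(t in `[0%R, (2 * pi)%R])
  T (chart_inv i (y + (cos t +i* sin t) *: w))%R)%E.
have oD := @chart_map_open _ _ _ X i.
have [d d0 dD] := disc_in_near oD zw.
have DK y : rball z d y -> D i y.
  by move=> /dD /(_ 0); rewrite scale0r addr0; apply; rewrite normr0 ler01.
rewrite leNgt; apply/negP => /ereal_between[|r Tr rG]; first by rewrite mule_ge0// lee_fin ltW.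
suff [e [e0 ed eG]] : exists e, [/\ 0 < e, e <= d & forall y, rball z e y -> (r%:E < G y)%E].
  have : (((2 * pi)^-1 * r)%:E <= T (chart_inv i z))%E.
    apply: (@le_lsc_reg _ _ _ _ _ (chart_inv i @` rball z e)).
    - apply: open_chart_image; first exact: rball_open.
      by move=> y ye; apply: DK; exact: lt_le_trans ed.
    - by exists z => //; rewrite /rball /= subrr rnorm0.
    move=> _ [y ye <-].
    have yd : rball z d y by exact: lt_le_trans ed.
    rewrite -(@lee_pmul2l _ (2 * pi)%:E) ?lte_fin// -EFinM mulVKf ?gt_eqF//.
    apply: le_trans (dS i y w (dD _ yd)).
    apply: (le_trans (ltW (eG _ ye))); apply: ge0_le_integral => //.
    - apply: measurable_funTS; apply: (measurable_circle _ (dD _ yd)).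
      exact: measurable_lsc_reg.
    - by apply: measurable_funTS; apply: (measurable_circle _ (dD _ yd)).
    - by move=> t _; exact: lsc_reg_le.
  rewrite -(@lee_pmul2l _ (2 * pi)%:E) ?lte_fin// -EFinM mulVKf ?gt_eqF//.
  by rewrite leNgt Tr.
(* Failing this, there are centers [y k] tending to [z] with [G (y k) <= r]. Lower semicontinuity at
   each point of the circle and Fatou then give [G z <= r]. *)
apply: contrapT => noe.
have bad k : exists y, rball z (d / k.+1%:R) y /\ (G y <= r%:E)%E.
  apply: contrapT => noy; apply: noe; exists (d / k.+1%:R); split.
  - exact: divr_gt0.
  - by rewrite ler_pdivrMr//; apply: ler_peMr; [exact: ltW|rewrite ler1n].
  - by move=> y yk; rewrite ltNge; apply/negP => Gy; apply: noy; exists y.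
pose y k := sval (cid (bad k)).
have yz k : rball z (d / k.+1%:R) (y k) by rewrite /y; case: cid => ? [].
have Gy k : (G (y k) <= r%:E)%E by rewrite /y; case: cid => ? [].
have yd k : rball z d (y k).
  by apply: lt_le_trans (yz k) _; rewrite ler_pdivrMr//; apply: ler_peMr; [exact: ltW|rewrite ler1n].
have mT y' : rball z d y' -> measurable_fun [set: measurableTypeR R]
    (fun t => T (chart_inv i (y' + (cos t +i* sin t) *: w))).
  by move=> y'd; apply: (measurable_circle _ (dD _ y'd)); exact: measurable_lsc_reg.
have : (G z <= r%:E)%E.
  apply: (@le_trans _ _ (\int[leb]_(t in `[0%R, (2 * pi)%R])
      limn_einf (fun k => T (chart_inv i (y k + (cos t +i* sin t) *: w))%R))%E).
    apply: ge0_le_integral => //.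
    - apply: measurable_funTS; apply: mT.
      by rewrite /rball /= subrr rnorm0.
    - rewrite /limn_einf; apply: measurable_funTS; apply: measurableT_comp => //.
      apply: measurable_fun_limn_esup => k; apply: measurableT_comp => //.
      exact: mT.
    move=> t _; rewrite leNgt; apply/negP => /ereal_between[|c cl cT].
      by apply: (limn_einf_ge (N := 0%N)) => k _; exact: T0.
    move: cl; rewrite ltNge => /negP; apply.
    set p := (z + (cos t +i* sin t) *: w) in cT.
    have pD : (D i `&` chart_inv i @^-1` [set x | (c%:E < lsc_reg S x)%E]) p.
      by split=> //; apply: zw; exact: normr_cis_le1.
    have := @open_chart_preimage _ _ _ X i _ (lsc_reg_open S c).
    rewrite openE => /(_ _ pD) /nbhs_rballP[e e0 eD].
    have [N] := ltr_add_invr (divr_gt0 e0 d0).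
    rewrite add0r ltr_pdivlMr// mulrC => Ne.
    apply: (limn_einf_ge (N := N)) => k Nk; apply/ltW.
    apply: (eD _ _).2; rewrite /rball /= /p opprD addrACA subrr addr0.
    apply: lt_trans (yz k) _; apply: le_lt_trans Ne.
    by rewrite ler_wpM2l ?(ltW d0)// lef_pV2 ?posrE// ler_nat.
  apply: le_trans (fatou _ _ _ _) _ => //.
  - by move=> k; apply: measurable_funTS; exact: mT.
  - exact: limn_einf_cst_le.
by rewrite leNgt rG.
Qed.

End disc_regularization.

(** * The local estimates carried to coordinate balls of the manifold *)

Section chart_ball.
Context (R : realType) (n : nat) (M : ptopologicalType).
Variables (X : complex_manifold R n M) (V : volume_form X) (i : chart X).
Notation E := 'rV[R[i]]_n.
Notation lam := (Cn_measure (R := R) (n := n)).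
Notation inv := (chart_inv i).
Notation D := (chart_map i @` chart_dom i).
Variables (z0 : E) (b : R) (b0 : 0 < b).
Hypothesis BD : closed_rball z0 (4 * b) `<=` D.

Let b4 : 0 < 4 * b. Proof. by rewrite mulr_gt0. Qed.

Let b2 : 0 < 2 * b. Proof. by rewrite mulr_gt0. Qed.

Let subball r : r <= 4 * b -> closed_rball z0 r `<=` D.
Proof. by move=> rb z zr; apply: BD; exact: le_trans rb. Qed.

Let b_le : b <= 4 * b. Proof. by have := b0; lra. Qed.

Let b2_le : 2 * b <= 4 * b. Proof. by have := b0; lra. Qed.

(** The cut keeps the ball of radius [4 * b]. The mean inequality then holds at centers within
    [2 * b] and scales up to [b], as the discs involved stay within [3 * b]; the compactness
    argument halves [2 * b] and yields closeness on the ball of radius [b]. *)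
Definition chart_cut (s : M -> \bar R) : borel E -> \bar R :=
  (fun z => s (inv z)) \_ (rball z0 (4 * b)).

Lemma chart_cut_ge0 s : (forall x, 0 <= s x)%E -> forall z, (0 <= chart_cut s z)%E.
Proof. by move=> s0 z; rewrite /chart_cut patchE; case: ifP. Qed.

Lemma chart_cutE s z : rball z0 (4 * b) z -> chart_cut s z = s (inv z).
Proof. by move=> zb; rewrite /chart_cut patchE mem_set. Qed.

Lemma chart_cut_supermean (s : M -> \bar R) :
  measurable_fun [set: borel M] (s : borel M -> \bar R) ->
  (forall x, 0 <= s x)%E -> disc_super X s ->
  forall r w, 0 < r -> r <= b -> rball z0 (2 * b) w ->
    (hatconv r (chart_cut s) w <= hatmass n r * chart_cut s w)%E.
Proof.
move=> ms s0 ds r w r0 rb wb.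
apply: hatconv_le_supermean => //.
- exact: (measurable_chart_comp BD ms).
- exact: chart_cut_ge0.
move=> v vr.
have sub4 c : normc c <= 1 -> rball z0 (4 * b) (w + c *: v).
  move=> c1; rewrite /rball /= addrAC; apply: le_lt_trans (rnormD _ _) _.
  rewrite rnormZ; have : normc c * rnorm v <= rnorm v by rewrite ler_piMl// rnorm_ge0.
  by move: wb vr; rewrite /rball /=; move: rb b0; lra.
have wv : disc_in D w v.
  move=> c; rewrite -[leLHS]/((normc c)%:C) lecR => c1.
  by apply: BD; apply: ltW; exact: sub4.
rewrite chart_cutE; last first.
  by have := sub4 0; rewrite scale0r addr0; apply; rewrite ComplexField.Normc.normc0 ler01.
apply: le_trans (ds i w v wv); rewrite le_eqVlt; apply/orP; left; apply/eqP.
apply: eq_integral => t _; rewrite chart_cutE//.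
by apply: sub4; rewrite normc_cis.
Qed.

Let finite_mass (s : M -> \bar R) : measurable_fun [set: borel M] (s : borel M -> \bar R) ->
  (forall x, 0 <= s x)%E ->
  (\int[lam]_z chart_cut s z = \int[lam]_(z in rball z0 (4 * b)) s (inv z))%E.
Proof. by move=> ms s0; rewrite [RHS]integral_mkcond. Qed.

(** The constant is [1 / c], with [c] the lower comparison constant between volume and Lebesgue
    measure: mass at most 1 on [M] becomes Lebesgue mass at most [1 / c] in the chart. *)
Lemma chart_almost_supermean : exists2 C : R, 0 < C &
  forall s : M -> \bar R, measurable_fun [set: borel M] (s : borel M -> \bar R) ->
  (forall x, 0 <= s x)%E -> disc_super X s ->
  (\int[vol V]_(x in [set: borel M]) s x <= 1)%E ->
  forall r, 0 < r -> r <= b ->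
    almost_supermean z0 (2 * b) r C (fine \o chart_cut s).
Proof.
have [c [C' [c0 C'0 cC]]] := chart_integral_bounds b4 BD V.
exists c^-1; first by rewrite invr_gt0.
move=> s ms s0 ds s1 r r0 rb.
have mcut : measurable_fun [set: borel E] (chart_cut s) := measurable_chart_comp BD ms.
have cut0 := chart_cut_ge0 s0.
have intcut : (\int[lam]_z chart_cut s z <= (c^-1)%:E)%E.
  rewrite finite_mass// -(@lee_pmul2l _ c%:E) ?lte_fin// -EFinM mulfV ?gt_eqF//.
  have [+ _] := cC s ms s0; move=> /le_trans; apply; apply: le_trans s1.
  by apply: ge0_subset_integral => //; exact: measurable_chart_ball.
have mfine : measurable_fun [set: borel E] (fine \o chart_cut s) by exact: measurableT_comp.
(* [fine] sends +oo to 0. The cut function is integrable, so this happens only on a null set and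
   changes neither its integral nor its convolutions. *)
have aefin : {ae lam, forall z : borel E, (fine (chart_cut s z))%:E = chart_cut s z}.
  have : lam.-integrable setT (chart_cut s).
    apply/integrableP; split=> //; rewrite (eq_integral (chart_cut s)) => [|z _]; last first.
      by rewrite gee0_abs.
    by apply: le_lt_trans intcut _; rewrite ltry.
  move=> /integrable_ae => /(_ measurableT); apply: filterS => z zfin.
  by rewrite fineK// zfin.
split=> //.
- by move=> w; rewrite /= fine_ge0.
- apply: le_trans intcut; rewrite le_eqVlt; apply/orP; left; apply/eqP.
  apply: ge0_ae_eq_integral => //.
  + exact/measurable_EFinP.
  + by move=> w _; rewrite lee_fin fine_ge0.
  + by move: (aefin); apply: filterS => z ze _.
move: (aefin); apply: filterS => w we wb; rewrite /= we.
apply: le_trans (chart_cut_supermean ms s0 ds r0 rb wb).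
rewrite !hatconvE le_eqVlt; apply/orP; left; apply/eqP.
apply: ge0_ae_eq_integral => //.
- apply: measurable_hatconv_integrand; exact/measurable_EFinP.
- exact: measurable_hatconv_integrand.
- by move=> z _; rewrite mule_ge0// lee_fin ?fine_ge0 ?hat_ge0.
- by move=> z _; rewrite mule_ge0// lee_fin hat_ge0.
- by apply: filterS aefin => z ze _; rewrite /= ze.
Qed.

Lemma chart_ultra (T : Type) (F : set_system T) (FU : UltraFilter F) (K : set T)
    (s : T -> M -> \bar R) eps : F K ->
  (forall t, K t -> [/\ measurable_fun [set: borel M] (s t : borel M -> \bar R),
     (forall x, 0 <= s t x)%E, disc_super X (s t) &
     (\int[vol V]_(x in [set: borel M]) s t x <= 1)%E]) -> 0 < eps ->
  exists2 S, F S & forall t t', S t -> S t' ->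
    (\int[vol V]_(x in (inv @` rball z0 b : set (borel M)))
       `|fine (s t x) - fine (s t' x)|%:E <= eps%:E)%E.
Proof.
move=> FK sP eps0.
have [C C0 CP] := chart_almost_supermean.
have [c [C' [c0 C'0 cC']]] := chart_integral_bounds b0 (subball b_le) V.
have [t r Kt r0 rb|S FS SP] := @almost_supermean_ultra R n T F FU K (fun t => fine \o chart_cut (s t))
   z0 (2 * b) b C (eps / C') b2 b0 C0 FK _ (divr_gt0 eps0 C'0).
  by have [? ? ? ?] := sP _ Kt; exact: CP.
exists (S `&` K); first exact: filterI.
move=> t t' [St Kt] [St' Kt']; have [mt t0 _ _] := sP t Kt; have [mt' t'0 _ _] := sP t' Kt'.
have mf : measurable_fun [set: borel M]
    ((fun x => `|fine (s t x) - fine (s t' x)|%:E) : borel M -> \bar R).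
  apply/measurable_EFinP; apply: measurableT_comp => //.
  by apply: measurable_funB; exact: measurableT_comp.
have [|_ ] := cC' _ mf; first by move=> x; rewrite lee_fin.
move=> /le_trans; apply.
rewrite -(@lee_pmul2l _ C'^-1%:E) ?lte_fin ?invr_gt0// muleA -EFinM mulVf ?gt_eqF// mul1e.
rewrite -EFinM mulrC; apply: le_trans (SP t t' St St').
rewrite (_ : 2 * b / 2 = b); last by field.
rewrite le_eqVlt; apply/orP; left; apply/eqP; apply: eq_integral => z /set_mem zb.
by rewrite /= !chart_cutE//; apply: lt_le_trans zb b_le.
Qed.

(** [supermean_regularization] asks that [hatmass n r] times the regularization dominate the
    convolution. The convolution is continuous and at most [hatmass n r * S], and a continuous
    minorant of [S] stays below its regularization. *)
Lemma chart_regularization (S : M -> \bar R) :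
  measurable_fun [set: borel M] (S : borel M -> \bar R) ->
  (forall x, 0 <= S x)%E -> disc_super X S ->
  (\int[vol V]_(x in [set: borel M]) S x < +oo)%E ->
  {ae vol V, forall x : borel M, (inv @` rball z0 (2 * b)) x -> S x = lsc_reg S x}.
Proof.
move=> mS S0 dS Soo.
have [c [C [c0 C0 cC]]] := chart_integral_bounds b4 BD V.
have mcut : measurable_fun [set: borel E] (chart_cut S) := measurable_chart_comp BD mS.
have mreg := measurable_lsc_reg S.
have cut0 := chart_cut_ge0 S0.
have intcut : (\int[lam]_z chart_cut S z < +oo)%E.
  have [+ _] := cC S mS S0; rewrite -finite_mass// => h.
  rewrite ltey_eq; apply/orP; left; rewrite ge0_fin_numE ?integral_ge0//.
  rewrite ltNge leye_eq; apply/negP => /eqP cutoo.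
  move: h; rewrite cutoo mulry gtr0_sg// mul1e leye_eq => /eqP h.
  move: Soo; rewrite ltNge leye_eq => /negP; apply; rewrite -leye_eq -h.
  by apply: ge0_subset_integral => //; exact: measurable_chart_ball.
have aeE : {ae lam, forall z : borel E, rball z0 (2 * b) z ->
    chart_cut S z = chart_cut (lsc_reg S) z}.
  apply: (@supermean_regularization _ _ _ _ z0 (2 * b) b) => //.
  - exact: (measurable_chart_comp BD mreg).
  - by apply: chart_cut_ge0 => x; exact: lsc_reg_ge0.
  - by move=> w; rewrite /chart_cut !patchE; case: ifP => // _; exact: lsc_reg_le.
  move=> r w r0 rb wb.
  have w4 : rball z0 (4 * b) w by exact: lt_le_trans wb b2_le.
  rewrite [chart_cut (lsc_reg S) w]chart_cutE//.
  have /andP[m0 moo] := hat_mass_bounds n r0.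
  have mE : hatmass n r = (fine (hatmass n r))%:E by rewrite fineK// ge0_fin_numE// ltW.
  move: m0; rewrite mE lte_fin; move: (fine _) mE => m mE m0.
  have reg0 : (0 <= lsc_reg S (inv w))%E by exact: lsc_reg_ge0.
  rewrite leNgt; apply/negP => /ereal_between[|q mq qc].
    by rewrite mule_ge0// lee_fin ltW.
  have [N [oN Nw NP]] : exists N : set E, [/\ open N, N w &
      forall y, N y -> rball z0 (2 * b) y /\ (q%:E <= hatconv r (chart_cut S) y)%E].
    pose K := fine (\int[lam]_z chart_cut S z)%E.
    have KE : (\int[lam]_z chart_cut S z)%E = K%:E by rewrite fineK// ge0_fin_numE// integral_ge0.
    have K0 : 0 <= K by rewrite fine_ge0// integral_ge0.
    have K1 : 0 < 1 + K by rewrite ltr_wpDr.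
    have convE y : hatconv r (chart_cut S) y = (fine (hatconv r (chart_cut S) y))%:E.
      rewrite fineK// ge0_fin_numE; last exact: hatconv_ge0.
      apply: le_lt_trans (hatconv_le y mcut cut0 (ltW r0)) _.
      by rewrite KE -EFinM ltry.
    move: qc; rewrite convE lte_fin => qc.
    pose d := Num.min (2 * b - rnorm (w - z0))
      ((fine (hatconv r (chart_cut S) w) - q) / (1 + K)).
    have d0 : 0 < d by rewrite lt_min subr_gt0 wb divr_gt0// subr_gt0.
    exists (rball w d); split; first exact: rball_open.
      by rewrite /rball /= subrr rnorm0.
    move=> y yw; split.
      rewrite /rball /= (_ : y - z0 = (y - w) + (w - z0)); last by rewrite addrA subrK.
      apply: le_lt_trans (rnormD _ _) _.
      have : rnorm (y - w) < 2 * b - rnorm (w - z0) by apply: lt_le_trans yw _; rewrite ge_min lexx.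
      by move: (rnorm (y - w)) (rnorm (w - z0)) => ? ?; lra.
    have := hatconv_lip mcut cut0 r w y.
    rewrite KE convE (convE y) rnormB.
    have : rnorm (y - w) * (1 + K) < fine (hatconv r (chart_cut S) w) - q.
      by rewrite -ltr_pdivlMr//; apply: lt_le_trans yw _; rewrite ge_min lexx orbT.
    have := rnorm_ge0 (y - w).
    move: (fine _) (fine _) (rnorm _) => x1 x2 x3.
    rewrite -EFinM -EFinD !lee_fin mulrDr mulr1 => ? ? ?; lra.
  move: mq; rewrite ltNge => /negP; apply.
  have : ((m^-1 * q)%:E <= lsc_reg S (inv w))%E.
    apply: (@le_lsc_reg _ _ _ _ _ (inv @` N)).
    - apply: open_chart_image => // y /NP[yb _]; apply: (subball b2_le).
      exact: ltW.
    - by exists w.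
    move=> _ [y Ny <-]; have [yb qy] := NP _ Ny.
    rewrite -(@lee_pmul2l _ m%:E) ?lte_fin// -EFinM mulVKf ?gt_eqF//.
    apply: (le_trans qy); have := chart_cut_supermean mS S0 dS r0 rb yb.
    by rewrite mE chart_cutE//; exact: lt_le_trans yb b2_le.
  by rewrite -(@lee_pmul2l _ m%:E) ?lte_fin// -EFinM mulVKf ?gt_eqF.
(* The exceptional set is null in the chart; the upper volume bound makes its image null in [M]. *)
have [c2 [C2 [_ C20 cC2]]] := chart_volume_bounds b2 (subball b2_le) V.
have mA : measurable ([set x | S x != lsc_reg S x] : set (borel M)).
  by rewrite -[X in measurable X]setTI; exact: measurable_neqe.
have [_ volA] := cC2 _ mA.
have mQ := measurable_chart_ball (subball b2_le).
have mg := measurable_chart_inv_on (@rball_open _ _ z0 (2 * b))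
  (fun z (zb : rball z0 (2 * b) z) => subball b2_le (ltW zb)).
have mgA : measurable (rball z0 (2 * b) `&`
    chart_inv_on i (rball z0 (2 * b)) @^-1` [set x | S x != lsc_reg S x] : set (borel E)).
  apply: measurableI; first exact: measurable_rball.
  by rewrite -[X in measurable X]setTI; apply: mg.
have lam0 : lam (rball z0 (2 * b) `&`
    chart_inv_on i (rball z0 (2 * b)) @^-1` [set x | S x != lsc_reg S x]) = 0%E.
  apply/measure_negligible => //.
  apply: negligibleS aeE => z [zb] /=; rewrite chart_inv_onE// => /eqP Sz.
  move=> /(_ zb); have z4 : rball z0 (4 * b) z by exact: lt_le_trans zb b2_le.
  by rewrite !chart_cutE.
exists (inv @` rball z0 (2 * b) `&` [set x | S x != lsc_reg S x]); split.
- exact: measurableI.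
- by apply/eqP; rewrite eq_le measure_ge0 andbT; move: volA; rewrite lam0 mule0.
move=> x /= /not_implyP[xQ /eqP Sx]; split=> //.
Qed.

End chart_ball.

(** * Compactness in L^1 *)

Section metric_compactness.
Context (R : realType) (T : metricType R).

(** Total boundedness and completeness, in the form in which the two halves of the argument supply
    them. The points [u k] are picked in decreasing members of the ultrafilter of diameter at most
    [2^-1 ^+ k], which makes the sequence rapidly convergent. *)
Lemma compact_ultra_cauchy (K : set T) :
  (forall F : set_system T, UltraFilter F -> F K -> forall e, 0 < e ->
     exists2 S, F S & forall x y, S x -> S y -> mdist x y <= e) ->
  (forall u : nat -> T, (forall k, K (u k)) ->
     (forall k, mdist (u k) (u k.+1) <= 2^-1 ^+ k) ->
     exists2 l, K l & forall k, mdist (u k) l <= 2 * 2^-1 ^+ k) ->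
  compact K.
Proof.
move=> cauchyK cvgK; rewrite compact_ultra => F FU FK.
have e0 k : 0 < 2^-1 ^+ k :> R by rewrite exprn_gt0// invr_gt0.
pose S k := s2val (cid2 (cauchyK F FU FK _ (e0 k))).
have FS k : F (S k) by rewrite /S; case: cid2.
have SP k x y : S k x -> S k y -> mdist x y <= 2^-1 ^+ k.
  by rewrite /S; case: cid2 => /= ? _; apply.
pose fix W k := if k is k'.+1 then W k' `&` S k else K `&` S 0%N.
have FW k : F (W k) by elim: k => [|k IHk] /=; exact: filterI.
have WK k : W k `<=` K.
  by elim: k => [|k IHk] x /= [+ _]; [|exact: IHk].
have WS k : W k `<=` S k by case: k => [|k] x [].
have W0 k : W k !=set0 by exact: (filter_ex (FW k)).
pose u k := sval (cid (W0 k)).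
have Wu k : W k (u k) by rewrite /u; case: cid.
have [k|k|l Kl ul] := cvgK u; first exact: WK (Wu k).
  by apply: (SP k); apply: WS => //; have [] := Wu k.+1.
exists l; split=> //= A /nbhs_ballP[e /= e_gt0 eA].
(* The factor is 2 + 1: the limit is within [2 * 2^-1 ^+ k] of [u k], and [S k] adds its diameter
   [2^-1 ^+ k]. *)
have [k ke] : exists k, 3 * 2^-1 ^+ k < e.
  have /cvgrPdist_lt /(_ (e / 3)) : 2^-1 ^+ k @[k --> \oo] --> (0 : R).
    by apply: cvg_expr; rewrite ger0_norm ?invr_ge0// invf_lt1// ltr1n.
  move=> /(_ (divr_gt0 e_gt0 (ltr0n R 3))) [k _ /(_ k (leqnn k))] /=.
  rewrite sub0r normrN gtr0_norm ?e0// => ke; exists k.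
  by rewrite mulrC -ltr_pdivlMr.
apply: filterS (FS k) => y Sy; apply: eA; rewrite ballEmdist /=.
apply: le_lt_trans ke; apply: le_trans (metric_triangle l (u k) y) _.
rewrite metric_sym; have := ul k; have := SP k (u k) y (WS _ _ (Wu k)) Sy.
by move: (mdist _ _) (mdist _ _) (2^-1 ^+ k) => ? ? ?; lra.
Qed.

End metric_compactness.

Section L1_lemmas.
Context d (T : measurableType d) (R : realType).
Variable mu : {measure set T -> \bar R}.
Implicit Types f g : L1 mu.

Lemma measurable_L1_fun f : measurable_fun [set: T] (L1_fun f).
Proof. exact: (@measurable_funPT _ _ _ _ (repr (f : {mfun_ mu, T >-> _}))). Qed.

Lemma L1_normE f : ('N[mu]_1[EFin \o L1_fun f] = \int[mu]_x `|L1_fun f x|%:E)%E.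
Proof. by rewrite Lnorm1. Qed.

Lemma L1_norm_lty f : (\int[mu]_x `|L1_fun f x|%:E < +oo)%E.
Proof. by rewrite -L1_normE; exact: (@Lebesgue_finite _ _ _ _ _ _ f). Qed.

Lemma L1_integral_dist f g :
  (L1_dist f g)%:E = (\int[mu]_x `|L1_fun f x - L1_fun g x|%:E)%E.
Proof.
have mf := measurable_L1_fun f; have mg := measurable_L1_fun g.
have mabs (h : T -> R) : measurable_fun [set: T] h -> measurable_fun [set: T] (fun x => `|h x|).
  by move=> mh; exact: measurableT_comp.
rewrite /L1_dist Lnorm1 fineK// ge0_fin_numE ?integral_ge0//=.
apply: (@le_lt_trans _ _ (\int[mu]_x (`|L1_fun f x| + `|L1_fun g x|)%:E)%E).
  apply: ge0_le_integral => //.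
  - by apply/measurable_EFinP; apply: mabs; exact: measurable_funB.
  - by apply/measurable_EFinP; apply: measurable_funD; exact: mabs.
  - by move=> x _; rewrite lee_fin ler_normB.
rewrite ge0_integral_EFinD//; try exact: mabs.
by apply: lte_add_pinfty; exact: L1_norm_lty.
Qed.

(** An element of [L1 mu] is a class with a chosen representative, so the class of [h] returns [h]
    only almost everywhere. *)
Lemma ex_L1 (h : T -> R) : measurable_fun [set: T] h ->
  (\int[mu]_x `|h x|%:E < +oo)%E ->
  exists f, {ae mu, forall x, L1_fun f x = h x}.
Proof.
move=> mh hoo.
pose H : {mfun T >-> measurableTypeR R} := HB.pack (h : T -> measurableTypeR R)
  (isMeasurableFun.Build _ _ _ _ (h : T -> measurableTypeR R) mh).
pose q : {mfun_ mu, T >-> measurableTypeR R} := (\pi_({mfun_ mu, T >-> measurableTypeR R}) H)%qT.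
have qh : {ae mu, forall x, (q : T -> R) x = h x}.
  have /eqmodP /asboolP : repr q = H %[mod {mfun_ mu, T >-> measurableTypeR R}]%qT.
    by rewrite reprK.
  by apply: filterS => x /(_ I).
have mq : measurable_fun [set: T] (q : T -> R) by exact: (@measurable_funPT _ _ _ _ (repr q)).
have qoo : finite_norm mu 1 q.
  rewrite /finite_norm Lnorm1; apply: le_lt_trans hoo.
  rewrite le_eqVlt; apply/orP; left; apply/eqP; apply: ge0_ae_eq_integral => //.
  - by apply: measurableT_comp => //; exact/measurable_EFinP.
  - by apply/measurable_EFinP; exact: measurableT_comp.
  - by apply: filterS qh => x qx _; rewrite /= qx.
pose f : L1 mu := HB.pack q (isFinLebesgue.Build _ _ _ mu 1%E (@lexx _ _ 1%E) q qoo).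
by exists f.
Qed.

End L1_lemmas.

Lemma ge0_integral_setU_le d (T : measurableType d) (R : realType)
    (mu : {measure set T -> \bar R}) (A B : set T) (f : T -> \bar R) :
  measurable A -> measurable B -> measurable_fun [set: T] f ->
  (forall x, 0 <= f x)%E ->
  (\int[mu]_(x in A `|` B) f x <= \int[mu]_(x in A) f x + \int[mu]_(x in B) f x)%E.
Proof.
move=> mA mB mf f0; have mBA := measurableD mB mA.
rewrite (_ : A `|` B = A `|` (B `\` A)); last first.
  by apply/seteqP; split=> x /=; have [] := pselect (A x); tauto.
rewrite ge0_integral_setU//.
- by rewrite leeD2l//; apply: ge0_subset_integral => //; exact: measurable_funTS.
- exact: measurable_funTS.
- by apply/disj_set2P; rewrite setDE setICA setICr setI0.
Qed.

(** * Countable covers by coordinate balls *)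

Section coordinate_balls.
Context (R : realType) (n : nat) (M : ptopologicalType).
Variable X : complex_manifold R n M.
Notation E := 'rV[R[i]]_n.

(** The ball of radius [cb_radius] serves for covering; the factor 4 is the room that the local
    estimates need around it. *)
Record coordinate_ball := CoordinateBall {
  cb_chart : chart X;
  cb_center : E;
  cb_radius : R;
  cb_radius_gt0 : 0 < cb_radius;
  cb_sub : closed_rball cb_center (4 * cb_radius) `<=`
           chart_map cb_chart @` chart_dom cb_chart
}.

Definition cb_set (k : coordinate_ball) : set M :=
  chart_inv (cb_chart k) @` rball (cb_center k) (cb_radius k).

Let cb_sub1 (k : coordinate_ball) : closed_rball (cb_center k) (cb_radius k) `<=`
  chart_map (cb_chart k) @` chart_dom (cb_chart k).
Proof.
move=> z zk; apply: cb_sub; apply: le_trans zk _.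
by have := cb_radius_gt0 k; lra.
Qed.

Lemma cb_set_open k : open (cb_set k).
Proof.
apply: open_chart_image; first exact: rball_open.
by move=> z zk; apply: cb_sub1; exact: ltW.
Qed.

Lemma cb_set_precompact k : precompact (cb_set k).
Proof.
apply: (@precompact_subset _ _ (chart_inv (cb_chart k) @`
    closed_rball (cb_center k) (cb_radius k))).
  by move=> _ [z zk <-]; exists z => //; exact: ltW.
apply: compact_precompact; first exact: manifold_hausdorff X.
apply: continuous_compact; last exact: compact_closed_rball.
apply: continuous_subspaceW (@cb_sub1 k) _.
exact: chart_inv_continuous.
Qed.

Lemma coordinate_ball_at x (U : set M) : open U -> U x -> exists2 k, cb_set k x & cb_set k `<=` U.
Proof.
move=> oU Ux; have : [set: M] x by [].
rewrite -(chart_dom_cover X) => -[i _ dx].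
pose D := chart_map i @` chart_dom i.
have Dx : (D `&` chart_inv i @^-1` U) (chart_map i x).
  by split; [exists x|rewrite /= chart_mapK].
have := @open_chart_preimage _ _ _ X i _ oU; rewrite openE => /(_ _ Dx) /nbhs_rballP[r r0 rD].
have r8 : 0 < r / 8 by exact: divr_gt0.
have r48 : 4 * (r / 8) < r by lra.
have r18 : r / 8 < r by lra.
have sub : closed_rball (chart_map i x) (4 * (r / 8)) `<=` D.
  by move=> z zr; have [] := rD z (le_lt_trans zr r48).
exists (CoordinateBall r8 sub); rewrite /cb_set /=.
  by exists (chart_map i x); [rewrite /rball /= subrr rnorm0|exact: chart_mapK].
by move=> _ [z zr <-]; have [] := rD z (lt_trans zr r18).
Qed.

(** Lindelof's argument: the members of a countable base that lie in some coordinate ball already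
    cover [M], and one ball is chosen for each of them. *)
Lemma countable_coordinate_cover :
  exists k : nat -> coordinate_ball, \bigcup_j cb_set (k j) = [set: M].
Proof.
have [B cB [oB bB]] := manifold_second_countable X.
pose B' := [set W | B W /\ exists k, W `<=` cb_set k].
have B'cover x : exists2 W, B' W & W x.
  have [k kx _] := @coordinate_ball_at x setT openT I.
  have [W [BW Wx] Wk] := bB x _ (open_nbhs_nbhs (conj (cb_set_open k) kx)).
  by exists W => //; split=> //; exists k.
have cB' : countable B' by apply: sub_countable cB; apply: subset_card_le => W [].
have /pfcard_geP[B'0|[f]] := cB'.
  by have [W + _] := B'cover point; rewrite B'0.
have fP j : exists k, f j `<=` cb_set k by have [] := @funS _ _ _ _ f j I.
exists (fun j => sval (cid (fP j))).
apply/seteqP; split=> // x _; have [W B'W Wx] := B'cover x.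
have [j _ fj] := 'surj_f B'W; exists j => //.
by case: cid => k /= fk; apply: fk; rewrite fj.
Qed.

Section exhaustion.
Variable k : nat -> coordinate_ball.
Hypothesis kcover : \bigcup_j cb_set (k j) = [set: M].

Fixpoint cb_exhaustion (j : nat) : set M :=
  if j is j'.+1 then cb_exhaustion j' `|` cb_set (k j) else cb_set (k 0%N).

Lemma cb_exhaustionP : exhaustion cb_exhaustion.
Proof.
split.
- by elim=> [|j IHj]; [exact: cb_set_open|apply: openU => //; exact: cb_set_open].
- elim=> [|j IHj] /=; first exact: cb_set_precompact.
  rewrite precompactE closureU; apply: compactU; rewrite -precompactE//.
  exact: cb_set_precompact.
- by move=> j; exact: subsetUl.
apply/seteqP; split=> // x _; have : [set: M] x by [].
rewrite -kcover => -[j _ jx]; exists j => //.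
by case: j jx => [//|j] jx; right.
Qed.

Lemma integral_cb_exhaustion (mu : {measure set (borel M) -> \bar R}) (f : borel M -> \bar R) e j :
  measurable_fun [set: borel M] f -> (forall x, 0 <= f x)%E ->
  (forall l, (l <= j)%N -> (\int[mu]_(x in (cb_set (k l) : set (borel M))) f x <= e%:E)%E) ->
  (\int[mu]_(x in (cb_exhaustion j : set (borel M))) f x <= (e *+ j.+1)%:E)%E.
Proof.
move=> mf f0; have mo (U : set M) : open U -> measurable (U : set (borel M)) by exact: open_borel.
have mQ l : measurable (cb_set (k l) : set (borel M)) by apply: mo; exact: cb_set_open.
elim: j => [|j IHj] fe; first by rewrite mulr1n; exact: fe.
have mU : measurable (cb_exhaustion j : set (borel M)).
  by apply: mo; have [] := cb_exhaustionP.
apply: le_trans (ge0_integral_setU_le _ mU (mQ j.+1) mf f0) _.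
rewrite mulrSr EFinD; apply: leeD; last exact: fe.
by apply: IHj => l lj; apply: fe; exact: leqW.
Qed.

End exhaustion.
End coordinate_balls.

(** Convergence of [h] is not presupposed: if the sum of the increments is finite, all later terms
    lie within it of [h j], hence so does the lower limit. *)
Lemma dist_limn_einf_le (R : realType) (h : R^nat) (l : R) j :
  limn_einf (fun k => (h k)%:E) = l%:E ->
  (`|h j - l|%:E <= \sum_(0 <= m <oo) `|h (j + m)%N - h (j + m).+1|%:E)%E.
Proof.
move=> hl; set G := (X in (_ <= X)%E).
have d N : (`|h j - h (j + N)%N|%:E <= G)%E.
  apply: le_trans (nneseries_lim_ge N _) => //.
  elim: N => [|N IHN]; first by rewrite addn0 subrr normr0 big_geq.
  rewrite big_nat_recr//= addnS; apply: le_trans (leeD IHN (lexx _)).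
  by rewrite -EFinD lee_fin -(subrKA (h (j + N)%N)) ler_normD.
have : (0 <= G)%E by apply: nneseries_ge0.
move: G d => [g| |] d //; rewrite ?leey// => _.
have dh k : (j <= k)%N -> `|h j - h k| <= g.
  by move=> jk; have := d (k - j)%N; rewrite subnKC// lee_fin.
rewrite lee_fin ler_distl; apply/andP; split; last first.
  have : ((h j - g)%:E <= l%:E)%E; last by rewrite lee_fin; lra.
  rewrite -hl; apply: (limn_einf_ge (N := j)) => k /dh.
  by rewrite lee_fin ler_norml => /andP[]; lra.
have : (l%:E <= (h j + g)%:E)%E; last by rewrite lee_fin; lra.
rewrite -hl leNgt; apply/negP => /lt_limn_einf[N hN].
have := hN _ (leq_maxr j N); have := dh _ (leq_maxl j N).
by rewrite lte_fin ler_norml => /andP[]; lra.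
Qed.

(** The pointwise bound by the sum of the increments is integrated term by term and leaves a
    geometric series. The signs come from passing to opposites of negative functions. *)
Lemma L1_dist_limn_einf_le d (T : measurableType d) (R : realType)
    (mu : {measure set T -> \bar R}) (c : nat -> L1 mu) (f : L1 mu) :
  (forall j, L1_dist (c j) (c j.+1) <= 2^-1 ^+ j) ->
  {ae mu, forall x, limn_einf (fun k => (- L1_fun (c k) x)%:E) = (- L1_fun f x)%:E} ->
  forall j, L1_dist (c j) f <= 2 * 2^-1 ^+ j.
Proof.
move=> cdist cf j.
have mdist' g g' : measurable_fun [set: T] (fun x => `|L1_fun g x - L1_fun g' x|%:E).
  apply/measurable_EFinP; apply: measurableT_comp => //.
  by apply: measurable_funB; exact: measurable_L1_fun.
pose G x := (\sum_(0 <= m <oo) `|L1_fun (c (j + m)%N) x - L1_fun (c (j + m).+1) x|%:E)%E.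
rewrite -lee_fin L1_integral_dist.
apply: (@le_trans _ _ (\int[mu]_x G x)%E).
  apply: ae_ge0_le_integral => //.
  - by move=> x _; apply: nneseries_ge0.
  - by apply: ge0_emeasurable_sum.
  - have G_opp x : G x =
        (\sum_(0 <= m <oo) `|- L1_fun (c (j + m)%N) x - - L1_fun (c (j + m).+1) x|%:E)%E.
      by apply: eq_eseriesr => m _; rewrite -opprD normrN.
    move: cf; apply: filterS => x cfx _.
    by have := dist_limn_einf_le j cfx; rewrite -opprD normrN G_opp.
rewrite integral_nneseries//.
apply: lime_le; first by apply: is_cvg_nneseries => m _ _; rewrite integral_ge0.
apply: nearW => N.
(* The exact geometric partial sum, which unlike the final bound can be proved by induction on
   [N]. *)
apply: (@le_trans _ _ (2 * 2^-1 ^+ j - 2 * 2^-1 ^+ (j + N))%:E); last first.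
  by rewrite lee_fin gerBl mulr_ge0// exprn_ge0// invr_ge0.
elim: N => [|N IHN]; first by rewrite addn0 subrr big_geq.
rewrite big_nat_recr//= -L1_integral_dist; apply: le_trans (leeD IHN (lexx _)) _.
rewrite -EFinD lee_fin addnS exprS; apply: le_trans (lerD (lexx _) (cdist _)) _.
by move: (2^-1 ^+ j) (2^-1 ^+ (j + N)) => p q; lra.
Qed.

Lemma fine_dist_le (R : realType) (a b : \bar R) : (0 <= a)%E -> (0 <= b)%E ->
  (`|fine a - fine b|%:E <= a + b)%E.
Proof.
move: a b => [a| |] [b| |] //= a0 b0; rewrite ?leey// -EFinD lee_fin.
rewrite !lee_fin in a0 b0.
by rewrite ler_norml; apply/andP; split; lra.
Qed.

(** * Negative plurisubharmonic functions *)

Section negative_psh_compact.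
Context (R : realType) (n : nat) (M : ptopologicalType).
Variables (X : complex_manifold R n M) (V : volume_form X).
Notation mu := (vol V).
Notation K := (negative_psh1 V).

Lemma negative_psh_super u : negative_psh X u ->
  [/\ measurable_fun [set: borel M] ((fun x => - u x)%E : borel M -> \bar R),
      forall x, (0 <= - u x)%E & disc_super X (fun x => - u x)%E].
Proof.
move=> [pu u0 _]; split.
- by apply: measurableT_comp => //; exact: psh_measurable pu.
- by move=> x; rewrite oppe_ge0.
- exact: psh_disc_super.
Qed.

(** Chooses a plurisubharmonic representative for all classes at once, because the ultrafilter
    argument needs it as a function of the class. Outside the set in question the choice is the
    constant 0. *)
Lemma negative_psh1_rep : exists u : L1 mu -> M -> \bar R, forall f, K f ->
  [/\ negative_psh X (u f),
      {ae mu, forall x : borel M, L1_fun f x = fine (u f x)},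
      {ae mu, forall x : borel M, (L1_fun f x)%:E = u f x} &
      (\int[mu]_(x in [set: borel M]) - u f x <= 1)%E].
Proof.
pose u (f : L1 mu) : M -> \bar R :=
  if pselect (K f) is left Kf then s2val (cid2 Kf.1) else cst 0%E.
exists u => f Kf.
have [pu ae] : negative_psh X (u f) /\ {ae mu, forall x : borel M, (L1_fun f x)%:E = u f x}.
  by rewrite /u; case: pselect => // -[Kf1 Kf2]; case: cid2.
split=> //; first by move: (ae); apply: filterS => x <-.
have [mu' u0 _] := negative_psh_super pu.
apply: le_trans Kf.2; rewrite L1_normE le_eqVlt; apply/orP; left; apply/eqP.
apply: ge0_ae_eq_integral => //.
  by apply/measurable_EFinP; apply: measurableT_comp => //; exact: measurable_L1_fun.
move: (ae); apply: filterS => x xe _; rewrite -[LHS]gee0_abs//.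
by rewrite abseN -xe.
Qed.

Lemma vol_setT_gt0 : (0 < mu [set: borel M])%E.
Proof.
have [k _ _] := @coordinate_ball_at R n M X point setT openT I.
have b4 : 0 < 4 * cb_radius k by rewrite mulr_gt0// cb_radius_gt0.
have [c [C [c0 _ cC]]] := chart_volume_bounds b4 (@cb_sub _ _ _ _ k) V.
have [+ _] := cC setT measurableT; rewrite preimage_setT !setIT => h.
have mQ := measurable_chart_ball (@cb_sub _ _ _ _ k).
apply: lt_le_trans (le_measure mu _ _ (@subsetT _ _)); rewrite ?inE//; last exact: mQ.
apply: lt_le_trans h; rewrite mule_gt0 ?lte_fin//.
by have /andP[] := Cn_measure_rball (cb_center k) b4.
Qed.

Hypothesis V_norming : norming V.

Lemma negative_psh1_cauchy (F : set_system (L1 mu)) : UltraFilter F -> F K ->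
  forall e, 0 < e -> exists2 S, F S & forall f g, S f -> S g -> L1_dist f g <= e.
Proof.
move=> FU FK e e0; have [u uP] := negative_psh1_rep.
have [k kcover] := @countable_coordinate_cover R n M X.
have [_ _ /(_ _ (cb_exhaustionP kcover))[eps [eps0 epscvg epsP]]] := V_norming.
(* Outside the exhaustion set the distance is at most the sum of two tails, so a quarter each leaves
   [e / 2] for the inside, which [d] shares among its [j + 1] balls. *)
have [j epsj] : exists j, eps j < e / 4.
  have /cvgrPdist_lt /(_ (e / 4)) := epscvg.
  move=> /(_ (divr_gt0 e0 (ltr0n R 4)))[j _ /(_ j (leqnn j))] /=.
  by rewrite sub0r normrN gtr0_norm// => ?; exists j.
pose d := e / 2 / j.+1%:R.
have d0 : 0 < d by rewrite !divr_gt0.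
have localS l : exists2 S, F S & forall f g, S f -> S g ->
    (\int[mu]_(x in (cb_set (k l) : set (borel M)))
       `|fine (- u f x) - fine (- u g x)|%:E <= d%:E)%E.
  apply: (@chart_ultra R n M X V _ _ _ (cb_radius_gt0 (k l)) (@cb_sub _ _ _ _ (k l))
    _ F FU K (fun f x => - u f x)%E d FK _ d0) => f /uP[pu _ _ u1].
  by have [] := negative_psh_super pu.
have [S FS SP] : exists2 S, F S & forall l f g, (l <= j)%N -> S f -> S g ->
    (\int[mu]_(x in (cb_set (k l) : set (borel M)))
       `|fine (- u f x) - fine (- u g x)|%:E <= d%:E)%E.
  elim: (j) => [|j' [S FS SP]].
    have [S FS SP] := localS 0%N; exists S => // l f g.
    by rewrite leqn0 => /eqP ->; exact: SP.
  have [S' FS' S'P] := localS j'.+1; exists (S `&` S'); first exact: filterI.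
  move=> l f g; rewrite leq_eqVlt => /orP[/eqP ->|lj'] [Sf S'f] [Sg S'g].
    exact: S'P.
  exact: SP.
exists (S `&` K); first exact: filterI.
move=> f g [Sf Kf] [Sg Kg].
have [pf aef _ f1] := uP f Kf; have [pg aeg _ g1] := uP g Kg.
have [mf f0 _] := negative_psh_super pf; have [mg g0 _] := negative_psh_super pg.
pose h (x : borel M) : \bar R := `|fine (- u f x) - fine (- u g x)|%:E.
have mh : measurable_fun [set: borel M] h.
  apply/measurable_EFinP; apply: measurableT_comp => //.
  by apply: measurable_funB; exact: measurableT_comp.
have h0 x : (0 <= h x)%E by rewrite lee_fin.
have mU : measurable (cb_exhaustion k j : set (borel M)).
  by apply: open_borel; have [] := cb_exhaustionP kcover.
rewrite -lee_fin L1_integral_dist.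
have -> : (\int[mu]_x `|L1_fun f x - L1_fun g x|%:E = \int[mu]_x h x)%E.
  apply: ge0_ae_eq_integral => //.
    apply/measurable_EFinP; apply: measurableT_comp => //.
    by apply: measurable_funB; exact: measurable_L1_fun.
  move: aef aeg; apply: filterS2 => x -> -> _.
  by rewrite /h !fineN -opprD normrN.
rewrite -(setUv (cb_exhaustion k j)).
apply: le_trans (ge0_integral_setU_le _ mU (measurableC mU) mh h0) _.
rewrite (splitr e) EFinD; apply: leeD.
  have -> : e / 2 = d *+ j.+1.
    by rewrite -[RHS]mulr_natr /d divfK// pnatr_eq0.
  apply: (integral_cb_exhaustion kcover) => // l lj.
  exact: SP.
have tail v : negative_psh X v -> (\int[mu]_(x in [set: borel M]) - v x <= 1)%E ->
    (\int[mu]_(x in (~` cb_exhaustion k j : set (borel M))) - v x <= (e / 4)%:E)%E.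
  move=> pv v1; have [mv v0 _] := negative_psh_super pv.
  have absv x : (- v x = `|v x|)%E by rewrite -abseN gee0_abs.
  have := epsP v pv j; rewrite /L1norm /L1norm_on.
  under eq_integral do rewrite -absv; move=> /le_trans; apply.
  apply: (@le_trans _ _ ((eps j)%:E * 1)%E).
    rewrite lee_wpmul2l ?lee_fin ?(ltW (eps0 j))//.
    by under eq_integral do rewrite -absv.
  by rewrite mule1 lee_fin ltW.
have mCU := measurableC mU.
apply: (@le_trans _ _ (\int[mu]_(x in (~` cb_exhaustion k j : set (borel M))) (- u f x + - u g x))%E).
  apply: ge0_le_integral => //.
  - exact: measurable_funTS.
  - by apply: measurable_funTS; exact: emeasurable_funD.
  - by move=> x _; exact: fine_dist_le.
rewrite ge0_integralD//; [|exact: measurable_funTS|exact: measurable_funTS].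
have -> : (e / 2)%:E = ((e / 4)%:E + (e / 4)%:E)%E by rewrite -EFinD; congr _%:E; lra.
by apply: leeD; exact: tail.
Qed.

Lemma negative_psh1_complete (c : nat -> L1 mu) : (forall j, K (c j)) ->
  (forall j, L1_dist (c j) (c j.+1) <= 2^-1 ^+ j) ->
  exists2 f, K f & forall j, L1_dist (c j) f <= 2 * 2^-1 ^+ j.
Proof.
move=> Kc cdist; have [u uP] := negative_psh1_rep.
pose s j (x : M) : \bar R := (- u (c j) x)%E.
have sP j : [/\ measurable_fun [set: borel M] (s j : borel M -> \bar R),
    forall x, (0 <= s j x)%E, disc_super X (s j) &
    (\int[mu]_(x in [set: borel M]) s j x <= 1)%E].
  by have [pu _ _ u1] := uP _ (Kc j); have [] := negative_psh_super pu.
have ms j : measurable_fun [set: borel M] (s j : borel M -> \bar R) by have [] := sP j.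
have s0 j x : (0 <= s j x)%E by have [] := sP j.
pose S x := limn_einf (s ^~ x).
have S0 x : (0 <= S x)%E by apply: (limn_einf_ge (N := 0%N)).
have mS : measurable_fun [set: borel M] (S : borel M -> \bar R).
  rewrite /S /limn_einf; apply: measurableT_comp => //.
  by apply: measurable_fun_limn_esup => j; apply: measurableT_comp.
have dS : disc_super X S by apply: disc_super_limn_einf => // j; have [] := sP j.
have S1 : (\int[mu]_(x in [set: borel M]) S x <= 1)%E.
  apply: le_trans (fatou _ _ _ _) _ => //.
  by apply: limn_einf_cst_le => j; have [] := sP j.
have Soo : (\int[mu]_(x in [set: borel M]) S x < +oo)%E by rewrite (le_lt_trans S1)// ltry.
pose T := lsc_reg S.
have T0 x : (0 <= T x)%E by exact: lsc_reg_ge0.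
have mT : measurable_fun [set: borel M] (T : borel M -> \bar R) := measurable_lsc_reg S.
have [k kcover] := @countable_coordinate_cover R n M X.
(* The local statements combine because countably many balls cover [M]. *)
have aeST : {ae mu, forall x : borel M, S x = T x}.
  have : {ae mu, forall x : borel M, forall l, cb_set (k l) x -> S x = T x}.
    apply/ae_foralln => l.
    have := chart_regularization (cb_radius_gt0 (k l)) (@cb_sub _ _ _ _ (k l)) mS S0 dS Soo.
    apply: filterS => x xS [z zk zx]; apply: xS; exists z => //.
    apply: lt_trans zk _; have := cb_radius_gt0 (k l); lra.
  apply: filterS => x xk; have : [set: M] x by [].
  by rewrite -kcover => -[l _ /xk].
have aeSfin : {ae mu, forall x : borel M, S x \is a fin_num}.
  have : mu.-integrable setT (S : borel M -> \bar R).
    apply/integrableP; split=> //; rewrite (eq_integral (S : borel M -> \bar R)) => [//|x _].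
    by rewrite gee0_abs.
  by move=> /integrable_ae => /(_ measurableT); apply: filterS => x; exact.
pose h (x : borel M) : R := - fine (T x).
have mh : measurable_fun [set: borel M] h by do 2 apply: measurableT_comp => //.
have hint : (\int[mu]_x `|h x|%:E <= 1)%E.
  apply: le_trans S1; apply: ge0_le_integral => //.
    by apply/measurable_EFinP; exact: measurableT_comp.
  move=> x _; rewrite /h normrN ger0_norm ?fine_ge0//.
  apply: le_trans (lsc_reg_le S x); rewrite -/T.
  by case: (T x) (T0 x) => [r| |] //= _; rewrite leey.
have [f fh] := ex_L1 mh (le_lt_trans hint (ltry 1)).
exists f.
  split.
    exists (fun x => - T x)%E.
      split.
      - apply: disc_super_psh => //; first exact: lsc_reg_open.
        exact: lsc_reg_disc_super.
      - by move=> x; rewrite oppe_le0.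
      (* If [T] were +oo everywhere, so would be [S], and its integral over [M], whose volume is
         positive, would be infinite. *)
      - apply: contrapT => noT.
        have Too x : S x = +oo%E.
          apply/eqP; rewrite -leye_eq; apply: le_trans (lsc_reg_le S x).
          rewrite leye_eq; apply/negP => Tx; apply: noT; exists x.
          by rewrite eqe_oppLR /=; exact/negP.
        move: Soo; under eq_integral do rewrite Too.
        rewrite integral_cst// gt0_mulye ?ltxx//.
        exact: vol_setT_gt0.
    move: fh aeST aeSfin; apply: filterS3 => x -> ST Sfin.
    by rewrite /h EFinN fineK// -ST.
  rewrite /= L1_normE.
  have -> : (\int[mu]_x `|L1_fun f x|%:E = \int[mu]_x `|h x|%:E)%E.
    apply: ge0_ae_eq_integral => //.
    - by apply/measurable_EFinP; apply: measurableT_comp => //; exact: measurable_L1_fun.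
    - by apply/measurable_EFinP; exact: measurableT_comp.
    - by move: fh; apply: filterS => x ->.
  exact: hint.
apply: (L1_dist_limn_einf_le cdist).
have cu : {ae mu, forall x : borel M, forall k, (L1_fun (c k) x)%:E = u (c k) x}.
  by apply/ae_foralln => l; have [] := uP _ (Kc l).
have ST : {ae mu, forall x : borel M, (- L1_fun f x)%:E = S x}.
  move: fh aeST aeSfin; apply: filterS3 => x -> ST Sfin.
  by rewrite /h opprK fineK -ST.
move: cu ST; apply: filterS2 => x cux ->; congr limn_einf.
by apply/funext => l; rewrite EFinN cux.
Qed.

End negative_psh_compact.

Theorem theorem5p4 (R : realType) (n : nat) (M : ptopologicalType)
    (X : complex_manifold R n M) (V : volume_form X)
    (M_connected : connected [set: M]) (V_norming : norming V) :
  compact (negative_psh1 V).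
Proof.
apply: compact_ultra_cauchy.
  exact: negative_psh1_cauchy.
exact: negative_psh1_complete.
Qed.
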